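(* Let $d\in\{1,2\}$, $\rho_1:=1$, $\rho_2:=\frac12$, and let $\mu_\ast>0$ be a constant. Let $\alpha,\mu,p,q$ satisfy $$-\infty<\alpha\le0,\qquad 0\le\mu\le\mu_\ast,\qquad 1<p<\infty,\qquad 1<q\le\infty,$$ and let $\kappa\in[0,\rho_d]$. Then for all $0\le s<t\le1$ and all $f\in\mathcal B^{\alpha,\mu}_{p,q}$, $$\|\{\mathcal G_t-\mathcal G_s\}f\|_{\mathcal B^{\alpha+\kappa,\mu}_{p,q}}\le C\,|t-s|^{\rho_d-\kappa}\,\|f\|_{\mathcal B^{\alpha,\mu}_{p,q}},$$ where, as far as the weight parameters are concerned, the constant $C$ depends only on $\mu_\ast$ (it may depend on the fixed parameters $\alpha,\kappa,p,q$, but not on $s,t,f$ or $\mu\in[0,\mu_\ast]$).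
   Context: Wave operator: $\mathcal G_tf=G_t*f$, where $G_t(x)=\frac12\mathbf 1_{|x|<t}$ if $d=1$ and $G_t(x)=\frac1{2\pi}(t^2-|x|^2)^{-1/2}\mathbf 1_{|x|<t}$ if $d=2$ (so $\mathcal G_0=0$). Weighted Besov spaces: $\|f\|_{L^p_\mu}:=(\int_{\mathbb R^d}|f(x)|^pe^{-\mu|x|}dx)^{1/p}$. Fix an integer $L\ge1$ and $\varphi_0\in C_c^\infty(\mathbb R^d)$ with $\int\varphi_0\ne0$ such that $\varphi(x):=\varphi_0(x)-2^{-d}\varphi_0(x/2)$ satisfies $\int x^r\varphi(x)dx=0$ for all multi-indices $|r|\le L$; put $\varphi_j(x):=2^{dj}\varphi(2^jx)$ for $j\ge1$. For $s\le1$, $1<p<\infty$, $1<q\le\infty$, $\mathcal B^{s,\mu}_{p,q}$ is the completion of $C_c^\infty(\mathbb R^d)$ for the norm $\|f\|_{\mathcal B^{s,\mu}_{p,q}}:=\big(\sum_{j\ge0}2^{jsq}\|\varphi_j*f\|^q_{L^p_\mu}\big)^{1/q}$ (supremum over $j$ of $2^{js}\|\varphi_j*f\|_{L^p_\mu}$ if $q=\infty$). Different admissible $(L,\varphi_0)$ give equivalent norms, uniformly over $\mu\in[0,\mu_\ast]$ (Rychkov). *)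

(* Defs.v *)
From HB Require Import structures.
From mathcomp Require Import all_boot all_order all_algebra.
From mathcomp Require Import all_classical all_reals all_analysis.

Set Implicit Arguments.
Unset Strict Implicit.
Unset Printing Implicit Defensive.

Import Order.TTheory GRing.Theory Num.Theory.
Import numFieldNormedType.Exports.

Local Open Scope classical_set_scope.
Local Open Scope ring_scope.

(* Metric completion of a subset D of V (meant to be a subspace) for a norm N
   on D. Points are classes of N-Cauchy sequences of D modulo N-null
   sequences, a class being a set of sequences. The norm takes values in \bar R
   so that it can be written as an integral or a series without first proving
   finiteness. *)
Section Completion.
Context {R : realType} {V : zmodType}.
Implicit Types (D : set V) (N : V -> \bar R) (u v : nat -> V).

Definition cauchy_in D N u : Prop :=
  (forall n, D (u n)) /\
  (forall e : R, 0 < e -> exists n0 : nat, forall m n : nat,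
     (n0 <= m)%N -> (n0 <= n)%N -> (N (u m - u n)%R < e%:E)%E).

Definition same_limit N u v : Prop :=
  (fun n => N (u n - v n)) @ \oo --> (0 : \bar R)%E.

Definition class_of D N u : set (nat -> V) :=
  [set v | cauchy_in D N v /\ same_limit N v u].

Definition completion D N : set (set (nat -> V)) :=
  [set class_of D N u | u in cauchy_in D N].

Definition completion_norm N (X : set (nat -> V)) : \bar R :=
  limn (N \o xget (fun=> 0) X).

(* Extension by continuity of T, defined on D, from the completion for one norm
   to the completion for the norm N'. The image of X is the set of sequences
   with the same N'-limit as T \o u for some u representing X; that it is a
   single class, i.e. a point of [completion D N'], is a property of T. *)
Definition extend_by_continuity D N' (T : V -> V) (X : set (nat -> V)) :
    set (nat -> V) :=
  \bigcup_(u in X) class_of D N' (T \o u).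

End Completion.

Section EuclideanSpace.
Context {R : realType} {d : nat}.
Local Notation E := 'rV[R]_d.

(* The library norm on 'rV[R]_d is the sup norm. *)
Definition enorm (x : E) : R := Num.sqrt (\sum_(i < d) x ord0 i ^+ 2).

(* Integral over R^d for Lebesgue measure; only d = 1 and d = 2 are meaningful. *)
Definition integral_Rd (f : E -> \bar R) : \bar R :=
  if d == 1%N then (\int[lebesgue_measure]_(x in [set: R]) f (\row_(i < d) x))%E
  else (\int[lebesgue_measure \x lebesgue_measure]_(z in [set: R * R])
          f (\row_(i < d) if i == 0%N :> nat then z.1 else z.2))%E.

Definition Rintegral_Rd (f : E -> R) : R := fine (integral_Rd (EFin \o f)).

Definition convolution (f g : E -> R) (x : E) : R :=
  Rintegral_Rd (fun y => f (x - y) * g y).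

Definition partial (i : 'I_d) (f : E -> R) : E -> R :=
  fun x => 'D_(delta_mx ord0 i) f x.

Definition smooth (f : E -> R) : Prop :=
  forall s : seq 'I_d,
    continuous (foldr partial f s) /\
    (forall i x, derivable (foldr partial f s) x (delta_mx ord0 i)).

Definition test_function : set (E -> R) :=
  [set f | smooth f /\ compact (closure [set x | f x != 0])].

Definition monomial (r : 'I_d -> nat) (x : E) : R :=
  \prod_(i < d) x ord0 i ^+ r i.

End EuclideanSpace.

Section Besov.
Context {R : realType} {d : nat}.
Local Notation E := 'rV[R]_d.

Definition lp_mother (phi0 : E -> R) (x : E) : R :=
  phi0 x - 2 ^- d * phi0 (2^-1 *: x).

Definition lp_block (phi0 : E -> R) (j : nat) (x : E) : R :=
  if j == 0%N then phi0 x
  else 2 ^+ (d * j) * lp_mother phi0 (2 ^+ j *: x).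

Definition admissible (L : nat) (phi0 : E -> R) : Prop :=
  [/\ test_function phi0,
      Rintegral_Rd phi0 <> 0 &
      forall r : 'I_d -> nat, (\sum_(i < d) r i <= L)%N ->
        Rintegral_Rd (fun x => monomial r x * lp_mother phi0 x) = 0].

Definition weighted_Lnorm (mu p : R) (f : E -> R) : \bar R :=
  (integral_Rd (fun x => (`|f x| `^ p * expR (- mu * enorm x))%:E) `^ p^-1)%E.

Definition besov_norm (phi0 : E -> R) (s mu p : R) (q : \bar R)
    (f : E -> R) : \bar R :=
  let N j := weighted_Lnorm mu p (convolution (lp_block phi0 j) f) in
  (match q with
   | r%:E => (\sum_(0 <= j <oo) (2 `^ (j%:R * s * r))%:E * N j `^ r) `^ r^-1
   | +oo => ereal_sup (range (fun j : nat => (2 `^ (j%:R * s))%:E * N j))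
   | -oo => 0
   end)%E.

Definition besov (phi0 : E -> R) (s mu p : R) (q : \bar R) :
    set (set (nat -> E -> R)) :=
  completion test_function (besov_norm phi0 s mu p q).

Definition besov_space_norm (phi0 : E -> R) (s mu p : R) (q : \bar R)
    (X : set (nat -> E -> R)) : \bar R :=
  completion_norm (besov_norm phi0 s mu p q) X.

End Besov.

Section Wave.
Context {R : realType} {d : nat}.
Local Notation E := 'rV[R]_d.

(* Only d = 1 and d = 2 are meaningful. *)
Definition wave_kernel (t : R) (x : E) : R :=
  if enorm x < t then
    if d == 1%N then 2^-1
    else (2 * pi)^-1 * (Num.sqrt (t ^+ 2 - enorm x ^+ 2))^-1
  else 0.

Definition wave_op (t : R) (f : E -> R) : E -> R := convolution (wave_kernel t) f.

(* The operator G_t - G_s, extended by continuity from the test functions to a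
   map into the Besov space of regularity s'. *)
Definition wave_increment (phi0 : E -> R) (s' mu p : R) (q : \bar R) (s t : R)
    : set (nat -> E -> R) -> set (nat -> E -> R) :=
  extend_by_continuity test_function (besov_norm phi0 s' mu p q)
    (fun f => wave_op t f - wave_op s f).

End Wave.

Definition wave_rho (R : realType) (d : nat) : R :=
  if d == 1%N then 1 else 2^-1.

(* Main.v *)
(* Let S = phi0 / (int phi0), S_j = 2^(dj) S(2^j .) and B_k = S_k * S_k. The
   blocks are phi_j = c (S_j - S_(j-1)), and with D_k h = h - B_k * h and D_(-1) = id
   the operators D_(k-1)^n - D_k^n telescope. As D_(k-1) - D_k is convolution with
   (S_k - S_(k-1)) * (S_k + S_(k-1)), this gives a reproducing formula
   h = sum_(k <= J) Q_k * phi_k * h + D_J^n h with smooth kernels Q_k of width 2^-k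
   and a remainder tending to 0. For h = phi_j * K * f, K = G_t - G_s, it reads
   phi_j * K * f = sum_k A_jk * (phi_k * f) up to a small remainder, where A_jk has a
   fixed compact support. Two vanishing moments of phi_j (k <= j) or n derivatives
   (k >= j) make its L^1 norm decay in |j - k|, and the zero mean of phi_j gains the
   L^1 modulus of continuity of K at scale 2^-min(j,k). Young's inequality with the
   weight exp(- mu |x|), which costs a factor exp(mu rho / p) for kernels supported in the
   ball of radius rho, and Young's inequality in j, k bound the Besov norm of K * f.

   It remains to see that |K|_1 and the modulus |K(. - y) - K|_1 / |y|^kappa are
   O(|t - s|^(rho_d - kappa)). Inside the smaller cone G_t <= G_s, while the total mass
   of G_t increases with t, so |G_t - G_s|_1 is at most twice the mass of G_t in the
   annulus s <= |x| < t; this mass is O((t - s)^rho_d), by slicing when d = 2. The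
   modulus of G_t is controlled by the same annulus masses, and one interpolates
   between |t - s|^rho_d and |y|^rho_d. *)
Require Import Defs.
From HB Require Import structures.
From mathcomp Require Import all_boot all_order all_algebra.
From mathcomp Require Import all_classical all_reals all_analysis.
From mathcomp Require Import measurable_realfun lra ring.

Set Implicit Arguments.
Unset Strict Implicit.
Unset Printing Implicit Defensive.

Import Order.TTheory GRing.Theory Num.Theory.
Import numFieldNormedType.Exports.

Local Open Scope classical_set_scope.
Local Open Scope ring_scope.

(** * Completion *)

(** The moments used are those of order 0 and 1, all that L >= 1 guarantees, whatever alpha is; so
    the two sides of the diagonal j = k are not symmetric. For k <= j the gain 2^(-2(j - k)) is
    enough because alpha <= 0 and kappa <= 1. For k > j the loss 2^(-alpha (k - j)) has no a priori
    bound; it is paid by the number n of deflations, each of which gains 2^-k against one derivative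
    because B_k has mass one. Telescoping leaves n - 1 of them, so the requirement is n - 1 >= 1 -
    alpha. The reproducing formula is exact for each J and built from convolutions of S only, so
    supports stay compact and the exponential weight costs a constant uniform in mu <= mu_ast. It is
    never summed as a series in a Besov norm: for fixed j and f the remainder has a support
    independent of J and size O(2^-J), and it is removed by letting J grow before anything is summed
    in j. Estimates are made on test functions alone; the completion enters only through an abstract
    extension argument. *)

Section CompletionFacts.
Context {R : realType} {V : zmodType}.
Implicit Types (D : set V) (N : V -> \bar R) (u v w : nat -> V).

(** The axioms use differences only, [V] being an abelian group: [seminorm_sym] stands in for
    homogeneity and [seminormB] is the triangle inequality. The value [+oo] is allowed, so
    finiteness of a Besov norm never has to be proved. *)
Record seminorm_on D N : Prop := SeminormOn {
  seminorm_ge0 : forall x, D x -> (0 <= N x)%E;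
  seminorm0 : N 0 = 0%E;
  seminorm_sym : forall x y, D x -> D y -> N (x - y) = N (y - x);
  seminormB : forall x y, D x -> D y -> (N x <= N (x - y)%R + N y)%E;
  seminorm_dom : forall x y, D x -> D y -> D (x - y) }.

Section OneNorm.
Variables (D : set V) (N : V -> \bar R).
Hypothesis sN : seminorm_on D N.

Lemma seminorm_triangle x y z : D x -> D y -> D z ->
  (N (x - z)%R <= N (x - y)%R + N (y - z)%R)%E.
Proof.
move=> Dx Dy Dz.
have -> : (x - y)%R = (x - z) - (y - z) by rewrite opprB addrA subrK.
by apply: (seminormB sN); exact: (seminorm_dom sN).
Qed.

(** Convergence to 0 in [\bar R] includes eventual finiteness, so it can be read as the same kind of
    epsilon condition as in [cauchy_in]. *)
Lemma same_limitP u v : (forall n, D (u n)) -> (forall n, D (v n)) ->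
  same_limit N u v <->
  (forall e : R, 0 < e -> exists n0 : nat, forall n, (n0 <= n)%N ->
     (N (u n - v n)%R < e%:E)%E).
Proof.
move=> Du Dv; rewrite /same_limit; split.
- move=> cv e e0.
  have /fine_cvgP[ffin /cvgrPdist_lt/(_ _ e0)] := cv.
  move=> H; have : \forall n \near \oo, (N (u n - v n)%R < e%:E)%E.
    near=> n.
    have fn : N (u n - v n)%R \is a fin_num by near: n.
    have : `|0 - fine (N (u n - v n)%R)| < e by near: n.
    rewrite sub0r normrN => /(le_lt_trans (ler_norm _)).
    by rewrite -lte_fin fineK.
  by case=> n0 _ Hn; exists n0 => n nn; exact: Hn.
- move=> H; apply/fine_cvgP; split.
    have [n0 Hn] := H _ ltr01; exists n0 => // n /= nn.
    rewrite ge0_fin_numE ?(lt_trans (Hn _ nn)) ?ltry//.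
    by apply: (seminorm_ge0 sN); exact: (seminorm_dom sN).
  apply/cvgrPdist_lt => e e0; have [n0 Hn] := H _ e0.
  exists n0 => // n /= nn.
  have Nge : (0 <= N (u n - v n)%R)%E.
    by apply: (seminorm_ge0 sN); exact: (seminorm_dom sN).
  rewrite sub0r normrN ger0_norm ?fine_ge0//.
  rewrite -lte_fin fineK ?Hn// ge0_fin_numE// (lt_trans (Hn _ nn)) ?ltry//.
Unshelve. all: by end_near.
Qed.

Lemma same_limit_refl u : same_limit N u u.
Proof.
rewrite /same_limit (_ : (fun _ => _) = cst 0%E); first exact: cvg_cst.
by apply/funext => n; rewrite subrr (seminorm0 sN).
Qed.

Lemma same_limit_sym u v : (forall n, D (u n)) -> (forall n, D (v n)) ->
  same_limit N u v -> same_limit N v u.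
Proof.
move=> Du Dv; rewrite /same_limit.
by rewrite (_ : (fun n => N (v n - u n)) = (fun n => N (u n - v n)))//;
  apply/funext => n; rewrite (seminorm_sym sN).
Qed.

Lemma same_limit_trans u v w :
  (forall n, D (u n)) -> (forall n, D (v n)) -> (forall n, D (w n)) ->
  same_limit N u v -> same_limit N v w -> same_limit N u w.
Proof.
move=> Du Dv Dw /same_limitP => /(_ Du Dv) uv /same_limitP => /(_ Dv Dw) vw.
apply/same_limitP => // e e0.
have [n1 H1] := uv _ (divr_gt0 e0 (ltr0n _ 2)).
have [n2 H2] := vw _ (divr_gt0 e0 (ltr0n _ 2)).
exists (maxn n1 n2) => n; rewrite geq_max => /andP[nn1 nn2].
rewrite (le_lt_trans (seminorm_triangle (Du n) (Dv n) (Dw n)))//.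
by rewrite (splitr e) EFinD lteD// ?H1 ?H2.
Qed.

Lemma class_of_eq u v : cauchy_in D N u -> cauchy_in D N v ->
  same_limit N u v -> class_of D N u = class_of D N v.
Proof.
move=> [Du _] [Dv _] uv; apply/seteqP; split => w [cw sw]; split => //.
  exact: (same_limit_trans cw.1 Du).
apply: (same_limit_trans cw.1 Dv) => //; exact: same_limit_sym.
Qed.

Lemma cauchy_class u : cauchy_in D N u -> class_of D N u u.
Proof. by move=> cu; split => //; exact: same_limit_refl. Qed.

(* A Cauchy sequence for an extended-valued seminorm either eventually has
   finite norms, or eventually only infinite ones. *)
Lemma cauchy_norm_cvg u : cauchy_in D N u -> cvgn (N \o u).
Proof.
move=> [Du cu].
have [n0 H0] := cu _ ltr01.
have [/eqP infty|fin] := boolP (N (u n0) == +oo%E).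
  apply/cvg_ex; exists +oo%E; apply: cvg_near_cst.
  exists n0 => // n /= nn.
  have := seminormB sN (Du n0) (Du n).
  rewrite infty leye_eq => /eqP.
  by have := H0 _ _ (leqnn n0) nn; case: (N (u n0 - u n)%R) => // r _; case: (N (u n)).
have finn n : (n0 <= n)%N -> N (u n) \is a fin_num.
  move=> nn; rewrite ge0_fin_numE ?(seminorm_ge0 sN)//.
  apply: (le_lt_trans (seminormB sN (Du n) (Du n0))).
  apply: lte_add_pinfty; last by rewrite ltey.
  by rewrite (lt_trans (H0 _ _ nn (leqnn _))) ?ltry.
have /cvg_ex[l ul] : cvgn (fine \o N \o u).
  apply/cauchy_cvgP/cauchy_exP => e e0.
  have [n1 H1] := cu _ e0.
  pose a := maxn n0 n1; exists (fine (N (u a))); exists a => // b /=.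
  have : (a <= a)%N by [].
  rewrite {1}/a !geq_max => /andP[a0 a1] /andP[b0 b1].
  rewrite /ball /= ltr_distl -!lte_fin EFinB EFinD !fineK ?finn//.
  rewrite lte_subel_addr// ?finn//; apply/andP; split.
    apply: (le_lt_trans (seminormB sN (Du b) (Du a))).
    by rewrite [ltRHS]addeC lteD2rE ?finn// H1.
  apply: (le_lt_trans (seminormB sN (Du a) (Du b))).
  by rewrite [ltRHS]addeC lteD2rE ?finn// H1.
apply/cvg_ex; exists l%:E; apply/fine_cvgP; split => //.
by exists n0.
Qed.

(** Limit of [N (u n) <= N (u n - v n) + N (v n)]. The limits may be added even if that of [N \o v]
    is [+oo], because the other one is 0. *)
Lemma same_limit_norm_le u v : cauchy_in D N u -> cauchy_in D N v ->
  same_limit N u v -> (limn (N \o u) <= limn (N \o v))%E.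
Proof.
move=> cu cv uv.
have s0 : (fun n => N (u n - v n)) @ \oo --> (0 : \bar R)%E by [].
rewrite -[leRHS]add0e -(cvg_lim _ s0)// -limeD//.
- apply: lee_lim; [exact: cauchy_norm_cvg| |].
    apply: is_cvgeD; [|by apply/cvg_ex; exists 0%E|exact: cauchy_norm_cvg].
    by rewrite (cvg_lim _ s0)// fin_num_adde_defr.
  by apply: nearW => n; apply: (seminormB sN); [exact: cu.1|exact: cv.1].
- by apply/cvg_ex; exists 0%E.
- exact: cauchy_norm_cvg.
- by rewrite (cvg_lim _ s0)// fin_num_adde_defr.
Qed.

(** [xget] picks an unspecified representative of the class; [same_limit_norm_le], used both ways,
    shows that the limit does not depend on it. *)
Lemma completion_norm_class u : cauchy_in D N u ->
  completion_norm N (class_of D N u) = limn (N \o u).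
Proof.
move=> cu; rewrite /completion_norm.
have [cw sw] : class_of D N u (xget (fun=> 0) (class_of D N u)).
  by apply: xgetPex; exists u; exact: cauchy_class.
by apply/eqP; rewrite eq_le !same_limit_norm_le//;
  apply: same_limit_sym => //; [exact: cw.1|exact: cu.1].
Qed.

End OneNorm.

(** The extension is a union of classes over all representatives of [X]. The bound on [T] sends
    Cauchy sequences to Cauchy sequences and equivalent ones to equivalent ones, so the union
    collapses to the class of [T \o u] for any one representative [u]. *)
Lemma extend_by_continuity_bounded D N N' (T : V -> V) (C : R)
    (X : set (nat -> V)) :
  seminorm_on D N -> seminorm_on D N' -> 0 < C ->
  (forall x, D x -> D (T x)) ->
  (forall x y, D x -> D y -> T (x - y) = T x - T y) ->
  (forall x, D x -> (N' (T x) <= C%:E * N x)%E) ->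
  completion D N X ->
  completion D N' (extend_by_continuity D N' T X) /\
  (completion_norm N' (extend_by_continuity D N' T X)
     <= C%:E * completion_norm N X)%E.
Proof.
move=> sN sN' C0 DT TB NT [u cu <-].
have small x y e : D x -> D y -> (N (x - y)%R < (C^-1 * e)%:E)%E ->
    (N' (T x - T y)%R < e%:E)%E.
  move=> Dx Dy Nxy; rewrite -TB//.
  apply: (le_lt_trans (NT _ (seminorm_dom sN Dx Dy))).
  by rewrite -lte_pdivlMl// -EFinM.
have cT v : cauchy_in D N v -> cauchy_in D N' (T \o v).
  move=> [Dv cv]; split=> [n|e e0]; first exact: DT.
  have [|n0 Hn] := cv (C^-1 * e); first by rewrite mulr_gt0// invr_gt0.
  by exists n0 => p n pn nn /=; apply: small => //; exact: Hn.
have extE : extend_by_continuity D N' T (class_of D N u) = class_of D N' (T \o u).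
  apply/seteqP; split=> [w [v [cv sv] ww]|w ww]; last first.
    by exists u => //; exact: (cauchy_class sN).
  rewrite (_ : class_of D N' (T \o u) = class_of D N' (T \o v))//.
  apply: (class_of_eq sN') => //; [exact: cT|exact: cT|].
  apply/(same_limitP sN') => [n|n|e e0] /=; [exact/DT/cu.1|exact/DT/cv.1|].
  have /(same_limitP sN cu.1 cv.1) uv := same_limit_sym sN cv.1 cu.1 sv.
  have [|n0 Hn] := uv (C^-1 * e); first by rewrite mulr_gt0// invr_gt0.
  by exists n0 => n nn; apply: small; [exact: cu.1|exact: cv.1|exact: Hn].
rewrite extE; split; first by exists (T \o u) => //; exact: cT.
rewrite (completion_norm_class sN' (cT _ cu)) (completion_norm_class sN cu).
have cvN := cauchy_norm_cvg sN cu.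
rewrite -limeMl//.
apply: lee_lim.
- by apply: (cauchy_norm_cvg sN'); exact: cT.
- by apply: is_cvgeMl.
- by apply: nearW => n /=; apply: NT; exact: cu.1.
Qed.

End CompletionFacts.

Lemma continuous_scale {R : realType} (T : topologicalType) (a : R) (g : T -> R) :
  continuous g -> continuous (fun x => a *: g x).
Proof. by move=> cg x; apply: continuousM; [exact: cst_continuous|exact: cg]. Qed.

Lemma continuous_add {R : realType} (T : topologicalType) (f g : T -> R) :
  continuous f -> continuous g -> continuous (fun x => f x + g x).
Proof. by move=> cf cg x; apply: continuousD; [exact: cf|exact: cg]. Qed.

(** * Smooth functions *)

Section EuclideanNorm.
Context {R : realType} {d : nat}.
Local Notation E := 'rV[R]_d.
Implicit Types (x y : E).

Lemma enorm_ge0 x : 0 <= enorm x. Proof. exact: sqrtr_ge0. Qed.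

Lemma enorm_sqr x : enorm x ^+ 2 = \sum_(i < d) x ord0 i ^+ 2.
Proof. by rewrite sqr_sqrtr// sumr_ge0// => i _; exact: sqr_ge0. Qed.

Lemma enorm0 : enorm (0 : E) = 0.
Proof. by rewrite /enorm big1 ?sqrtr0// => i _; rewrite mxE expr0n. Qed.

Lemma enormZ (a : R) x : enorm (a *: x) = `|a| * enorm x.
Proof.
rewrite /enorm (eq_bigr (fun i => a ^+ 2 * x ord0 i ^+ 2)); last first.
  by move=> i _; rewrite mxE exprMn.
by rewrite -mulr_sumr sqrtrM ?sqr_ge0// sqrtr_sqr.
Qed.

Lemma enormN x : enorm (- x) = enorm x.
Proof. by rewrite -scaleN1r enormZ normrN1 mul1r. Qed.

Lemma coord_le_enorm x i : `|x ord0 i| <= enorm x.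
Proof.
rewrite -[X in X <= _]sqrtr_sqr ler_sqrt ?sumr_ge0//; last by move=> ? _; exact: sqr_ge0.
rewrite (bigD1 i)//= lerDl sumr_ge0// => j _; exact: sqr_ge0.
Qed.

Lemma enorm_triangle x y : enorm (x + y) <= enorm x + enorm y.
Proof.
pose A := \sum_(i < d) x ord0 i ^+ 2; pose B := \sum_(i < d) x ord0 i * y ord0 i.
pose C := \sum_(i < d) y ord0 i ^+ 2.
have A0 : 0 <= A by apply: sumr_ge0 => i _; exact: sqr_ge0.
have C0 : 0 <= C by apply: sumr_ge0 => i _; exact: sqr_ge0.
have CS : B ^+ 2 <= A * C.
  have [A_0|An0] := eqVneq A 0.
    rewrite A_0 mul0r /B big1 ?expr0n// => i _.
    have /psumr_eq0P H := A_0; have : x ord0 i ^+ 2 = 0.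
      by apply: (H _ i) => // j _; exact: sqr_ge0.
    by move/eqP; rewrite sqrf_eq0 => /eqP ->; rewrite mul0r.
  (* Cauchy-Schwarz: this sum of squares equals A (A C - B^2), and A > 0 here. *)
  have : 0 <= \sum_(i < d) (A * y ord0 i - B * x ord0 i) ^+ 2.
    by apply: sumr_ge0 => i _; exact: sqr_ge0.
  rewrite (eq_bigr (fun i => A ^+ 2 * y ord0 i ^+ 2 - (2 * A * B) * (x ord0 i * y ord0 i)
     + B ^+ 2 * x ord0 i ^+ 2)); last by move=> i _; ring.
  rewrite big_split/= sumrB -!mulr_sumr -/A -/B -/C.
  have -> : A ^+ 2 * C - 2 * A * B * B + B ^+ 2 * A = A * (A * C - B ^+ 2) by ring.
  by rewrite pmulr_rge0 ?subr_ge0// lt_def An0.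
rewrite -(@ler_pXn2r _ 2) ?nnegrE ?addr_ge0 ?enorm_ge0//.
rewrite sqrrD !enorm_sqr.
rewrite (eq_bigr (fun i => x ord0 i ^+ 2 + (x ord0 i * y ord0 i) *+ 2 + y ord0 i ^+ 2)); last first.
  by move=> i _; rewrite mxE sqrrD.
rewrite 2!big_split/= -/A -/C sumrMnl -/B lerD2r lerD2l lerMn2r/=.
rewrite (le_trans (ler_norm _))//.
by rewrite /enorm -sqrtrM// -sqrtr_sqr ler_sqrt// mulr_ge0.
Qed.

Lemma enormB x y : enorm (x - y) <= enorm x + enorm y.
Proof. by rewrite (le_trans (enorm_triangle _ _))// enormN. Qed.

Lemma enorm_continuous : continuous (enorm : E -> R).
Proof.
have cs (s : seq 'I_d) : continuous (fun x : E => \sum_(i <- s) x ord0 i ^+ 2).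
  elim: s => [|i s IH] x.
    rewrite (_ : (fun y : E => _) = cst 0); first exact: cst_continuous.
    by apply/funext => y; rewrite big_nil.
  rewrite (_ : (fun y : E => _) =
      (fun y : E => y ord0 i ^+ 2 + \sum_(j <- s) y ord0 j ^+ 2)); last first.
    by apply/funext => y; rewrite big_cons.
  apply: (@continuous_add R E) => // {}x.
  apply: (@continuous_comp _ _ _ (fun y : E => y ord0 i) (fun z : R => z ^+ 2)).
    exact: coord_continuous.
  exact: exprn_continuous.
by move=> x; apply: continuous_comp; [exact: cs|exact: sqrt_continuous].
Qed.

Lemma le_norm_enorm x : `|x| <= enorm x.
Proof.
rewrite [`|x|]mx_normrE; apply: bigmax_le; first exact: enorm_ge0.
by move=> [i j] _ /=; rewrite ord1 coord_le_enorm.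
Qed.

End EuclideanNorm.

Section Smooth.
Context {R : realType} {d : nat}.
Local Notation E := 'rV[R]_d.
Implicit Types (f g : E -> R) (x y : E) (s : seq 'I_d).

Lemma smooth_continuous f : smooth f -> continuous f.
Proof. by move=> /(_ [::])[]. Qed.

Lemma smooth_iter f s : smooth f -> smooth (foldr partial f s).
Proof. by move=> sf s'; have := sf (s' ++ s); rewrite foldr_cat. Qed.

Lemma smooth_partial f i : smooth f -> smooth (partial i f).
Proof. exact: (smooth_iter [:: i]). Qed.

Lemma smooth_derivable f i x : smooth f -> derivable f x (delta_mx ord0 i).
Proof. by move=> /(_ [::])[_]. Qed.

(** A coinduction principle: a class of continuous functions that have partial derivatives, and is
    stable under them, consists of smooth functions. It spares an induction on lists of derivatives
    whenever the class is known, as for convolutions with test functions. *)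
Lemma smooth_closed (P : (E -> R) -> Prop) :
  (forall f, P f -> continuous f) ->
  (forall f i x, P f -> derivable f x (delta_mx ord0 i)) ->
  (forall f i, P f -> P (partial i f)) ->
  forall f, P f -> smooth f.
Proof.
move=> Pc Pd Pp f Pf s.
have Ps : P (foldr partial f s) by elim: s => //= i s /Pp.
by split=> [|i x]; [exact: Pc|exact: Pd].
Qed.

Lemma foldr_partialD f g s : smooth f -> smooth g ->
  foldr partial (f + g) s = foldr partial f s + foldr partial g s.
Proof.
move=> sf sg; elim: s => //= i s ->; apply/funext => x.
by rewrite /partial deriveD//; [have [_] := sf s|have [_] := sg s].
Qed.

Lemma foldr_partialZ (a : R) f s : smooth f ->
  foldr partial (a \*: f) s = a \*: foldr partial f s.
Proof.
move=> sf; elim: s => //= i s ->; apply/funext => x.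
by rewrite /partial deriveZ//; have [_] := sf s.
Qed.

Lemma smoothD f g : smooth f -> smooth g -> smooth (f + g).
Proof.
move=> sf sg s; rewrite foldr_partialD//; have [cf df] := sf s; have [cg dg] := sg s.
split=> [x|i x]; first by apply: continuousD; [exact: cf|exact: cg].
by apply: derivableD; [exact: df|exact: dg].
Qed.

Lemma smoothZ (a : R) f : smooth f -> smooth (a \*: f).
Proof.
move=> sf s; rewrite foldr_partialZ//; have [cf df] := sf s.
split=> [x|i x]; last by apply: derivableZ; exact: df.
exact: (@continuous_scale R E).
Qed.

Definition dilate (l : R) f : E -> R := fun x => f (l *: x).

(** Brings a directional derivative back to one real variable, where the chain rule and the mean
    value theorem are applied. *)
Lemma derive_line f x v : 'D_v f x = 'D_1 (fun h : R => f (h *: v + x)) 0.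
Proof.
rewrite /derive; set g1 := fun h => h^-1 *: _; set g2 := fun h => h^-1 *: _.
suff -> : g1 = g2 by [].
by apply/funext => h; rewrite /g1 /g2 /= scale0r add0r addr0 [_%:A]mulr1.
Qed.

Lemma is_derive_line f x v (df : R) :
  is_derive x v f df <-> is_derive (0 : R) 1 (fun h : R => f (h *: v + x)) df.
Proof.
split=> -[d1 d2].
  by split; [exact: (derivable1P f x v).1 d1|rewrite -derive_line].
by split; [exact: (derivable1P f x v).2 d1|rewrite derive_line].
Qed.

Lemma dilate_is_derive (l : R) f x v (df : R) : is_derive (l *: x) v f df ->
  is_derive x v (dilate l f) (l * df).
Proof.
move=> /is_derive_line dg; apply/is_derive_line.
rewrite (_ : (fun h : R => _) = (fun h : R => f (h *: v + l *: x)) \o *%R l); last first.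
  by apply/funext => h; rewrite /dilate /= scalerDr scalerA.
rewrite mulrC; apply: is_derive1_comp; first by rewrite mulr0.
by apply: is_derive_eq; rewrite /GRing.scale/= mulr1.
Qed.

Lemma foldr_partial_dilate (l : R) f s : smooth f ->
  foldr partial (dilate l f) s = (l ^+ size s) \*: dilate l (foldr partial f s).
Proof.
move=> sf; elim: s => [|i s IH] /=.
  by apply/funext => x /=; rewrite expr0 [RHS]mul1r.
rewrite IH; apply/funext => x.
have dl : is_derive x (delta_mx ord0 i) (dilate l (foldr partial f s))
     (l * 'D_(delta_mx ord0 i) (foldr partial f s) (l *: x)).
  by apply: dilate_is_derive; apply: DeriveDef => //; have [_] := sf s.
have [dl1 dl2] := dl.
by rewrite /partial deriveZ// dl2 /= /GRing.scale/= exprSr mulrA.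
Qed.

Lemma smooth_dilate (l : R) f : smooth f -> smooth (dilate l f).
Proof.
move=> sf s; rewrite foldr_partial_dilate//; have [cf df] := sf s.
split=> [x|i x].
  apply: (@continuous_scale R E) => {}x.
  apply: (@continuous_comp E E R ( *:%R l)); last exact: cf.
  exact: scaler_continuous.
apply: derivableZ.
have [] // : is_derive x (delta_mx ord0 i) (dilate l (foldr partial f s))
     (l * 'D_(delta_mx ord0 i) (foldr partial f s) (l *: x)).
by apply: dilate_is_derive; apply: DeriveDef.
Qed.

Lemma smooth_coord_MVT f x i (a : R) : smooth f ->
  exists2 c, `|c| <= `|a| &
    f (x + a *: delta_mx ord0 i) - f x = a * partial i f (x + c *: delta_mx ord0 i).
Proof.
move=> sf; set e := delta_mx ord0 i.
pose g (h : R) : R := f (x + h *: e).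
have dg (h : R) : is_derive h 1 g (partial i f (x + h *: e)).
  pose k (z : R) : R := f (z *: e + (x + h *: e)).
  have gk : g = k \o (fun z => z - h).
    by apply/funext => z; rewrite /g /k /= scalerBl addrCA subrK addrC.
  have dk : is_derive (h - h) 1 k (partial i f (x + h *: e)).
    by rewrite subrr; apply/is_derive_line; apply: DeriveDef => //; exact: smooth_derivable.
  rewrite gk -[X in is_derive _ _ _ X]mulr1; apply: is_derive1_comp.
  by apply: is_derive_eq; rewrite subr0.
have cg : continuous g.
  by move=> h; apply: differentiable_continuous; apply/derivable1_diffP; case: (dg h).
have g0 : g 0 = f x by rewrite /g scale0r addr0.
have [a0|a0] := leP 0 a.
  have [|c /[!in_itv]/= /andP[c0 ca] E] := @MVT_segment R g _ 0 a a0 (fun h _ => dg h).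
    exact: continuous_subspaceT.
  exists c; first by rewrite !ger0_norm.
  by rewrite -/(g a) -g0 E subr0 mulrC.
have [|c /[!in_itv]/= /andP[c0 ca] E] := @MVT_segment R g _ a 0 (ltW a0) (fun h _ => dg h).
  exact: continuous_subspaceT.
exists c; first by rewrite !ler0_norm ?lerN2// ltW.
by rewrite -/(g a) -g0 -opprB E sub0r mulrN opprK mulrC.
Qed.

(** The order is exactly [n], so [dbound 0] is a sup bound. Mixed derivatives are words in the
    coordinates, and no commutation of partials is involved. *)
Definition dbound (n : nat) f (M : R) :=
  forall s, size s = n -> forall x, `|foldr partial f s x| <= M.

Lemma row_sum_coord x : x = \sum_(i < d) x ord0 i *: delta_mx ord0 i.
Proof. by rewrite -row_sum_delta. Qed.

Definition l1norm x : R := \sum_(i < d) `|x ord0 i|.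

Lemma l1norm_ge0 x : 0 <= l1norm x. Proof. exact: sumr_ge0. Qed.

Lemma l1norm_le x : l1norm x <= d%:R * enorm x.
Proof.
rewrite (le_trans (ler_sum _ (fun i _ => coord_le_enorm x i)))//.
by rewrite sumr_const card_ord mulr_natl.
Qed.

(** The path from [x] to [x + z] follows one coordinate axis after the other, by induction on the
    list of coordinates; this is why the l^1 norm of [z] appears. *)
Lemma dbound1_lip f M x z : smooth f -> dbound 1 f M ->
  `|f (x + z) - f x| <= M * l1norm z.
Proof.
move=> sf Mf; rewrite {1}(row_sum_coord z) /l1norm.
elim: (index_enum _) x => [|i s IH] x; first by rewrite !big_nil addr0 subrr normr0 mulr0.
rewrite !big_cons addrA.
have [c _ E] := smooth_coord_MVT x i (z ord0 i) sf.
set y := x + z ord0 i *: delta_mx ord0 i in E *; set F := f (y + _) in IH *.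
have -> : F - f x = (f y - f x) + (F - f y) by ring.
rewrite (le_trans (ler_normD _ _))// mulrDr lerD//; last exact: IH.
by rewrite E normrM mulrC ler_wpM2r//; exact: (Mf [:: i]).
Qed.

(** Same walk along the axes. After the step along axis i the gradient sits at the new base point
    [y]; bringing it back to [x] costs M |z_i| S, which is absorbed by the cross term of (|z_i| +
    S)^2. The mean value point gives the constant M instead of M / 2. *)
Lemma dbound2_taylor f M x z : smooth f -> 0 <= M -> dbound 2 f M ->
  `|f (x + z) - f x - \sum_(i < d) z ord0 i * partial i f x| <= M * l1norm z ^+ 2.
Proof.
move=> sf M0 Mf.
have Mfi i : dbound 1 (partial i f) M.
  by move=> [|j []]// _ y; exact: (Mf [:: j; i]).
rewrite {1}(row_sum_coord z) /l1norm.
elim: (index_enum _) x => [|i s IH] x.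
  by rewrite !big_nil addr0 subrr subr0 normr0 expr0n mulr0.
rewrite !big_cons addrA.
have [c ca E] := smooth_coord_MVT x i (z ord0 i) sf.
set y := x + z ord0 i *: delta_mx ord0 i in E *.
set S := \sum_(j <- s) `|z ord0 j|; have S0 : 0 <= S by exact: sumr_ge0.
set t := \sum_(j <- s) z ord0 j * partial j f x.
pose t' := \sum_(j <- s) z ord0 j * partial j f y.
have tt' : `|t' - t| <= M * `|z ord0 i| * S.
  rewrite -sumrB (le_trans (ler_norm_sum _ _ _))// mulr_sumr ler_sum// => j _.
  rewrite -mulrBr normrM [leRHS]mulrC ler_wpM2l//.
  rewrite (le_trans (dbound1_lip _ _ (smooth_partial _ sf) (Mfi _)))// ler_wpM2l//.
  rewrite /l1norm (bigD1 i)//= big1 ?addr0; last first.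
    by move=> k ki; rewrite !mxE (negbTE ki) andbF mulr0 normr0.
  by rewrite !mxE !eqxx mulr1.
have fi : `|f y - f x - z ord0 i * partial i f x| <= M * `|z ord0 i| ^+ 2.
  rewrite E -mulrBr normrM (_ : M * _ = `|z ord0 i| * (M * `|z ord0 i|)) ?ler_wpM2l//; last by ring.
  rewrite (le_trans (dbound1_lip _ _ (smooth_partial _ sf) (Mfi _)))// ler_wpM2l//.
  rewrite /l1norm (bigD1 i)//= big1 ?addr0; last first.
    by move=> k ki; rewrite !mxE (negbTE ki) andbF mulr0 normr0.
  by rewrite !mxE !eqxx mulr1.
have := IH y; rewrite -/t' -/S => IHy; set F := f (y + _) in IHy *.
have -> : F - f x - (z ord0 i * partial i f x + t) =
   (F - f y - t') + (t' - t) + (f y - f x - z ord0 i * partial i f x) by ring.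
rewrite (le_trans (ler_normD _ _))//.
rewrite (le_trans (lerD (le_trans (ler_normD _ _) (lerD IHy tt')) fi))//.
have : 0 <= M * `|z ord0 i| * S by rewrite !mulr_ge0.
by rewrite sqrrD mulr2n !mulrDr; set a := `|_|; nra.
Qed.

End Smooth.

(** * Test functions and their supports *)

Section TestFunctions.
Context {R : realType} {d : nat}.
Local Notation E := 'rV[R]_d.
Implicit Types (f g : E -> R) (x y : E) (s : seq 'I_d).

Definition vanish_outside (r : R) f := forall x, r < enorm x -> f x = 0.

Lemma compact_eball (r : R) : compact [set x : E | enorm x <= r].
Proof.
apply: bounded_closed_compact.
  exists r; split; first exact: num_real.
  by move=> M rM x /= xr; rewrite (le_trans (le_norm_enorm x))// (le_trans xr)// ltW.
rewrite (_ : [set x | _] = (enorm : E -> R) @^-1` [set y | y <= r])//.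
by apply: closed_comp; [move=> x _; exact: enorm_continuous|exact: closed_le].
Qed.

(** Replaces compactness of the support by a radius, which adds up under convolution and scales
    under dilation. *)
Lemma test_functionP f :
  test_function f <-> smooth f /\ exists2 r, 0 < r & vanish_outside r f.
Proof.
split=> [[sf cf]|[sf [r r0 fr]]]; split => //.
  have : compact ((enorm : E -> R) @` closure [set x | f x != 0]).
    by apply: continuous_compact cf; apply: continuous_subspaceT; exact: enorm_continuous.
  move=> /compact_bounded [M [_ HM]].
  exists (`|M| + 1); first by rewrite ltr_wpDl.
  move=> x Mx; apply/eqP/negP => /negP fx.
  have M1 : M < `|M| + 1 by rewrite (le_lt_trans (ler_norm M))// ltrDl.
  have /= := HM _ M1 (enorm x); rewrite ger0_norm ?enorm_ge0// leNgt Mx.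
  by apply/not_implyP; split => //; exists x => //; exact: subset_closure.
apply: (@subclosed_compact _ _ [set x | enorm x <= r]); last 2 first.
  - exact: compact_eball.
  - rewrite closureE; apply: smallest_sub.
      exact: (compact_closed (@norm_hausdorff _ _)  (@compact_eball r)).
    move=> x /= fx; rewrite leNgt; apply/negP => /fr /eqP; exact/negP.
exact: closed_closure.
Qed.

Lemma vanish_le r r' f : r <= r' -> vanish_outside r f -> vanish_outside r' f.
Proof. by move=> rr fr x xr; apply: fr; exact: le_lt_trans xr. Qed.

(** The strict inequality makes the region open, so [f] is zero near each of its points. *)
Lemma vanish_partial r f i : vanish_outside r f -> vanish_outside r (partial i f).
Proof.
move=> fr x rx; rewrite /partial (@near_eq_derive _ _ _ f (cst 0)).
  exact: derive_cst.
have : \forall y \near x, r < enorm y.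
  have := @enorm_continuous R d x.
  by move=> /cvgr_gt; apply.
by apply: filterS => y; exact: fr.
Qed.

Lemma vanishD r f g : vanish_outside r f -> vanish_outside r g -> vanish_outside r (f + g).
Proof. by move=> fr gr x rx; rewrite fctE fr// gr// addr0. Qed.

Lemma vanishZ (a : R) r f : vanish_outside r f -> vanish_outside r (a \*: f).
Proof. by move=> fr x rx; rewrite /= fr// scaler0. Qed.

Lemma vanishB r f g : vanish_outside r f -> vanish_outside r g -> vanish_outside r (f - g).
Proof. by move=> fr gr x rx; rewrite !fctE fr// gr// subr0. Qed.

Lemma vanish_dilate (l : R) r f : 0 < l -> vanish_outside r f ->
  vanish_outside (l^-1 * r) (dilate l f).
Proof.
move=> l0 fr x rx; apply: fr; rewrite enormZ (gtr0_norm l0).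
by rewrite mulrC -ltr_pdivrMr// mulrC.
Qed.

Lemma test_smooth f : test_function f -> smooth f. Proof. by case. Qed.

Lemma test_continuous f : test_function f -> continuous f.
Proof. by move=> /test_smooth; exact: smooth_continuous. Qed.

Lemma test_vanish f : test_function f -> exists2 r, 0 < r & vanish_outside r f.
Proof. by move=> /test_functionP[]. Qed.

Lemma test_bounded f : test_function f -> exists2 M, 0 < M & forall x, `|f x| <= M.
Proof.
move=> tf; have [r r0 fr] := test_vanish tf.
have : compact (f @` [set x | enorm x <= r]).
  apply: continuous_compact; last exact: compact_eball.
  by apply: continuous_subspaceT; exact: test_continuous.
move=> /compact_bounded [M [_ HM]].
exists (`|M| + 1); first by rewrite ltr_wpDl.
move=> x; have [xr|xr] := leP (enorm x) r.
  apply: (HM (`|M| + 1)); last by exists x.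
  by rewrite (le_lt_trans (ler_norm M))// ltrDl.
by rewrite fr// normr0 addr_ge0.
Qed.

Lemma test_partial f i : test_function f -> test_function (partial i f).
Proof.
move=> tf; have [r r0 fr] := test_vanish tf; apply/test_functionP; split.
  exact/smooth_partial/test_smooth.
by exists r => //; exact: vanish_partial.
Qed.

Lemma test_iter f s : test_function f -> test_function (foldr partial f s).
Proof. by move=> tf; elim: s => //= i s; exact: test_partial. Qed.

Lemma testD f g : test_function f -> test_function g -> test_function (f + g).
Proof.
move=> tf tg; have [r r0 fr] := test_vanish tf; have [r' r'0 gr] := test_vanish tg.
apply/test_functionP; split; first by apply: smoothD; exact: test_smooth.
exists (Num.max r r'); first by rewrite lt_max r0.
by apply: vanishD; [apply: vanish_le fr|apply: vanish_le gr]; rewrite le_max lexx ?orbT.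
Qed.

Lemma testZ (a : R) f : test_function f -> test_function (a \*: f).
Proof.
move=> tf; have [r r0 fr] := test_vanish tf.
apply/test_functionP; split; first by apply: smoothZ; exact: test_smooth.
by exists r => //; exact: vanishZ.
Qed.

Lemma testN f : test_function f -> test_function (- f).
Proof.
move=> /(testZ (-1)); rewrite (_ : -1 \*: f = - f)//.
by apply/funext => x; rewrite !fctE /= scaleN1r.
Qed.

Lemma testB f g : test_function f -> test_function g -> test_function (f - g).
Proof. by move=> tf tg; apply: testD => //; exact: testN. Qed.

Lemma test0 : test_function (0 : E -> R).
Proof.
apply/test_functionP; split; last by exists 1 => // x _.
apply: (@smooth_closed _ _ (fun f => f = 0)) => //.
- by move=> f -> x; exact: (@cst_continuous E R).
- by move=> f i x ->; exact: (derivable_cst (0 : R)).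
- by move=> f i ->; apply/funext => x; rewrite /partial (derive_cst (0 : R)).
Qed.

Lemma test_dilate (l : R) f : 0 < l -> test_function f -> test_function (dilate l f).
Proof.
move=> l0 tf; have [r r0 fr] := test_vanish tf.
apply/test_functionP; split; first by apply: smooth_dilate; exact: test_smooth.
by exists (l^-1 * r); [rewrite mulr_gt0// invr_gt0|exact: vanish_dilate].
Qed.

Lemma test_dbound n f : test_function f -> exists2 M, 0 < M & dbound n f M.
Proof.
elim: n f => [|n IH] f tf.
  by have [M M0 fM] := test_bounded tf; exists M => // -[|//] _.
have /choice[M HM] i : exists M, 0 < M /\ dbound n (partial i f) M.
  by have [M M0 HM] := IH _ (test_partial i tf); exists M.
exists (1 + \sum_i M i).
  by rewrite ltr_wpDr// sumr_ge0// => i _; rewrite ltW//; case: (HM i).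
(* The last letter of the word is the derivative taken first; removing it leaves a word of length n
   applied to [partial i f]. *)
move=> s; case/lastP: s => // s i; rewrite size_rcons => -[sn] x.
rewrite foldr_rcons (le_trans ((HM i).2 s sn x))// (bigD1 i)//=.
rewrite addrCA lerDl addr_ge0// sumr_ge0// => j _; rewrite ltW//; by case: (HM j).
Qed.

End TestFunctions.

(* What is used of Lebesgue measure on R^d, d = 1, 2; [io] and [oi] identify the
   measurable space that carries the measure, R or R * R, with 'rV_d. *)
Record lebesgue_model {R : realType} {d : nat} {dT} {T : measurableType dT}
    (m : {sigma_finite_measure set T -> \bar R})
    (io : T -> 'rV[R]_d) (oi : 'rV[R]_d -> T) : Prop := LebesgueModel {
  model_int : forall F : 'rV[R]_d -> \bar R,
    integral_Rd F = (\int[m]_x F (io x))%E;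
  model_oiK : cancel oi io;
  model_sub : measurable_fun setT (fun z : T * T => oi (io z.1 - io z.2));
  model_refl : forall (F : 'rV[R]_d -> \bar R) a,
    measurable_fun setT (F \o io : T -> \bar R) -> (forall x, 0 <= F x)%E ->
    (\int[m]_x F (a - io x)%R = \int[m]_x F (io x))%E;
  model_scale : forall (F : 'rV[R]_d -> \bar R) (n : nat),
    measurable_fun setT (F \o io : T -> \bar R) -> (forall x, 0 <= F x)%E ->
    ((2 ^+ (d * n))%:E * \int[m]_x F (2 ^+ n *: io x)%R = \int[m]_x F (io x))%E;
  model_cont : forall f : 'rV[R]_d -> R, continuous f ->
    measurable_fun setT (f \o io);
  model_ball : forall r : R, 0 <= r ->
    (m [set x | enorm (io x) <= r]%R <= ((2 * r) ^+ d)%:E)%E }.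

(** * Convolution *)

Section ConvolutionAlgebra.
Context {R : realType} {d : nat} {dT} {T : measurableType dT}.
Context {m : {sigma_finite_measure set T -> \bar R}}.
Context {io : T -> 'rV[R]_d} {oi : 'rV[R]_d -> T}.
Local Notation E := 'rV[R]_d.
Hypothesis M : lebesgue_model m io oi.
Implicit Types (f g h K : E -> R) (x y : E).

Local Notation mfun f := (measurable_fun [set: T] (f \o io)).
Local Notation L1 f := (m.-integrable [set: T] (EFin \o (f \o io))).
Local Notation I f := (Rintegral m setT (f \o io)).
Local Notation norm1 f := (Rintegral m setT (Num.norm \o (f \o io))).

Lemma Rintegral_RdE f : Rintegral_Rd f = I f.
Proof. by rewrite /Rintegral_Rd (model_int M). Qed.

Lemma convolutionE f g x : convolution f g x = I (fun y => f (x - y) * g y).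
Proof. by rewrite /convolution Rintegral_RdE. Qed.

Lemma mfun_sub f : mfun f -> measurable_fun setT (fun z : T * T => f (io z.1 - io z.2)).
Proof.
move=> mf; rewrite (_ : (fun _ => _) = (f \o io) \o (fun z : T * T => oi (io z.1 - io z.2))).
  by apply: measurableT_comp => //; exact: (model_sub M).
by apply/funext => z /=; rewrite (model_oiK M).
Qed.

Lemma mfun_subr f x : mfun f -> mfun (fun y => f (x - y)).
Proof.
move=> /mfun_sub mf; rewrite (_ : _ \o io = (fun z : T * T => f (io z.1 - io z.2)) \o pair (oi x)).
  by apply: measurableT_comp => //; exact: pair1_measurable.
by apply/funext => z /=; rewrite (model_oiK M).
Qed.

Lemma mfun_subl f x : mfun f -> mfun (fun y => f (y - x)).
Proof.
move=> /mfun_sub mf.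
rewrite (_ : _ \o io = (fun z : T * T => f (io z.1 - io z.2)) \o (pair^~ (oi x))).
  by apply: measurableT_comp => //; exact: pair2_measurable.
by apply/funext => z /=; rewrite (model_oiK M).
Qed.

Lemma model_opp (F : E -> \bar R) : measurable_fun setT (F \o io : T -> \bar R) ->
  (forall x, 0 <= F x)%E -> (\int[m]_x F (- io x)%R = \int[m]_x F (io x))%E.
Proof.
move=> mF F0; rewrite -[RHS](model_refl M 0)//.
by apply: eq_integral => x _; rewrite sub0r.
Qed.

Lemma emfun_opp (F : E -> \bar R) : measurable_fun setT (F \o io : T -> \bar R) ->
  measurable_fun setT ((fun y => F (- y)) \o io : T -> \bar R).
Proof.
move=> mF; rewrite (_ : _ \o io =
   (F \o io) \o ((fun z : T * T => oi (io z.1 - io z.2)) \o pair (oi 0))).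
  apply: measurableT_comp => //; apply: measurableT_comp; first exact: (model_sub M).
  exact: pair1_measurable.
by apply/funext => z /=; rewrite !(model_oiK M) sub0r.
Qed.

(** A translation is the composition of two reflections, one about 0 and one about [a]. *)
Lemma model_trans (F : E -> \bar R) a : measurable_fun setT (F \o io : T -> \bar R) ->
  (forall x, 0 <= F x)%E -> (\int[m]_x F (io x - a)%R = \int[m]_x F (io x))%E.
Proof.
move=> mF F0; rewrite -[RHS]model_opp//.
rewrite -[RHS](model_refl M (a) (F := fun y => F (- y)%R))//; last exact: emfun_opp.
by apply: eq_integral => x _; rewrite opprB.
Qed.

Lemma L1_mfun f : L1 f -> mfun f.
Proof. by move=> /measurable_int /measurable_EFinP. Qed.

Lemma norm1E f : L1 f -> (\int[m]_x `|f (io x)|%:E = (norm1 f)%:E)%E.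
Proof.
move=> /integrableP[_ fi]; rewrite /Rintegral fineK// ge0_fin_numE//.
by apply: integral_ge0 => x _; rewrite lee_fin normr_ge0.
Qed.

Lemma norm1_ge0 f : 0 <= norm1 f.
Proof. by apply: Rintegral_ge0 => x _; exact: normr_ge0. Qed.

Lemma L1P f : L1 f <-> mfun f /\ (\int[m]_x `|f (io x)|%:E < +oo)%E.
Proof.
split=> [fi|[mf fi]]; first by split; [exact: L1_mfun|case/integrableP: fi].
by apply/integrableP; split => //; exact/measurable_EFinP.
Qed.

Lemma L1_refl f x : L1 f -> L1 (fun y => f (x - y)).
Proof.
move=> /L1P[mf fi]; apply/L1P; split; first exact: mfun_subr.
rewrite (model_refl M (F := fun y => `|f y|%:E) x)//.
by apply/measurable_EFinP; exact: (measurableT_comp (@normr_measurable _ _)).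
Qed.

Lemma L1_trans f x : L1 f -> L1 (fun y => f (y - x)).
Proof.
move=> /L1P[mf fi]; apply/L1P; split; first exact: mfun_subl.
rewrite (model_trans (F := fun y => `|f y|%:E) x)//.
by apply/measurable_EFinP; exact: (measurableT_comp (@normr_measurable _ _)).
Qed.

(** The invariances of the model concern nonnegative functions; signed integrals inherit them
    through positive and negative parts. *)
Lemma I_split f : L1 f -> I f = I (fun x => Num.max (f x) 0) - I (fun x => Num.max (- f x) 0).
Proof.
move=> fi; rewrite -RintegralB//; last 2 first.
  - by have := integrable_funrpos measurableT fi.
  - by have := integrable_funrneg measurableT fi.
apply: eq_Rintegral => x _ /=.
by have [|] := leP (f (io x)) 0; have [|] := leP (- f (io x)) 0; lra.
Qed.

Lemma I_refl f x : L1 f -> I (fun y => f (x - y)) = I f.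
Proof.
move=> fi; rewrite (I_split fi) (I_split (L1_refl x fi)); have mf := L1_mfun fi.
congr (_ - _); rewrite /Rintegral; congr fine.
  rewrite (model_refl M (F := fun y => (Num.max (f y) 0)%:E) x)//.
    by apply/measurable_EFinP; exact: (measurable_funrpos mf).
  by move=> y; rewrite lee_fin le_max lexx orbT.
rewrite (model_refl M (F := fun y => (Num.max (- f y) 0)%:E) x)//.
  by apply/measurable_EFinP; exact: (measurable_funrneg mf).
by move=> y; rewrite lee_fin le_max lexx orbT.
Qed.

Lemma I_trans f x : L1 f -> I (fun y => f (y - x)) = I f.
Proof.
move=> fi; rewrite (I_split fi) (I_split (L1_trans x fi)); have mf := L1_mfun fi.
congr (_ - _); rewrite /Rintegral; congr fine.
  rewrite (model_trans (F := fun y => (Num.max (f y) 0)%:E) x)//.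
    by apply/measurable_EFinP; exact: (measurable_funrpos mf).
  by move=> y; rewrite lee_fin le_max lexx orbT.
rewrite (model_trans (F := fun y => (Num.max (- f y) 0)%:E) x)//.
  by apply/measurable_EFinP; exact: (measurable_funrneg mf).
by move=> y; rewrite lee_fin le_max lexx orbT.
Qed.

Lemma L1_le f g : mfun f -> L1 g -> (forall x, `|f x| <= g x) -> L1 f.
Proof.
move=> mf gi fg; apply: le_integrable gi => //; first exact/measurable_EFinP.
by move=> x _ /=; rewrite lee_fin (le_trans (fg _))// ler_norm.
Qed.

Lemma L1Z (a : R) f : L1 f -> L1 (fun x => a * f x).
Proof. by move=> /(integrableZl measurableT a); apply: eq_integrable. Qed.

Lemma L1D f g : L1 f -> L1 g -> L1 (fun x => f x + g x).
Proof. by move=> fi gi; have := integrableD measurableT fi gi; apply: eq_integrable. Qed.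

Lemma L1B f g : L1 f -> L1 g -> L1 (fun x => f x - g x).
Proof. by move=> fi gi; have := integrableB measurableT fi gi; apply: eq_integrable. Qed.

Lemma L1_norm f : L1 f -> L1 (fun x => `|f x|).
Proof. by move=> /integrable_norm. Qed.

Lemma L1M (C : R) f g : L1 f -> mfun g -> (forall x, `|g x| <= C) ->
  L1 (fun x => f x * g x).
Proof.
move=> fi mg gC; apply: (@L1_le _ (fun x => C * `|f x|)).
- by apply: measurable_funM => //; exact: L1_mfun.
- by apply: L1Z; exact: L1_norm.
- by move=> x; rewrite normrM mulrC ler_wpM2r.
Qed.

Lemma IM_le (C : R) f g : L1 f -> mfun g -> (forall x, `|g x| <= C) ->
  `|I (fun x => f x * g x)| <= C * norm1 f.
Proof.
move=> fi mg gC.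
rewrite (le_trans (le_normr_Rintegral _ (L1M fi mg gC)))//.
rewrite -RintegralZl//; last exact: (L1_norm fi).
apply: le_Rintegral => //.
- exact: (L1_norm (L1M fi mg gC)).
- exact: (L1Z C (L1_norm fi)).
- by move=> x _ /=; rewrite normrM mulrC ler_wpM2r.
Qed.

Lemma vanish_L1 (r C : R) f : 0 <= r -> mfun f -> vanish_outside r f ->
  (forall x, `|f x| <= C) -> L1 f /\ norm1 f <= C * (2 * r) ^+ d.
Proof.
move=> r0 mf fr fC; have C0 : 0 <= C by rewrite (le_trans (normr_ge0 (f 0))).
pose B := [set x : T | enorm (io x) <= r].
have mB : measurable B.
  have := model_cont M (@enorm_continuous R d).
  move=> /(_ measurableT `]-oo, r]%classic (measurable_itv _)).
  rewrite setTI; congr measurable; apply/seteqP; split => x /=; rewrite in_itv//=.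
have HB : (\int[m]_x `|f (io x)|%:E <= (C * (2 * r) ^+ d)%:E)%E.
  apply: (@le_trans _ _ (\int[m]_x (C * \1_B x)%:E)%E).
    apply: ge0_le_integral => //.
    - by apply/measurable_EFinP; exact: (measurableT_comp (@normr_measurable _ _)).
    - by apply/measurable_EFinP; apply: measurable_funM => //; exact: measurable_indic.
    - move=> x _; rewrite lee_fin indicE; have [xB|xB] := boolP (x \in B).
        by rewrite mulr1.
      rewrite fr ?normr0 ?mulr0// ltNge; apply/negP => xr.
      by move/negP: xB; apply; rewrite inE.
  under eq_integral do rewrite EFinM.
  rewrite ge0_integralZl//; last by apply/measurable_EFinP; exact: measurable_indic.
  rewrite integral_indic// setIT EFinM lee_wpmul2l ?lee_fin//.
  exact: (model_ball M).
have fi : L1 f by apply/L1P; split => //; apply: (le_lt_trans HB); rewrite ltry.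
by split => //; rewrite -lee_fin -norm1E.
Qed.

Lemma test_mfun f : test_function f -> mfun f.
Proof. by move=> /test_continuous; exact: (model_cont M). Qed.

Lemma test_L1 f : test_function f -> L1 f.
Proof.
move=> tf; have [r r0 fr] := test_vanish tf; have [C C0 fC] := test_bounded tf.
by have [] := vanish_L1 (ltW r0) (test_mfun tf) fr fC.
Qed.

(** The translation is moved onto the bounded factor [g]. In this form all the regularity of the
    convolution comes from [g], and [K] need only be integrable. *)
Lemma convolutionC K g x : L1 K -> mfun g -> (exists C, forall x, `|g x| <= C) ->
  convolution K g x = I (fun y => K y * g (x - y)).
Proof.
move=> Ki mg [C gC]; rewrite convolutionE.
have Fi : L1 (fun y => K y * g (x - y)).
  by apply: L1M Ki _ _ => //; exact: mfun_subr.
rewrite -(I_refl x Fi); apply: eq_Rintegral => y _ /=.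
by rewrite opprB addrCA subrr addr0.
Qed.

Definition bmfun g : Prop := mfun g /\ exists C, forall x, `|g x| <= C.

Lemma test_bmfun g : test_function g -> bmfun g.
Proof.
by move=> tg; split; [exact: test_mfun|have [C _ gC] := test_bounded tg; exists C].
Qed.

Lemma bmfun_refl g x : bmfun g -> bmfun (fun y => g (x - y)).
Proof. by move=> [mg [C gC]]; split; [exact: mfun_subr|exists C]. Qed.

Lemma bmfunB g h : bmfun g -> bmfun h -> bmfun (fun y => g y - h y).
Proof.
move=> [mg [C gC]] [mh [C' hC']]; split; first exact: measurable_funB.
by exists (C + C') => x; rewrite (le_trans (ler_normB _ _))// lerD.
Qed.

Lemma bmfun_cst (a : R) : bmfun (fun=> a).
Proof. by split; [exact: measurable_cst|exists `|a|]. Qed.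

Lemma L1_bmfun K g : L1 K -> bmfun g -> L1 (fun y => K y * g y).
Proof. by move=> Ki [mg [C gC]]; exact: L1M gC. Qed.

Lemma I_KB K u v : L1 K -> bmfun u -> bmfun v ->
  I (fun y => K y * u y) - I (fun y => K y * v y) = I (fun y => K y * (u y - v y)).
Proof.
move=> Ki bu bv; rewrite -RintegralB//; [|exact: (L1_bmfun Ki bu)|exact: (L1_bmfun Ki bv)].
by apply: eq_Rintegral => y _ /=; rewrite mulrBr.
Qed.

Lemma IZ (a : R) f : L1 f -> I (fun y => a * f y) = a * I f.
Proof. by move=> fi; rewrite -RintegralZl. Qed.

Lemma IB f g : L1 f -> L1 g -> I (fun y => f y - g y) = I f - I g.
Proof. by move=> fi gi; rewrite -RintegralB. Qed.

Lemma ID f g : L1 f -> L1 g -> I (fun y => f y + g y) = I f + I g.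
Proof. by move=> fi gi; rewrite -RintegralD. Qed.

Lemma le_I f g : L1 f -> L1 g -> (forall x, f x <= g x) -> I f <= I g.
Proof. by move=> fi gi fg; apply: le_Rintegral => // x _; exact: fg. Qed.

Lemma I_le_norm1 (C : R) f g : mfun g -> L1 f -> (forall x, `|g x| <= C * `|f x|) ->
  `|I g| <= C * norm1 f.
Proof.
move=> mg fi gf; have gi : L1 g by apply: (L1_le mg (L1Z C (L1_norm fi))).
rewrite (le_trans (le_normr_Rintegral _ gi))//.
rewrite -[leRHS](IZ C (L1_norm fi)).
by apply: (le_I (L1_norm gi) (L1Z C (L1_norm fi))).
Qed.

Lemma convE K g x : L1 K -> bmfun g -> convolution K g x = I (fun y => K y * g (x - y)).
Proof. by move=> Ki [mg gC]; exact: convolutionC. Qed.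

Lemma conv_sup_le (C : R) K g x : L1 K -> mfun g -> (forall x, `|g x| <= C) ->
  `|convolution K g x| <= C * norm1 K.
Proof.
move=> Ki mg gC; rewrite convE//; last by split => //; exists C.
by apply: IM_le => //; exact: mfun_subr.
Qed.

Lemma convBr K g h : L1 K -> bmfun g -> bmfun h ->
  convolution K (g - h) = convolution K g - convolution K h.
Proof.
move=> Ki bg bh; apply/funext => x; rewrite !fctE !convE//; last exact: bmfunB.
by rewrite I_KB//; exact: bmfun_refl.
Qed.

Lemma convBl K K' g : L1 K -> L1 K' -> bmfun g ->
  convolution (K - K') g = convolution K g - convolution K' g.
Proof.
move=> Ki Ki' bg; apply/funext => x; rewrite !fctE !convE//; last exact: L1B.
rewrite -IB; [|exact: (L1_bmfun Ki (bmfun_refl x bg))|exact: (L1_bmfun Ki' (bmfun_refl x bg))].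
by apply: eq_Rintegral => y _ /=; rewrite mulrBl.
Qed.

Lemma convDl K K' g : L1 K -> L1 K' -> bmfun g ->
  convolution (K + K') g = convolution K g + convolution K' g.
Proof.
move=> Ki Ki' bg; apply/funext => x; rewrite !fctE !convE//; last exact: L1D.
rewrite -ID; [|exact: (L1_bmfun Ki (bmfun_refl x bg))|exact: (L1_bmfun Ki' (bmfun_refl x bg))].
by apply: eq_Rintegral => y _ /=; rewrite mulrDl.
Qed.

Lemma convZl (a : R) K g : L1 K -> bmfun g ->
  convolution (a \*: K) g = a \*: convolution K g.
Proof.
move=> Ki bg; apply/funext => x; rewrite /= convE//; last exact: L1Z.
rewrite convE// [RHS]/GRing.scale/= -(IZ a (L1_bmfun Ki (bmfun_refl x bg))).
by apply: eq_Rintegral => y _ /=; rewrite /GRing.scale/= mulrA.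
Qed.

Lemma conv_comm f g : test_function f -> test_function g ->
  convolution f g = convolution g f.
Proof.
move=> tf tg; apply/funext => x; rewrite convE; [|exact: test_L1|exact: test_bmfun].
by rewrite convolutionE; apply: eq_Rintegral => y _ /=; rewrite mulrC.
Qed.

Lemma is_derive_quad (F : E -> R) x v (D C : R) :
  (forall h : R, `|F (h *: v + x) - F x - h * D| <= C * h ^+ 2) -> is_derive x v F D.
Proof.
move=> FC.
have cv : h^-1 *: ((F \o shift x) (h *: v) - F x) @[h --> 0^'] --> D.
  apply/cvgrPdist_le => e e0; near=> h.
  have h0 : h != 0 by near: h; exact: nbhs_dnbhs_neq.
  have he : `|h| <= e / (`|C| + 1).
    by near: h; apply: dnbhs0_le; rewrite divr_gt0// ltr_wpDl.
  rewrite /= [_ *: _]/(_ * _) -(mulKf h0 D) -mulrBr normrM normfV mulrC distrC.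
  rewrite ler_pdivrMr ?normr_gt0// (le_trans (FC h))//.
  rewrite -[h ^+ 2]ger0_norm ?sqr_ge0// normrX expr2 mulrA ler_wpM2r//.
  move: he; rewrite ler_pdivlMr ?ltr_wpDl// => /(le_trans _); apply.
  by rewrite mulrC ler_wpM2l// (le_trans (ler_norm C))// lerDl.
by split; [apply/cvg_ex; exists D|exact: cvg_lim cv].
Unshelve. all: by end_near.
Qed.

(** Differentiation under the integral without dominated convergence: the second-order Taylor error
    of [g] is at most C h^2 uniformly, hence at most C |K|_1 h^2 after integration against [K]. *)
Lemma conv_is_derive K g i x : L1 K -> test_function g ->
  is_derive x (delta_mx ord0 i) (convolution K g) (convolution K (partial i g) x).
Proof.
move=> Ki tg; set e := delta_mx ord0 i.
have [C C0 gC] := test_dbound 2 tg.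
have bg := test_bmfun tg; have bpg := test_bmfun (test_partial i tg).
apply: (@is_derive_quad _ _ _ _ (C * norm1 K)) => h.
rewrite !convE// -IZ; last exact: (L1_bmfun Ki (bmfun_refl x bpg)).
rewrite I_KB//; [|exact: bmfun_refl|exact: bmfun_refl].
rewrite -IB; last 2 first.
- by apply: L1_bmfun => //; apply: bmfunB; exact: bmfun_refl.
- by apply: L1Z; exact: (L1_bmfun Ki (bmfun_refl x bpg)).
rewrite mulrAC; apply: I_le_norm1 => //.
  apply: measurable_funB.
    by apply: measurable_funM; [exact: L1_mfun|case: (bmfunB (bmfun_refl (h *: e + x) bg) (bmfun_refl x bg))].
  exact: (L1_mfun (L1Z h (L1_bmfun Ki (bmfun_refl x bpg)))).
move=> y /=; rewrite mulrCA -mulrBr normrM mulrC ler_wpM2r//.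
have := @dbound2_taylor R d g C (x - y) (h *: e) (test_smooth tg) (ltW C0) gC.
rewrite (_ : x - y + h *: e = h *: e + x - y); last by rewrite addrC addrA.
rewrite (bigD1 i)//= big1 ?addr0; last first.
  by move=> j ji; rewrite !mxE (negbTE ji) andbF mulr0 mul0r.
rewrite !mxE !eqxx mulr1 => /le_trans; apply; rewrite ler_wpM2l ?(ltW C0)//.
rewrite /l1norm (bigD1 i)//= big1 ?addr0; last first.
  by move=> j ji; rewrite !mxE (negbTE ji) andbF mulr0 normr0.
by rewrite !mxE !eqxx mulr1 real_normK ?num_real.
Qed.

Lemma conv_partial K g i : L1 K -> test_function g ->
  partial i (convolution K g) = convolution K (partial i g).
Proof. by move=> Ki tg; apply/funext => x; have [] := conv_is_derive i x Ki tg. Qed.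

Lemma conv_iter K g s : L1 K -> test_function g ->
  foldr partial (convolution K g) s = convolution K (foldr partial g s).
Proof.
by move=> Ki tg; elim: s => //= i s ->; rewrite conv_partial//; exact: test_iter.
Qed.

Lemma lip_continuous (F : E -> R) (C : R) : 0 <= C ->
  (forall x z, `|F (x + z) - F x| <= C * enorm z) -> continuous F.
Proof.
move=> C0 FC x.
apply/(@cvgrPdist_le R R^o E (nbhs x) (nbhs_filter x) F (F x)) => e e0.
have C1 : 0 < C + 1 by rewrite ltr_wpDl.
(* The neighbourhoods come from the sup norm; continuity of [enorm] at 0 makes [enorm (y - x)] small
   on them. *)
have := @enorm_continuous R d 0; rewrite /continuous_at enorm0.
move=> /(@cvgrPdist_le R R^o E (nbhs (0 : E)) (nbhs_filter (0 : E)) enorm 0).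
move=> /(_ (e / (C + 1)) (divr_gt0 e0 C1))/nbhs_ballP[eta /= eta0 Heta].
apply/nbhs_ballP; exists eta => //= y.
rewrite -ball_normE /= distrC => xy; have := Heta (y - x).
rewrite -ball_normE/= sub0r normrN => /(_ xy).
rewrite sub0r normrN (ger0_norm (enorm_ge0 _)) ler_pdivlMr// => ye.
rewrite distrC -[y](subrK x) [_ + x]addrC (le_trans (FC _ _))// (le_trans _ ye)//.
by rewrite mulrC ler_wpM2l ?enorm_ge0// lerDl.
Qed.

Lemma conv_continuous K g : L1 K -> test_function g -> continuous (convolution K g).
Proof.
move=> Ki tg.
have [C C0 gC] := test_dbound 1 tg; have bg := test_bmfun tg.
apply: (@lip_continuous _ (C * d%:R * norm1 K)).
  by rewrite !mulr_ge0 ?norm1_ge0// ltW.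
move=> x z.
rewrite !convE// I_KB//; [|exact: bmfun_refl|exact: bmfun_refl].
rewrite mulrAC; apply: IM_le => //.
  by case: (bmfunB (bmfun_refl (x + z) bg) (bmfun_refl x bg)).
move=> y; rewrite addrAC (le_trans (dbound1_lip _ _ (test_smooth tg) gC))//.
by rewrite -mulrA ler_wpM2l ?(ltW C0)//; exact: l1norm_le.
Qed.

Lemma conv_smooth K g : L1 K -> test_function g -> smooth (convolution K g).
Proof.
move=> Ki tg.
apply: (@smooth_closed _ _ (fun F => exists2 g, test_function g & F = convolution K g)).
- by move=> _ [h th ->]; exact: conv_continuous.
- by move=> _ i x [h th ->]; have [] := conv_is_derive i x Ki th.
- move=> _ i [h th ->]; exists (partial i h); first exact: test_partial.
  exact: conv_partial.
- by exists g.
Qed.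

Lemma vanish_conv (r r' : R) K g : vanish_outside r K -> vanish_outside r' g ->
  vanish_outside (r + r') (convolution K g).
Proof.
move=> Kr gr x rx; rewrite convolutionE /Rintegral; rewrite integral0_eq// => y _ /=.
have [yr|yr] := leP (enorm (io y)) r'; last by rewrite (gr (io y))// mulr0.
rewrite Kr ?mul0r// ltNge; apply/negP => xyr.
have := enorm_triangle (x - io y) (io y).
by rewrite subrK leNgt (le_lt_trans _ rx)// lerD.
Qed.

Lemma test_conv K g : L1 K -> (exists2 r, 0 < r & vanish_outside r K) ->
  test_function g -> test_function (convolution K g).
Proof.
move=> Ki [r r0 Kr] tg; have [r' r'0 gr] := test_vanish tg.
apply/test_functionP; split; first exact: conv_smooth.
by exists (r + r'); [rewrite addr_gt0|exact: vanish_conv].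
Qed.

Lemma emfun_norm f : mfun f -> measurable_fun [set: T] (fun y : T => `|f (io y)|%:E).
Proof. by move=> mf; apply/measurable_EFinP; exact: (measurableT_comp (@normr_measurable _ _)). Qed.

Lemma norm1_refl f x : mfun f ->
  (\int[m]_y `|f (x - io y)|%:E = \int[m]_y `|f (io y)|%:E)%E.
Proof. by move=> mf; rewrite (model_refl M (F := fun y => `|f y|%:E) x)//; exact: emfun_norm. Qed.

Lemma norm1_trans f x : mfun f ->
  (\int[m]_y `|f (io y - x)|%:E = \int[m]_y `|f (io y)|%:E)%E.
Proof. by move=> mf; rewrite (model_trans (F := fun y => `|f y|%:E) x)//; exact: emfun_norm. Qed.

Lemma mfun_fst f : mfun f -> measurable_fun setT (fun z : T * T => f (io z.1)).
Proof. by move=> mf; apply: (measurableT_comp mf); exact: measurable_fst. Qed.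

Lemma mfun_snd f : mfun f -> measurable_fun setT (fun z : T * T => f (io z.2)).
Proof. by move=> mf; apply: (measurableT_comp mf); exact: measurable_snd. Qed.

(** Fubini for a(x - y) b(y - z) c(z). Since [a] is only integrable, joint integrability uses the
    sup bound of [b] and the integrability of [a] and [c]. *)
Lemma conv_assoc a b c : L1 a -> test_function b -> test_function c ->
  L1 (convolution a b) ->
  convolution a (convolution b c) = convolution (convolution a b) c.
Proof.
move=> ai tb tc abi; apply/funext => x.
have [C C0 bC] := test_bounded tb.
have ma := L1_mfun ai; have mb := test_mfun tb; have mc := test_mfun tc.
have ci := test_L1 tc; have bb := test_bmfun tb; have bc := test_bmfun tc.
pose F (z : T * T) : \bar R := (a (x - io z.1) * b (io z.1 - io z.2) * c (io z.2))%:E.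
have mF : measurable_fun setT F.
  apply/measurable_EFinP; apply: measurable_funM; last exact: mfun_snd.
  apply: measurable_funM; last exact: mfun_sub.
  exact: (@mfun_fst (fun y => a (x - y)) (mfun_subr x ma)).
have iF : (m \x m)%E.-integrable setT F.
  apply/integrable21ltyP => //.
  apply: (@le_lt_trans _ _ (\int[m]_y ((C * norm1 a)%:E * `|c (io y)|%:E))%E).
    apply: ge0_le_integral => //.
    - by move=> y _; exact: integral_ge0.
    - apply: (measurable_fun_fubini_tonelli_G (abse \o F)) => //.
        exact: measurableT_comp.
      by move=> z; exact: abse_ge0.
    - by apply: measurable_funeM; exact: emfun_norm.
    move=> y _; rewrite EFinM -norm1E// -(norm1_refl x)// muleAC -EFinM.
    rewrite -ge0_integralZl//; last 2 first.
    - by apply: (@emfun_norm (fun y => a (x - y))); exact: mfun_subr.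
    - by rewrite lee_fin mulr_ge0// ltW.
    apply: ge0_le_integral => //.
    - by apply: measurableT_comp => //; exact: (measurable_fun_pair1 _ mF).
    - by apply: measurable_funeM; apply: (@emfun_norm (fun y => a (x - y))); exact: mfun_subr.
    move=> z _; rewrite /F /= lee_fin !normrM.
    by rewrite -mulrA mulrC ler_wpM2r// ler_wpM2r.
  rewrite ge0_integralZl//; last 2 first.
  - exact: emfun_norm.
  - by rewrite lee_fin mulr_ge0 ?norm1_ge0// ltW.
  by rewrite norm1E// -EFinM ltry.
have := Fubini iF.
have -> : (\int[m]_y \int[m]_z F (y, z) = \int[m]_y (a (x - io y) * convolution b c (io y))%:E)%E.
  apply: eq_integral => y _.
  rewrite convolutionE EFinM /Rintegral fineK; last first.
    apply: integrable_fin_num => //.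
    have := L1_bmfun ci (bmfun_refl (io y) bb).
    by apply: eq_integrable => // z _ /=; rewrite mulrC.
  rewrite -integralZl//; last first.
    have := L1_bmfun ci (bmfun_refl (io y) bb).
    by apply: eq_integrable => // z _ /=; rewrite mulrC.
  by apply: eq_integral => z _; rewrite /F /= -EFinM mulrA.
have -> : (\int[m]_z \int[m]_y F (y, z) = \int[m]_z (convolution a b (x - io z) * c (io z))%:E)%E.
  apply: eq_integral => z _.
  have Gi : L1 (fun w => a (x - io z - w) * b w).
    have := L1_bmfun (L1_refl (x - io z) ai) bb.
    by apply: eq_integrable.
  rewrite convolutionE -(I_trans (io z) Gi) EFinM muleC /Rintegral fineK; last first.
    by apply: integrable_fin_num => //; exact: (L1_trans (io z) Gi).
  rewrite -integralZl//; last exact: (L1_trans (io z) Gi).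
  apply: eq_integral => y _; rewrite /F /= -EFinM.
  have -> : x - io z - (io y - io z) = x - io y by rewrite opprB addrA subrK.
  by rewrite mulrC.
by rewrite !convolutionE /Rintegral => ->.
Qed.

Lemma I_conv a b : test_function a -> test_function b ->
  I (convolution a b) = I a * I b.
Proof.
move=> ta tb.
have ma := test_mfun ta; have mb := test_mfun tb.
have ai := test_L1 ta; have bi := test_L1 tb; have ba := test_bmfun ta.
pose F (z : T * T) : \bar R := (a (io z.1 - io z.2) * b (io z.2))%:E.
have mF : measurable_fun setT F.
  by apply/measurable_EFinP; apply: measurable_funM; [exact: mfun_sub|exact: mfun_snd].
have iF : (m \x m)%E.-integrable setT F.
  apply/integrable21ltyP => //.
  rewrite (eq_integral (fun y : T => `|b (io y)|%:E * (norm1 a)%:E)%E); last first.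
    move=> y _; rewrite -norm1E// -(norm1_trans (io y))// -ge0_integralZl//; last first.
      by apply: (@emfun_norm (fun z => a (z - io y))); exact: mfun_subl.
    by apply: eq_integral => z _; rewrite /F /= normrM mulrC EFinM.
  rewrite ge0_integralZr//; last 2 first.
  - exact: emfun_norm.
  - by rewrite lee_fin norm1_ge0.
  by rewrite norm1E// -EFinM ltry.
have := Fubini iF.
have -> : (\int[m]_x \int[m]_y F (x, y) = \int[m]_x (convolution a b (io x))%:E)%E.
  apply: eq_integral => x _; rewrite convolutionE /Rintegral fineK//.
  apply: integrable_fin_num => //.
  have := L1_bmfun bi (bmfun_refl (io x) ba).
  by apply: eq_integrable => // z _ /=; rewrite mulrC.
have -> : (\int[m]_y \int[m]_x F (x, y) = \int[m]_y ((I a) * b (io y))%:E)%E.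
  apply: eq_integral => y _; rewrite -(I_trans (io y) ai) EFinM muleC /Rintegral fineK; last first.
    by apply: integrable_fin_num => //; exact: (L1_trans (io y) ai).
  rewrite -integralZl//; last exact: (L1_trans (io y) ai).
  by apply: eq_integral => x _; rewrite /F /= -EFinM mulrC.
by rewrite -(IZ _ bi) /Rintegral => ->.
Qed.

(* [c = 0] gives Young's inequality; [c = 1] gains the modulus of continuity of
   [K] when [g] has zero mean. *)
Lemma norm1_conv (c W r : R) K g : L1 K -> (exists2 r, 0 < r & vanish_outside r K) ->
  test_function g -> 0 <= r -> vanish_outside r g -> c * I g = 0 ->
  (forall y, enorm y <= r -> norm1 (fun x => K (x - y) - c * K x) <= W) ->
  norm1 (convolution K g) <= W * norm1 g.
Proof.
move=> Ki Kr tg r0 gr cg HW.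
have mK := L1_mfun Ki; have mg := test_mfun tg.
have gi := test_L1 tg; have bg := test_bmfun tg.
have tc := test_conv Ki Kr tg; have ci := test_L1 tc.
pose F (z : T * T) : \bar R := (`|K (io z.1 - io z.2) - c * K (io z.1)| * `|g (io z.2)|)%:E.
have mF : measurable_fun setT F.
  apply/measurable_EFinP; apply: measurable_funM; last first.
    by apply: measurableT_comp => //; exact: mfun_snd.
  apply: measurableT_comp => //; apply: measurable_funB; first exact: mfun_sub.
  by apply: measurable_funM => //; exact: mfun_fst.
have F0 z : (0 <= F z)%E by rewrite lee_fin mulr_ge0.
rewrite -lee_fin -norm1E//.
apply: (@le_trans _ _ (\int[m]_x \int[m]_y F (x, y))%E).
  apply: ge0_le_integral => //.
  - exact/emfun_norm/test_mfun.
  - exact: (measurable_fun_fubini_tonelli_F F).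
  move=> x _.
  have Gi : L1 (fun y => K (io x - y) * g y) by exact: (L1_bmfun (L1_refl (io x) Ki) bg).
  have Hi : L1 (fun y => K (io x - y) * g y - (c * K (io x)) * g y).
    by apply: L1B => //; exact: L1Z.
  (* Subtracting c K(x) g(y) does not change the integral in y, as c times the mean of [g] is
     zero. *)
  have -> : convolution K g (io x) = I (fun y => K (io x - y) * g y - (c * K (io x)) * g y).
    by rewrite IB//; [rewrite IZ// mulrAC cg mul0r subr0 convolutionE|exact: L1Z].
  rewrite (EFin_normr_Rintegral measurableT Hi).
  apply: (le_trans (le_abse_integral _ _ _)) => //; first exact: measurable_int Hi.
  rewrite le_eqVlt; apply/orP; left; apply/eqP; apply: eq_integral => y _ /=.
  by rewrite -mulrBl normrM.
rewrite (fubini_tonelli F)//.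
apply: (@le_trans _ _ (\int[m]_y (W%:E * `|g (io y)|%:E))%E).
  apply: ge0_le_integral => //.
  - by move=> y _; exact: integral_ge0.
  - exact: (measurable_fun_fubini_tonelli_G F).
  - by apply: measurable_funeM; exact: emfun_norm.
  move=> y _; rewrite /F /=.
  have [yr|yr] := leP (enorm (io y)) r; last first.
    rewrite (gr _ yr) normr0 mule0 integral0_eq// => z _ /=.
    by rewrite mulr0.
  have Di : L1 (fun z => K (z - io y) - c * K z).
    by apply: L1B; [exact: L1_trans|exact: L1Z].
  under eq_integral do rewrite EFinM.
  rewrite ge0_integralZr//; last exact: (emfun_norm (L1_mfun Di)).
  by rewrite (norm1E Di) lee_wpmul2r// lee_fin HW.
rewrite ge0_integralZl//.
- by rewrite norm1E// EFinM.
- exact: emfun_norm.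
(* Nonnegativity of [W] is read off from its defining bound at y = 0. *)
- by rewrite lee_fin (le_trans (norm1_ge0 (fun x => K (x - 0) - c * K x)))//; apply: HW; rewrite enorm0.
Qed.

Lemma mfun_dilate n f : continuous f -> mfun (dilate (2 ^+ n) f).
Proof.
move=> cf; apply: (model_cont M) => x.
apply: (@continuous_comp E E R ( *:%R (2 ^+ n))); last exact: cf.
exact: scaler_continuous.
Qed.

Lemma norm1_scale n f : continuous f -> L1 f ->
  L1 (dilate (2 ^+ n) f) /\ 2 ^+ (d * n) * norm1 (dilate (2 ^+ n) f) = norm1 f.
Proof.
move=> cf fi; have mf := L1_mfun fi.
have E1 := model_scale M (F := fun y => `|f y|%:E) n (emfun_norm mf) (fun=> normr_ge0 _).
have di : L1 (dilate (2 ^+ n) f).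
  apply/L1P; split; first exact: mfun_dilate.
  rewrite ltNge leye_eq; apply/negP => /eqP H.
  move: E1; rewrite /dilate in H; rewrite H (norm1E fi) gt0_muley ?lte_fin ?exprn_gt0//.
split => //; apply: EFin_inj; rewrite EFinM -(norm1E di) -(norm1E fi) -E1.
by [].
Qed.

Lemma I_scale n f : continuous f -> L1 f ->
  2 ^+ (d * n) * I (dilate (2 ^+ n) f) = I f.
Proof.
move=> cf fi; have mf := L1_mfun fi; have [di _] := norm1_scale n cf fi.
have pos (g : E -> R) : L1 g -> continuous g -> (forall x, 0 <= g x) ->
    2 ^+ (d * n) * I (dilate (2 ^+ n) g) = I g.
  move=> gi cg g0; have [dgi] := norm1_scale n cg gi.
  have e1 : norm1 (dilate (2 ^+ n) g) = I (dilate (2 ^+ n) g).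
    by apply: eq_Rintegral => x _ /=; rewrite /dilate ger0_norm.
  have e2 : norm1 g = I g by apply: eq_Rintegral => x _ /=; rewrite ger0_norm.
  by rewrite e1 e2.
rewrite (I_split fi) (I_split di) mulrBr.
rewrite -(pos (fun x => Num.max (f x) 0)); last 3 first.
- exact: (integrable_funrpos measurableT fi).
- by move=> x; apply: (@continuous_max R E f (cst 0)); [exact: cf|exact: cst_continuous].
- by move=> x; rewrite le_max lexx orbT.
rewrite -(pos (fun x => Num.max (- f x) 0))//.
- exact: (integrable_funrneg measurableT fi).
- move=> x; apply: (@continuous_max R E (- f) (cst 0)); last exact: cst_continuous.
  by apply: (@continuousN R R^o E); exact: cf.
- by move=> x; rewrite le_max lexx orbT.
Qed.

Lemma L1_sum (J : eqType) (s : seq J) (f : J -> E -> R) : (forall i, L1 (f i)) ->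
  L1 (fun x => \sum_(i <- s) f i x) /\
  I (fun x => \sum_(i <- s) f i x) = \sum_(i <- s) I (f i).
Proof.
move=> fi; elim: s => [|i s [IH1 IH2]].
  have E0 : (fun x : E => \sum_(i <- [::]) f i x) = (fun=> 0).
    by apply/funext => x; rewrite big_nil.
  rewrite E0 big_nil; split; first exact: integrable0.
  by rewrite /Rintegral integral0.
have E1 : (fun x : E => \sum_(j <- i :: s) f j x) = (fun x => f i x + \sum_(j <- s) f j x).
  by apply/funext => x; rewrite big_cons.
by rewrite E1 big_cons -IH2; split; [exact: L1D|rewrite ID].
Qed.

(* The moments kill the affine part of [u] at [x]. *)
Lemma conv_moments (r C : R) K u x : L1 K -> continuous K ->
  0 <= r -> vanish_outside r K -> I K = 0 ->
  (forall i : 'I_d, I (fun y => y ord0 i * K y) = 0) ->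
  test_function u -> 0 <= C -> dbound 2 u C ->
  `|convolution K u x| <= C * (d%:R * r) ^+ 2 * norm1 K.
Proof.
move=> Ki cK r0 Kr K0 K1 tu C0 uC; have bu := test_bmfun tu.
have mc i : mfun (fun y => y ord0 i) by apply: (model_cont M); exact: coord_continuous.
have Ci (i : 'I_d) : L1 (fun y => y ord0 i * K y).
  apply: (@L1_le _ (fun y => r * `|K y|)).
  - exact: (measurable_funM (mc i) (L1_mfun Ki)).
  - by apply: L1Z; exact: L1_norm.
  move=> y; rewrite normrM; have [yr|yr] := leP (enorm y) r.
    by rewrite ler_wpM2r// (le_trans (coord_le_enorm _ _)).
  by rewrite Kr// normr0 !mulr0.
have [Si SE] := L1_sum (index_enum 'I_d) (fun i => L1Z (partial i u x) (Ci i)).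
have Ki1 := L1_bmfun Ki (bmfun_refl x bu).
have -> : convolution K u x =
    I (fun y => (K y * u (x - y) - u x * K y) + \sum_i partial i u x * (y ord0 i * K y)).
  rewrite ID//; last by apply: L1B => //; exact: L1Z.
  rewrite IB//; last exact: L1Z.
  rewrite IZ// K0 mulr0 subr0 convE// SE big1 ?addr0// => i _.
  by rewrite IZ// K1 mulr0.
apply: I_le_norm1 => //.
  by apply: L1_mfun; apply: L1D => //; apply: L1B => //; exact: L1Z.
move=> y; rewrite [X in `|X|](_ : _ = K y * (u (x + - y) - u x -
    \sum_i (- y) ord0 i * partial i u x)); last first.
  rewrite mulrBr mulr_sumr mulrBr -[X in _ = _ - X]opprK -sumrN; congr (_ + _).
    by rewrite [K y * u x]mulrC.
  by rewrite opprK; apply: eq_bigr => i _; rewrite mxE; ring.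
rewrite normrM mulrC; have [yr|yr] := leP (enorm y) r; last first.
  by rewrite Kr// normr0 !mulr0.
rewrite ler_wpM2r// (le_trans (dbound2_taylor _ _ (test_smooth tu) C0 uC))//.
rewrite ler_wpM2l// ler_pXn2r ?nnegrE ?l1norm_ge0 ?mulr_ge0//.
by rewrite (le_trans (l1norm_le _))// enormN ler_wpM2l.
Qed.

(** As [K] has mass one, u(x) is the integral of K(y) u(x), and only the differences u(x) - u(x - y)
    with |y| <= r remain. *)
Lemma conv_sub_id (r C : R) K u x : L1 K -> 0 <= r -> vanish_outside r K -> I K = 1 ->
  test_function u -> 0 <= C -> dbound 1 u C ->
  `|u x - convolution K u x| <= C * (d%:R * r) * norm1 K.
Proof.
move=> Ki r0 Kr K1 tu C0 uC; have bu := test_bmfun tu.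
have -> : u x - convolution K u x = I (fun y => K y * (u x - u (x - y))).
  rewrite -I_KB//; [|exact: bmfun_cst|exact: bmfun_refl].
  rewrite convE//; congr (_ - _).
  by rewrite -[LHS]mulr1 -K1 -IZ//; apply: eq_Rintegral => y _ /=; rewrite mulrC.
apply: I_le_norm1 => //.
  apply: L1_mfun; apply: L1_bmfun => //; apply: bmfunB; [exact: bmfun_cst|exact: bmfun_refl].
move=> y; rewrite normrM mulrC; have [yr|yr] := leP (enorm y) r; last first.
  by rewrite Kr// normr0 !mulr0.
rewrite ler_wpM2r// distrC (le_trans (dbound1_lip _ _ (test_smooth tu) uC))//.
rewrite ler_wpM2l// (le_trans (l1norm_le _))// enormN ler_wpM2l//.
Qed.

Lemma dbound_conv n (C : R) K u : L1 K -> test_function u -> dbound n u C ->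
  dbound n (convolution K u) (C * norm1 K).
Proof.
move=> Ki tu uC s sn x; rewrite conv_iter//.
by apply: conv_sup_le => // [|y]; [apply: test_mfun; exact: test_iter|exact: uC].
Qed.

End ConvolutionAlgebra.

(** * Littlewood-Paley blocks *)

Section LittlewoodPaley.
Context {R : realType} {d : nat} {dT} {T : measurableType dT}.
Context {m : {sigma_finite_measure set T -> \bar R}}.
Context {io : T -> 'rV[R]_d} {oi : 'rV[R]_d -> T}.
Local Notation E := 'rV[R]_d.
Hypothesis M : lebesgue_model m io oi.
Implicit Types (f g h K a b u v : E -> R) (x y : E).

Local Notation mfun f := (measurable_fun [set: T] (f \o io)).
Local Notation L1 f := (m.-integrable [set: T] (EFin \o (f \o io))).
Local Notation I f := (Rintegral m setT (f \o io)).
Local Notation norm1 f := (Rintegral m setT (Num.norm \o (f \o io))).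
Local Notation test := (@test_function R d).
Local Notation conv := (@convolution R d).

Let tL1 := test_L1 M.

Lemma test_conv2 a b : test a -> test b -> test (conv a b).
Proof. by move=> ta tb; apply: (test_conv M (tL1 ta)) => //; exact: test_vanish. Qed.

Lemma convA a b c : test a -> test b -> test c -> conv a (conv b c) = conv (conv a b) c.
Proof.
by move=> ta tb tc; apply: (conv_assoc M (tL1 ta)) => //; apply: tL1; exact: test_conv2.
Qed.

Lemma convC a b : test a -> test b -> conv a b = conv b a.
Proof. exact: (conv_comm M). Qed.

Lemma convCA a b c : test a -> test b -> test c -> conv a (conv b c) = conv b (conv a c).
Proof. by move=> ta tb tc; rewrite convA// (convC ta)// -convA. Qed.

Lemma convB a u v : test a -> test u -> test v -> conv a (u - v) = conv a u - conv a v.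
Proof.
by move=> ta tu tv; apply: (convBr M); [exact: tL1|exact: (test_bmfun M)|exact: (test_bmfun M)].
Qed.

Lemma convDr a u v : test a -> test u -> test v -> conv a (u + v) = conv a u + conv a v.
Proof.
move=> ta tu tv; rewrite (convC ta) ?(convC ta)//; last exact: testD.
by apply: (convDl M); [exact: tL1|exact: tL1|exact: (test_bmfun M)].
Qed.

Lemma conv0l g : conv 0 g = 0.
Proof.
apply/funext => x; rewrite (convolutionE M) /Rintegral integral0_eq// => y _ /=.
by rewrite mul0r.
Qed.

Lemma convK_swap K u f : L1 K -> (exists2 r, 0 < r & vanish_outside r K) -> test u -> test f ->
  conv u (conv K f) = conv K (conv u f).
Proof.
move=> Ki Kr tu tf; have tKf := test_conv M Ki Kr tf.
by rewrite convC// -(conv_assoc M Ki) ?(convC tf)//; exact: tL1.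
Qed.

Lemma convK_assoc K u f : L1 K -> (exists2 r, 0 < r & vanish_outside r K) -> test u -> test f ->
  conv K (conv u f) = conv (conv K u) f.
Proof. by move=> Ki Kr tu tf; apply: (conv_assoc M Ki) => //; apply/tL1/(test_conv M Ki). Qed.

Lemma norm1_conv_le K g : L1 K -> (exists2 r, 0 < r & vanish_outside r K) -> test g ->
  norm1 (conv K g) <= norm1 K * norm1 g.
Proof.
move=> Ki Kr tg; have [r r0 gr] := test_vanish tg.
apply: (@norm1_conv _ _ _ _ _ _ _ M 0 _ r) => //; [exact: ltW|by rewrite mul0r|].
move=> y _; rewrite le_eqVlt; apply/orP; left; apply/eqP.
rewrite -(I_trans M y (L1_norm Ki)).
by apply: eq_Rintegral => x _ /=; rewrite mul0r subr0.
Qed.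

Lemma norm1D_le f g : L1 f -> L1 g -> norm1 (f + g) <= norm1 f + norm1 g.
Proof.
move=> fi gi; rewrite -(ID (L1_norm fi) (L1_norm gi)).
apply: (le_I (L1_norm (L1D fi gi)) (L1D (L1_norm fi) (L1_norm gi))) => x.
exact: ler_normD.
Qed.

Lemma norm1B_le f g : L1 f -> L1 g -> norm1 (f - g) <= norm1 f + norm1 g.
Proof.
move=> fi gi; rewrite -(ID (L1_norm fi) (L1_norm gi)).
apply: (le_I (L1_norm (L1B fi gi)) (L1D (L1_norm fi) (L1_norm gi))) => x.
exact: ler_normB.
Qed.

(** With b = B_k this is the operator D_k of the overview. *)
Definition deflate b h := h - conv b h.

Lemma test_deflate b h : test b -> test h -> test (deflate b h).
Proof. by move=> tb th; apply: testB => //; exact: test_conv2. Qed.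

Lemma test_iter_deflate b n h : test b -> test h -> test (iter n (deflate b) h).
Proof. by move=> tb th; elim: n => //= n; exact: test_deflate. Qed.

Lemma deflate_conv b u v : test b -> test u -> test v ->
  deflate b (conv u v) = conv (deflate b u) v.
Proof.
move=> tb tu tv; rewrite /deflate convA//.
rewrite (convC (testB tu (test_conv2 tb tu)) tv) convB//; last exact: test_conv2.
by rewrite (convC tv tu) (convC tv)//; exact: test_conv2.
Qed.

Lemma iter_deflate_conv n b u v : test b -> test u -> test v ->
  iter n (deflate b) (conv u v) = conv (iter n (deflate b) u) v.
Proof.
by move=> tb tu tv; elim: n => //= n ->; rewrite deflate_conv//; exact: test_iter_deflate.
Qed.

Lemma deflateB b u v : test b -> test u -> test v ->
  deflate b (u - v) = deflate b u - deflate b v.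
Proof. by move=> tb tu tv; rewrite /deflate convB//; apply/funext => x; rewrite !fctE; ring. Qed.

Lemma iter_deflateB n b u v : test b -> test u -> test v ->
  iter n (deflate b) (u - v) = iter n (deflate b) u - iter n (deflate b) v.
Proof.
by move=> tb tu tv; elim: n => //= n ->; rewrite deflateB//; exact: test_iter_deflate.
Qed.

(* [A^n - B^n = (A - B) sum_i A^i B^(n-1-i)] for [A = 1 - a], [B = 1 - b]. *)
Lemma iter_deflate_sub n a b h : test a -> test b -> test h ->
  iter n (deflate a) h - iter n (deflate b) h =
  \sum_(i < n) iter i (deflate a) (iter (n.-1 - i) (deflate b) (conv (b - a) h)).
Proof.
move=> ta tb; elim: n h => [|n IH] h th; first by rewrite big_ord0 subrr.
have tah := test_deflate ta th; have tbh := test_deflate tb th.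
(* With A, B the deflations by a, b: A^(n+1) - B^(n+1) = A^n (A - B) + (A^n - B^n) B, and A - B is
   convolution with b - a. *)
have -> : iter n.+1 (deflate a) h - iter n.+1 (deflate b) h =
    iter n (deflate a) (deflate a h - deflate b h) +
    (iter n (deflate a) (deflate b h) - iter n (deflate b) (deflate b h)).
  by rewrite 2!iterSr iter_deflateB// addrA subrK.
rewrite IH// [RHS]big_ord_recr/= subnn /= addrC; congr (_ + _); last first.
  apply: eq_bigr => i _; congr (iter _ _ _).
  have tba := testB tb ta.
  have -> : conv (b - a) (deflate b h) = deflate b (conv (b - a) h).
    by rewrite (convC tba tbh) -(deflate_conv tb th tba) (convC th tba).
  have -> : (n - i = (n.-1 - i).+1)%N by case: n i {IH} => [[]//|n] i; rewrite subSn// -ltnS.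
  by rewrite iterSr.
congr (iter _ _ _); rewrite (convC (testB tb ta) th) convB// (convC th tb) (convC th ta).
by rewrite /deflate; apply/funext => x; rewrite !fctE; ring.
Qed.

Lemma deflate_iter b h s : test b -> test h ->
  foldr partial (deflate b h) s = deflate b (foldr partial h s).
Proof.
move=> tb th; rewrite /deflate -(conv_iter M s (tL1 tb) th).
rewrite foldr_partialD; [|exact: test_smooth|exact: test_smooth (testN (test_conv2 tb th))].
congr (_ + _).
have NE (u : E -> R) : - u = -1 \*: u by apply/funext => x; rewrite !fctE /= scaleN1r.
by rewrite NE foldr_partialZ ?NE//; exact: test_smooth (test_conv2 tb th).
Qed.

Lemma dbound_deflate n (N C : R) b h : test b -> test h -> 0 <= C -> norm1 b <= N ->
  dbound n h C -> dbound n (deflate b h) ((1 + N) * C).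
Proof.
move=> tb th C0 bN hC s sn x; rewrite deflate_iter// /deflate !fctE.
rewrite (le_trans (ler_normB _ _))// mulrDl mul1r lerD//; first exact: hC.
rewrite (le_trans (conv_sup_le M x (tL1 tb) (test_mfun M (test_iter s th)) (hC s sn)))//.
by rewrite mulrC ler_wpM2r.
Qed.

Lemma dbound_iter_deflate k n (N C : R) b h : test b -> test h -> 0 <= C ->
  norm1 b <= N -> dbound n h C -> dbound n (iter k (deflate b) h) ((1 + N) ^+ k * C).
Proof.
move=> tb th C0 bN hC.
have N0 : 0 <= N by rewrite (le_trans _ bN)// norm1_ge0.
elim: k => [|k IH] /=; first by rewrite expr0 mul1r.
rewrite exprS -mulrA; apply: dbound_deflate => //; first exact: test_iter_deflate.
by rewrite mulr_ge0// exprn_ge0// addr_ge0.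
Qed.

(** The counterpart of [dbound_deflate]: when [b] has mass one, a deflation gains the radius of [b]
    and consumes one derivative. Iteration trades k derivatives for the k-th power of the radius,
    which is how arbitrarily negative alpha is reached. *)
Lemma dbound_deflate_lip n (r N C : R) b h : test b -> test h -> 0 <= C -> 0 <= r ->
  vanish_outside r b -> I b = 1 -> norm1 b <= N ->
  dbound n.+1 h C -> dbound n (deflate b h) (d%:R * r * N * C).
Proof.
move=> tb th C0 r0 br b1 bN hC s sn x; rewrite deflate_iter// /deflate !fctE.
have tsh := test_iter s th.
have hC1 : dbound 1 (foldr partial h s) C.
  by move=> [|i []]// _ y; apply: (hC (i :: s)); rewrite /= sn.
rewrite (le_trans (conv_sub_id M x (tL1 tb) r0 br b1 tsh C0 hC1))//.
rewrite -mulrA mulrC ler_wpM2r// ler_wpM2l// mulr_ge0//.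
Qed.

Lemma dbound_iter_deflate_lip k n (r N C : R) b h : test b -> test h -> 0 <= C -> 0 <= r ->
  vanish_outside r b -> I b = 1 -> norm1 b <= N ->
  dbound (k + n) h C -> dbound n (iter k (deflate b) h) ((d%:R * r * N) ^+ k * C).
Proof.
move=> tb th C0 r0 br b1 bN.
have N0 : 0 <= N by rewrite (le_trans _ bN)// norm1_ge0.
elim: k n => [|k IH] n; first by rewrite expr0 mul1r.
rewrite addSnnS => /IH /= ; rewrite exprS -[_ * _ ^+ k * C]mulrA.
apply: dbound_deflate_lip => //; first exact: test_iter_deflate.
by rewrite mulr_ge0// exprn_ge0// !mulr_ge0.
Qed.

Lemma vanish_deflate (r r' : R) b h : 0 <= r -> vanish_outside r b -> vanish_outside r' h ->
  vanish_outside (r + r') (deflate b h).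
Proof.
move=> r0 br hr; apply: vanishB; last exact: (vanish_conv M).
by apply: vanish_le hr; rewrite lerDr.
Qed.

Lemma vanish_iter_deflate n (r r' : R) b h : 0 <= r -> vanish_outside r b ->
  vanish_outside r' h -> vanish_outside (n%:R * r + r') (iter n (deflate b) h).
Proof.
move=> r0 br hr; elim: n => [|n IH] /=; first by rewrite mul0r add0r.
by rewrite -natr1 mulrDl mul1r [_ * r + r]addrC -addrA; exact: vanish_deflate.
Qed.

Lemma I_deflate b h : test b -> test h -> I h = 0 -> I (deflate b h) = 0.
Proof.
move=> tb th h0; rewrite (IB (tL1 th) (tL1 (test_conv2 tb th))) (I_conv M)// h0.
by rewrite mulr0 subr0.
Qed.

Lemma I_iter_deflate n b h : test b -> test h -> I h = 0 -> I (iter n (deflate b) h) = 0.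
Proof.
move=> tb th h0; elim: n => //= n IH; apply: I_deflate => //; exact: test_iter_deflate.
Qed.

(** * The reproducing formula at dyadic scales *)

Section Blocks.
Variables (S : E -> R) (r0 : R).
Hypothesis tS : test S.
Hypothesis r00 : 0 < r0.
Hypothesis S0 : vanish_outside r0 S.
Hypothesis IS1 : I S = 1.
Hypothesis IS_coord : forall i : 'I_d, I (fun y => y ord0 i * S y) = 0.

Let N := norm1 S.
Let r2 (j : nat) : R := 2 ^- j * r0.

Definition scaled j : E -> R := 2 ^+ (d * j) \*: dilate (2 ^+ j) S.
(* S_(k-1), with S_(-1) = 0. *)
Definition scaled_pred k : E -> R := if k is k'.+1 then scaled k' else 0.
Definition piece j := scaled j - scaled_pred j.
Definition smoother k := conv (scaled k) (scaled k).
(** The value 0 at k = 0 makes the corresponding deflation the identity, which starts the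
    telescope. *)
Definition smoother_pred k : E -> R := if k is k'.+1 then smoother k' else 0.

Lemma pow2_neq0 n : 2 ^+ n != 0 :> R.
Proof. by rewrite expf_neq0// pnatr_eq0. Qed.

Lemma test_scaled j : test (scaled j).
Proof. by apply: testZ; apply: test_dilate. Qed.

Lemma test_scaled_pred j : test (scaled_pred j).
Proof. by case: j => [|j]; [exact: test0|exact: test_scaled]. Qed.

Lemma test_piece j : test (piece j).
Proof. by apply: testB; [exact: test_scaled|exact: test_scaled_pred]. Qed.

Lemma test_smoother j : test (smoother j).
Proof. by apply: test_conv2; exact: test_scaled. Qed.

Lemma test_smoother_pred j : test (smoother_pred j).
Proof. by case: j => [|j]; [exact: test0|exact: test_smoother]. Qed.

Lemma r2_ge0 j : 0 <= r2 j.
Proof. by rewrite /r2 mulr_ge0 ?invr_ge0 ?exprn_ge0// ltW. Qed.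

Lemma r2S j : r2 j = 2 * r2 j.+1.
Proof. by rewrite /r2 exprS invfM !mulrA divff ?mul1r. Qed.

Lemma r2_anti j k : (j <= k)%N -> r2 k <= r2 j.
Proof.
move=> jk; rewrite /r2 ler_pM2r// lef_pV2 ?posrE ?exprn_gt0//.
by rewrite ler_weXn2l// ler1n.
Qed.

Lemma vanish_scaled j : vanish_outside (r2 j) (scaled j).
Proof. by apply: vanishZ; apply: vanish_dilate => //; exact: exprn_gt0. Qed.

Lemma vanish_scaled_pred j : vanish_outside (2 * r2 j) (scaled_pred j).
Proof. by case: j => [|j] //; rewrite -r2S; exact: vanish_scaled. Qed.

Lemma vanish_piece j : vanish_outside (2 * r2 j) (piece j).
Proof.
apply: vanishB; last exact: vanish_scaled_pred.
by apply: vanish_le (@vanish_scaled j); rewrite ler_peMl ?r2_ge0// ler1n.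
Qed.

Lemma vanish_smoother j : vanish_outside (2 * r2 j) (smoother j).
Proof. by rewrite mulr_natl mulr2n; apply: (vanish_conv M); exact: vanish_scaled. Qed.

Lemma vanish_smoother_pred j : vanish_outside (4 * r2 j) (smoother_pred j).
Proof.
case: j => [|j] //; rewrite (_ : 4 * _ = 2 * r2 j); first exact: vanish_smoother.
by rewrite [in RHS]r2S mulrA -natrM.
Qed.

Lemma norm1_dilate j : L1 (dilate (2 ^+ j) S) /\ 2 ^+ (d * j) * norm1 (dilate (2 ^+ j) S) = N.
Proof. by apply: (norm1_scale M) => //; [exact: test_continuous|exact: tL1]. Qed.

Lemma norm1_scaled j : norm1 (scaled j) = N.
Proof.
have [di <-] := norm1_dilate j; rewrite -(IZ _ (L1_norm di)).
apply: eq_Rintegral => x _ /=; rewrite /scaled /= normrM ger0_norm// exprn_ge0//.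
Qed.

Lemma norm1_0 : norm1 (0 : E -> R) = 0.
Proof. by rewrite /Rintegral integral0_eq// => x _ /=; rewrite normr0. Qed.

Lemma N_ge0 : 0 <= N. Proof. exact: norm1_ge0. Qed.

Lemma norm1_scaled_pred j : norm1 (scaled_pred j) <= N.
Proof. by case: j => [|j]; rewrite ?norm1_scaled//= norm1_0 N_ge0. Qed.

Lemma norm1_smoother j : norm1 (smoother j) <= N ^+ 2.
Proof.
have tj := test_scaled j.
by rewrite (le_trans (norm1_conv_le (tL1 tj) (test_vanish tj) tj))// norm1_scaled.
Qed.

Lemma norm1_smoother_pred j : norm1 (smoother_pred j) <= N ^+ 2.
Proof. by case: j => [|j]; [rewrite norm1_0 sqr_ge0|exact: norm1_smoother]. Qed.

Lemma I_scaled j : I (scaled j) = 1.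
Proof.
rewrite -IS1 -(I_scale M j (test_continuous tS) (tL1 tS)) -IZ//.
by have [] := norm1_dilate j.
Qed.

Lemma I_smoother j : I (smoother j) = 1.
Proof. by rewrite (I_conv M) ?I_scaled ?mulr1//; exact: test_scaled. Qed.

(** Positive indices only: [piece 0] is S, of integral one. Its first moments do vanish, but j = 0
    has to be treated apart wherever zero mean is used. *)
Lemma I_piece j : I (piece j.+1) = 0.
Proof.
by rewrite (IB (tL1 (test_scaled j.+1)) (tL1 (test_scaled j))) !I_scaled subrr.
Qed.

Lemma L1_coord (i : 'I_d) u : test u -> continuous (fun y : E => y ord0 i * u y) /\
  L1 (fun y => y ord0 i * u y).
Proof.
move=> tu; have cc : continuous (fun y : E => y ord0 i * u y).
  move=> y; apply: (@continuousM R E (fun y => y ord0 i) u); first exact: coord_continuous.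
  exact: test_continuous.
split => //; have [r r_gt0 ur] := test_vanish tu.
apply: (L1_le (g := fun y => r * `|u y|)).
- exact: (model_cont M).
- by apply: L1Z; apply: L1_norm; exact: tL1.
move=> y; rewrite normrM; have [yr|yr] := leP (enorm y) r.
  by rewrite ler_wpM2r// (le_trans (coord_le_enorm _ _)).
by rewrite ur// normr0 !mulr0.
Qed.

Lemma I_coord_scaled j (i : 'I_d) : I (fun y => y ord0 i * scaled j y) = 0.
Proof.
have [cS iS] := L1_coord i tS.
have E1 : (fun y : E => y ord0 i * scaled j y) =
    (fun y => (2 ^- j * 2 ^+ (d * j)) * dilate (2 ^+ j) (fun y => y ord0 i * S y) y).
  apply/funext => y; rewrite /scaled /dilate /= mxE /GRing.scale/=.
  have : 2 ^+ j != 0 :> R by rewrite expf_neq0.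
  move: (2 ^+ j) (2 ^+ (d * j)) => A B A0; by field.
have [di _] := norm1_scale M j cS iS.
by rewrite E1 IZ// -mulrA (I_scale M j cS iS) IS_coord mulr0.
Qed.

Lemma I_coord_piece j (i : 'I_d) : I (fun y => y ord0 i * piece j y) = 0.
Proof.
have [_ i1] := L1_coord i (test_scaled j).
have [_ i2] := L1_coord i (test_scaled_pred j).
have -> : (fun y : E => y ord0 i * piece j y) =
    (fun y => y ord0 i * scaled j y - y ord0 i * scaled_pred j y).
  by apply/funext => y; rewrite /piece !fctE mulrBr.
rewrite IB// I_coord_scaled sub0r; apply/eqP; rewrite oppr_eq0; apply/eqP.
case: j {i1 i2} => [|j]; last exact: I_coord_scaled.
by rewrite /Rintegral integral0_eq// => x _ /=; rewrite mulr0.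
Qed.

Lemma norm1_piece j : norm1 (piece j) <= 2 * N.
Proof.
rewrite (le_trans (norm1B_le (tL1 (test_scaled j)) (tL1 (test_scaled_pred j))))//.
by rewrite mulr_natl mulr2n lerD ?norm1_scaled ?norm1_scaled_pred.
Qed.

(** The cofactor of [piece k] in B_k - B_(k-1), read as a difference of squares. *)
Definition blur k := scaled k + scaled_pred k.

Lemma test_blur k : test (blur k).
Proof. by apply: testD; [exact: test_scaled|exact: test_scaled_pred]. Qed.

Lemma norm1_blur j : norm1 (blur j) <= 2 * N.
Proof.
rewrite (le_trans (norm1D_le (tL1 (test_scaled j)) (tL1 (test_scaled_pred j))))//.
by rewrite mulr_natl mulr2n lerD ?norm1_scaled ?norm1_scaled_pred.
Qed.

Lemma vanish_blur j : vanish_outside (2 * r2 j) (blur j).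
Proof.
apply: vanishD; last exact: vanish_scaled_pred.
by apply: vanish_le (@vanish_scaled j); rewrite ler_peMl ?r2_ge0// ler1n.
Qed.

Lemma dbound_scaled n (C : R) j : dbound n S C ->
  dbound n (scaled j) (2 ^+ (d * j) * (2 ^+ (n * j) * C)).
Proof.
move=> SC s sn x; rewrite foldr_partialZ; last exact/smooth_dilate/test_smooth.
rewrite foldr_partial_dilate; last exact: test_smooth.
rewrite sn /= !normrZ !normrX (ger0_norm (ler0n _ 2)) -exprM [(j * n)%N]mulnC.
by rewrite ler_wpM2l ?exprn_ge0// ler_wpM2l ?exprn_ge0// /dilate SC.
Qed.

Lemma dbound_scaled_pred n (C : R) j : 0 <= C -> dbound n S C ->
  dbound n (scaled_pred j) (2 ^+ (d * j) * (2 ^+ (n * j) * C)).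
Proof.
move=> C0 SC; case: j => [|j] s sn x.
  rewrite (_ : foldr partial _ s = 0) ?normr0 ?mulr_ge0 ?exprn_ge0//.
  elim: s {sn} => //= i s ->; apply/funext => y.
  by rewrite /partial (derive_cst (0 : R)).
rewrite (le_trans (dbound_scaled j SC sn x))//.
rewrite ler_pM ?mulr_ge0 ?exprn_ge0//.
  by rewrite ler_weXn2l ?ler1n// leq_mul.
by rewrite ler_wpM2r// ler_weXn2l ?ler1n// leq_mul.
Qed.

Lemma dboundD n (C C' : R) u v : test u -> test v -> dbound n u C -> dbound n v C' ->
  dbound n (u + v) (C + C').
Proof.
move=> tu tv uC vC s sn x; rewrite foldr_partialD; [|exact: test_smooth|exact: test_smooth].
by rewrite (le_trans (ler_normD _ _))// lerD ?uC ?vC.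
Qed.

Lemma dboundN n (C : R) u : test u -> dbound n u C -> dbound n (- u) C.
Proof.
move=> tu uC s sn x; rewrite (_ : - u = -1 \*: u); last first.
  by apply/funext => y; rewrite !fctE /= scaleN1r.
rewrite foldr_partialZ; last exact: test_smooth.
by rewrite /= scaleN1r normrN uC.
Qed.

Lemma dbound_piece n (C : R) j : 0 <= C -> dbound n S C ->
  dbound n (piece j) (2 ^+ (d * j) * 2 ^+ (n * j) * (2 * C)).
Proof.
move=> C0 SC; rewrite (_ : _ * _ = 2 ^+ (d * j) * (2 ^+ (n * j) * C) +
    2 ^+ (d * j) * (2 ^+ (n * j) * C)); last by ring.
apply: dboundD; [exact: test_scaled|exact/testN/test_scaled_pred|exact: dbound_scaled|].
by apply: dboundN; [exact: test_scaled_pred|exact: dbound_scaled_pred].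
Qed.

Lemma dbound_blur n (C : R) j : 0 <= C -> dbound n S C ->
  dbound n (blur j) (2 ^+ (d * j) * 2 ^+ (n * j) * (2 * C)).
Proof.
move=> C0 SC; rewrite (_ : _ * _ = 2 ^+ (d * j) * (2 ^+ (n * j) * C) +
    2 ^+ (d * j) * (2 ^+ (n * j) * C)); last by ring.
apply: dboundD; [exact: test_scaled|exact: test_scaled_pred|exact: dbound_scaled|].
exact: dbound_scaled_pred.
Qed.

Lemma smoother_sub k : smoother k - smoother_pred k = conv (piece k) (blur k).
Proof.
have ts := test_scaled k; have tp := test_scaled_pred k.
have -> : smoother_pred k = conv (scaled_pred k) (scaled_pred k).
  by case: k {ts tp} => [|k] //=; rewrite conv0l.
rewrite (convC (test_piece k) (test_blur k)) convB//; last exact: test_blur.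
rewrite (convC (test_blur k) ts) (convC (test_blur k) tp) /blur !convDr// (convC tp ts).
by rewrite opprD addrA addrK.
Qed.

Lemma conv_suml n (g : nat -> E -> R) z : (forall i, test (g i)) -> test z ->
  test (\sum_(i < n) g i) /\ \sum_(i < n) conv (g i) z = conv (\sum_(i < n) g i) z.
Proof.
move=> tg tz; elim: n => [|n [IH1 IH2]]; first by rewrite !big_ord0 conv0l; split => //; exact: test0.
rewrite !big_ord_recr/= IH2; split; first exact: testD.
by rewrite (convC (testD IH1 (tg n)) tz) convDr// !(convC tz).
Qed.

(** What is left of B_k - B_(k-1) once [piece k] has been moved onto f, combined with the block
    [piece j]. *)
Definition LP_arg j k := conv (blur k) (piece j).

Lemma test_LP_arg j k : test (LP_arg j k).
Proof. by apply: test_conv2; [exact: test_blur|exact: test_piece]. Qed.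

(** The i-th summand D_(k-1)^i D_k^(n-1-i) of the factorization in [iter_deflate_sub]; n - 1
    deflations remain. *)
Definition LP_term n j k i :=
  iter i (deflate (smoother_pred k)) (iter (n.-1 - i) (deflate (smoother k)) (LP_arg j k)).

Lemma test_LP_term n j k i : test (LP_term n j k i).
Proof.
apply: test_iter_deflate; first exact: test_smoother_pred.
by apply: test_iter_deflate; [exact: test_smoother|exact: test_LP_arg].
Qed.

Definition LP_kernel n j k : E -> R := \sum_(i < n) LP_term n j k i.

Lemma test_LP_kernel n j k : test (LP_kernel n j k).
Proof. by have [] := conv_suml n (@test_LP_term n j k) test0. Qed.

Lemma LP_telescope n J K f j : L1 K -> (exists2 r, 0 < r & vanish_outside r K) -> test f ->
  conv (piece j) (conv K f) - iter n (deflate (smoother J)) (conv (piece j) (conv K f)) =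
  \sum_(k < J.+1) conv (conv K (LP_kernel n j k)) (conv (piece k) f).
Proof.
move=> Ki Kr tf; have tKf := test_conv M Ki Kr tf.
have tj := test_piece j; set h := conv (piece j) _.
have th : test h by exact: test_conv2.
have term k : iter n (deflate (smoother_pred k)) h - iter n (deflate (smoother k)) h =
    conv (conv K (LP_kernel n j k)) (conv (piece k) f).
  have tk := test_piece k; have tb := test_blur k.
  have tz := test_conv2 tk tf; have tKz := test_conv M Ki Kr tz.
  rewrite (iter_deflate_sub n (test_smoother_pred k) (test_smoother k) th) smoother_sub.
  (* By commutativity [piece k] passes through [piece j] and [K] and lands on f, while [blur k]
     joins [piece j]. *)
  have -> : conv (conv (piece k) (blur k)) h = conv (LP_arg j k) (conv K (conv (piece k) f)).
    rewrite /h -(convA tk tb th) (convCA tk tb th) (convCA tk tj tKf).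
    by rewrite (convK_swap Ki Kr tk tf) (convA tb tj tKz).
  rewrite -(convK_assoc Ki Kr (test_LP_kernel n j k) tz) -(convK_swap Ki Kr (test_LP_kernel n j k) tz).
  have [_ <-] := conv_suml n (@test_LP_term n j k) tKz.
  apply: eq_bigr => i _.
  rewrite (iter_deflate_conv _ (test_smoother k) (test_LP_arg j k) tKz).
  rewrite (iter_deflate_conv _ (test_smoother_pred k) _ tKz)//.
  by apply: test_iter_deflate; [exact: test_smoother|exact: test_LP_arg].
under eq_bigr do rewrite -term.
elim: J => [|J IH].
  rewrite big_ord_recr big_ord0/= add0r; congr (_ - _).
  (* The telescope starts at D_(-1)^n = id: deflation by 0 changes nothing. *)
  by elim: n {term} => //= n <-; rewrite /deflate conv0l subr0.
by rewrite big_ord_recr/= -IH addrA subrK.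
Qed.

(** Below the diagonal the exponent 2 comes from the two vanishing moments of [piece j]; above it n
    - 1 counts the deflations that remain, each worth one derivative. *)
Let decay n j k : R := if (k <= j)%N then 2 ^- (2 * (j - k)) else 2 ^- (n.-1 * (k - j)).

Lemma LP_term_dbound n j k i (C : R) : 0 <= C -> (i < n)%N -> dbound 0 (LP_arg j k) C ->
  dbound 0 (LP_term n j k i) ((1 + N ^+ 2) ^+ n.-1 * C).
Proof.
move=> C0 ni XC.
have -> : (1 + N ^+ 2) ^+ n.-1 * C = (1 + N ^+ 2) ^+ i * ((1 + N ^+ 2) ^+ (n.-1 - i) * C).
  by rewrite mulrA -exprD subnKC// -ltnS prednK// (leq_ltn_trans _ ni).
have N2 : 0 <= 1 + N ^+ 2 by rewrite addr_ge0 ?sqr_ge0.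
apply: dbound_iter_deflate.
- exact: test_smoother_pred.
- by apply: test_iter_deflate; [exact: test_smoother|exact: test_LP_arg].
- by rewrite mulr_ge0// exprn_ge0.
- exact: norm1_smoother_pred.
- by apply: dbound_iter_deflate; [exact: test_smoother|exact: test_LP_arg|by []|
    exact: norm1_smoother|by []].
Qed.

(** Three regimes. For k <= j with j > 0, the second-order Taylor expansion of [blur k] (second
    derivatives of size 2^(dk) 2^(2k)) against [piece j] (radius of order 2^-j) gives 2^(-2(j-k)),
    and the deflations are merely bounded; this is [Ca]. For j = k = 0 there is no zero mean, but no
    decay is asked for; this is [Cb]. For k > j, n - 1 derivatives of [piece j] cost 2^((n-1)j) and
    the deflations gain 2^(-(n-1)k); this is [Cc]. *)
Lemma LP_term_bound n : exists2 C, 0 < C & forall j k i, (i < n)%N -> forall x,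
  `|LP_term n j k i x| <= C * 2 ^+ (d * minn j k) * decay n j k.
Proof.
have [C2 C20 SC2] := test_dbound 2 tS.
have [Cn Cn0 SCn] := test_dbound n.-1 tS.
have [C0 C00 SC0] := test_dbound 0 tS.
have N2 : 0 < 1 + N ^+ 2 by rewrite ltr_wpDr ?sqr_ge0.
have N0 := N_ge0.
pose Ca := (1 + N ^+ 2) ^+ n.-1 * (2 * C2 * (d%:R * (2 * r0)) ^+ 2 * (2 * N)).
pose Cb := (1 + N ^+ 2) ^+ n.-1 * (2 * C0 * (2 * N)).
(* The radius 4 r0 2^-k serves both for [smoother k] (twice [r2 k]) and for [smoother_pred k] (four
   times [r2 k]). *)
pose Cc := (d%:R * (4 * r0) * N ^+ 2) ^+ n.-1 * (2 * Cn * (2 * N)).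
have Ca0 : 0 <= Ca.
  by rewrite /Ca mulr_ge0 ?exprn_ge0 ?mulr_ge0 ?sqr_ge0//; exact: ltW.
have Cb0 : 0 <= Cb by rewrite /Cb mulr_ge0 ?exprn_ge0 ?mulr_ge0//; exact: ltW.
have Cc0 : 0 <= Cc.
  by rewrite /Cc mulr_ge0 ?exprn_ge0 ?mulr_ge0 ?sqr_ge0//; exact: ltW.
exists (Ca + Cb + Cc + 1); first by rewrite ltr_wpDl// !addr_ge0.
move=> j k i ni x.
have dec0 : 0 <= decay n j k by rewrite /decay; case: ifP; rewrite invr_ge0 exprn_ge0.
have gen C' : 0 <= C' -> C' <= Ca + Cb + Cc + 1 ->
    `|LP_term n j k i x| <= C' * 2 ^+ (d * minn j k) * decay n j k ->
    `|LP_term n j k i x| <= (Ca + Cb + Cc + 1) * 2 ^+ (d * minn j k) * decay n j k.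
  move=> C'0 CC /le_trans; apply; rewrite ler_wpM2r// ler_wpM2r// exprn_ge0//.
have [kj|] := boolP (k <= j)%N; last rewrite -ltnNge => jk.
  have [j0|j0] := posnP j.
    have k0 : k = 0%N by move: kj; rewrite j0 leqn0 => /eqP.
    apply: (gen Cb) => //; first by lra.
    rewrite j0 k0 /decay leqnn subnn muln0 expr0 invr1 mulr1 minnn muln0 expr0 mulr1.
    have XC : dbound 0 (LP_arg 0 0) (2 * C0 * (2 * N)).
      have := dbound_conv M (tL1 (test_blur 0)) (test_piece 0)
        (dbound_piece 0 (ltW C00) SC0).
      rewrite muln0 mul0n !expr0 !mul1r => H s sn y; rewrite (le_trans (H s sn y))//.
      by rewrite ler_wpM2l ?norm1_blur// mulr_ge0// ltW.
    by apply: (LP_term_dbound _ ni XC (s := [::])) => //; rewrite !mulr_ge0// ltW.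
  apply: (gen Ca) => //; first by lra.
  have XC : dbound 0 (LP_arg j k)
      (2 * C2 * (d%:R * (2 * r0)) ^+ 2 * (2 * N) * 2 ^+ (d * k) * 2 ^- (2 * (j - k))).
    move=> [|//] _ y /=; rewrite /LP_arg convC; [|exact: test_blur|exact: test_piece].
    have tj := test_piece j.
    have bC := dbound_blur k (ltW C20) SC2.
    have I0 : I (piece j) = 0 by case: (j) j0 => // l _; exact: I_piece.
    rewrite (le_trans (conv_moments M y (tL1 tj) (test_continuous tj) _ (@vanish_piece j) I0
       (I_coord_piece j) (test_blur k) _ bC))//.
    - by rewrite mulr_ge0 ?r2_ge0.
    - by rewrite !mulr_ge0 ?exprn_ge0// ltW.
    rewrite (@le_trans _ _ (2 ^+ (d * k) * 2 ^+ (2 * k) * (2 * C2) * (d%:R * (2 * r2 j)) ^+ 2 * (2 * N)))//.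
      rewrite ler_wpM2l ?norm1_piece// !mulr_ge0 ?exprn_ge0 ?mulr_ge0 ?r2_ge0//; exact: ltW.
    rewrite /r2 -{1}(subnK kj) exprD [(2 * k)%N]mulnC [(2 * (j - k))%N]mulnC !exprM.
    have := pow2_neq0 k.
    have := pow2_neq0 (j - k).
    move: (2 ^+ k : R) (2 ^+ (j - k) : R) (2 ^+ d : R) => A B D B0 A0.
    by rewrite le_eqVlt; apply/orP; left; apply/eqP; field; rewrite A0 B0.
  rewrite /decay kj (minn_idPr kj).
  have := LP_term_dbound _ ni XC (s := [::]) erefl x.
  rewrite /= => /(_ _)/le_trans -> //; last by rewrite /Ca !mulrA.
  by rewrite !mulr_ge0 ?invr_ge0 ?exprn_ge0 ?mulr_ge0//; exact: ltW.
apply: (gen Cc) => //; first by lra.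
rewrite /decay leqNgt jk/= (minn_idPl (ltnW jk)).
have k0 : (0 < k)%N by exact: leq_ltn_trans jk.
have r2k := r2_ge0 k.
pose L := d%:R * (4 * r2 k) * N ^+ 2.
have L0 : 0 <= L.
  exact: (mulr_ge0 (mulr_ge0 (ler0n _ _) (mulr_ge0 (ler0n _ _) r2k)) (sqr_ge0 _)).
pose CX := 2 ^+ (d * j) * 2 ^+ (n.-1 * j) * (2 * Cn) * (2 * N).
have CX0 : 0 <= CX by rewrite /CX !mulr_ge0 ?exprn_ge0// ltW.
have XC : dbound n.-1 (LP_arg j k) CX.
  have H := dbound_conv M (tL1 (test_blur k)) (test_piece j)
    (dbound_piece j (ltW Cn0) SCn).
  move=> s sn y; rewrite (le_trans (H s sn y))// ler_wpM2l ?norm1_blur//.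
  by rewrite !mulr_ge0 ?exprn_ge0// ltW.
have ni' : (i <= n.-1)%N by rewrite -ltnS prednK// (leq_ltn_trans _ ni).
(* Of the n - 1 available derivatives, D_k uses n - 1 - i; the i left over are used by D_(k-1) in
   [step2]. *)
have step1 : dbound i (iter (n.-1 - i) (deflate (smoother k)) (LP_arg j k)) (L ^+ (n.-1 - i) * CX).
  apply: dbound_iter_deflate_lip => //.
  - exact: test_smoother.
  - exact: test_LP_arg.
  - by rewrite mulr_ge0.
  - by apply: vanish_le (@vanish_smoother k); rewrite ler_wpM2r// ler_nat.
  - exact: I_smoother.
  - exact: norm1_smoother.
  - by rewrite subnK.
have step2 : dbound 0 (LP_term n j k i) (L ^+ i * (L ^+ (n.-1 - i) * CX)).
  apply: (@dbound_iter_deflate_lip i 0 (4 * r2 k) (N ^+ 2)) => //.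
  - exact: test_smoother_pred.
  - by apply: test_iter_deflate; [exact: test_smoother|exact: test_LP_arg].
  - by rewrite mulr_ge0 ?exprn_ge0.
  - by rewrite mulr_ge0.
  - exact: vanish_smoother_pred.
  - by case: (k) k0 => // l _; exact: I_smoother.
  - exact: norm1_smoother_pred.
  - by rewrite addn0.
rewrite (le_trans (step2 [::] erefl x))// mulrA -exprD subnKC// /L /CX /Cc /r2.
have -> : 2 ^- (n.-1 * (k - j)) = ((2 : R) ^+ (k - j)) ^- n.-1 by rewrite mulnC exprM.
have -> : 2 ^+ (n.-1 * j) = ((2 : R) ^+ j) ^+ n.-1 by rewrite mulnC exprM.
rewrite -{1}(subnK (ltnW jk)) exprD.
have := pow2_neq0 j.
have := pow2_neq0 (k - j).
move: (2 ^+ j : R) (2 ^+ (k - j) : R) (2 ^+ (d * j) : R) => A B D B0 A0.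
rewrite invfM !exprMn !exprVn.
have := expf_neq0 n.-1 A0; have := expf_neq0 n.-1 B0.
rewrite le_eqVlt => B1 A1; apply/orP; left; apply/eqP; field; rewrite A1 B1//.
Qed.

(** [LP_arg] contributes 2 + 2, and each of the n - 1 deflations at most 4, in units of the larger
    of the two scales. *)
Lemma vanish_LP_term n j k i : (i < n)%N ->
  vanish_outside ((4 + 4 * n%:R) * r2 (minn j k)) (LP_term n j k i).
Proof.
move=> ni; have r2k := r2_ge0 k.
have kmin : r2 k <= r2 (minn j k) by apply: r2_anti; exact: geq_minr.
have jmin : r2 j <= r2 (minn j k) by apply: r2_anti; exact: geq_minl.
have XV : vanish_outside (2 * r2 k + 2 * r2 j) (LP_arg j k).
  by apply: (vanish_conv M); [exact: vanish_blur|exact: vanish_piece].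
have BV := @vanish_iter_deflate (n.-1 - i) _ _ _ _ (mulr_ge0 (ler0n R 2) r2k) (@vanish_smoother k) XV.
have AV := @vanish_iter_deflate i _ _ _ _ (mulr_ge0 (ler0n R 4) r2k) (@vanish_smoother_pred k) BV.
apply: vanish_le AV; rewrite natrB; last by rewrite -ltnS prednK// (leq_ltn_trans _ ni).
have : n.-1%:R <= n%:R :> R by rewrite ler_nat leq_pred.
have : i%:R <= n%:R :> R by rewrite ler_nat ltnW.
have : i%:R <= n.-1%:R :> R by rewrite ler_nat -ltnS prednK// (leq_ltn_trans _ ni).
have : 0 <= i%:R :> R by [].
move: kmin jmin r2k; move: (r2 k) (r2 j) (r2 (minn j k)) (i%:R : R) (n.-1%:R : R) (n%:R : R).
move=> a b c u v w ac bc a0 u0 uv uw vw.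
have : 0 <= (v - u) * (c - a) by rewrite mulr_ge0 ?subr_ge0.
have : 0 <= u * (c - a) by rewrite mulr_ge0 ?subr_ge0.
have : 0 <= (w - v) * c by rewrite mulr_ge0 ?subr_ge0// (le_trans a0 ac).
have : 0 <= v * c by rewrite mulr_ge0 ?(le_trans a0 ac)// (le_trans u0 uv).
have : 0 <= (v - u) * a by rewrite mulr_ge0 ?subr_ge0.
nra.
Qed.

(** The factor 2^(d min(j,k)) of the sup bound is cancelled by the volume of a support of radius of
    order 2^(-min(j,k)). *)
Lemma LP_kernel_norm1 n : exists2 C, 0 < C & forall j k,
  norm1 (LP_kernel n j k) <= C * decay n j k.
Proof.
have [C C0 HC] := LP_term_bound n.
exists ((n%:R * C + 1) * (2 * ((4 + 4 * n%:R) * r0)) ^+ d).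
  by rewrite mulr_gt0 ?exprn_gt0// ?ltr_wpDl ?mulr_gt0 ?mulr_ge0 ?(ltW C0)// ltr_wpDr// mulr_ge0.
move=> j k; have dec0 : 0 <= decay n j k.
  by rewrite /decay; case: ifP; rewrite invr_ge0 exprn_ge0.
have tG := test_LP_kernel n j k.
have R0 : 0 <= (4 + 4 * n%:R) * r2 (minn j k) by rewrite mulr_ge0 ?r2_ge0// addr_ge0// mulr_ge0.
have GV : vanish_outside ((4 + 4 * n%:R) * r2 (minn j k)) (LP_kernel n j k).
  move=> x rx; rewrite /LP_kernel fct_sumE big1// => i _.
  exact: (@vanish_LP_term n j k i).
have GC x : `|LP_kernel n j k x| <= (n%:R * C + 1) * 2 ^+ (d * minn j k) * decay n j k.
  rewrite /LP_kernel fct_sumE (le_trans (ler_norm_sum _ _ _))//.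
  rewrite (le_trans (ler_sum _ (fun (i : 'I_n) _ => HC j k i (ltn_ord i) x)))//.
  rewrite sumr_const card_ord -[_ *+ n]mulr_natl !mulrA ler_wpM2r// ler_wpM2r ?exprn_ge0//.
  by rewrite lerDl.
have [_] := vanish_L1 M R0 (test_mfun M tG) GV GC.
move=> /le_trans; apply; rewrite /r2 exprM [2 ^+ d ^+ _]exprAC.
have := pow2_neq0 (minn j k).
move: (2 ^+ minn j k : R) => A A0.
rewrite !exprMn exprVn.
have := expf_neq0 d A0.
rewrite le_eqVlt => A1; apply/orP; left; apply/eqP; field; exact: A1.
Qed.

Lemma I_LP_kernel n j k : I (LP_kernel n j.+1 k) = 0.
Proof.
have tj := test_piece j.+1.
have [_ HI] := L1_sum (index_enum 'I_n) (fun i : 'I_n => tL1 (test_LP_term n j.+1 k i)).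
have -> : LP_kernel n j.+1 k = (fun x => \sum_(i < n) LP_term n j.+1 k i x).
  by apply/funext => x; rewrite /LP_kernel fct_sumE.
rewrite HI big1// => i _; apply: I_iter_deflate; first exact: test_smoother_pred.
  by apply: test_iter_deflate; [exact: test_smoother|exact: test_LP_arg].
apply: I_iter_deflate; [exact: test_smoother|exact: test_LP_arg|].
by rewrite (I_conv M (test_blur k) tj) I_piece mulr0.
Qed.

Lemma vanish_LP_kernel n j k :
  vanish_outside ((4 + 4 * n%:R) * r2 (minn j k)) (LP_kernel n j k).
Proof.
move=> x rx; rewrite /LP_kernel fct_sumE big1// => i _.
exact: (@vanish_LP_term n j k i).
Qed.

(** One deflation gains 2^-J from a Lipschitz bound on [h], the other n are bounded crudely. The
    constants may depend on [h] but not on J, which suffices since J tends to infinity with [h]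
    fixed. *)
Lemma LP_remainder n h : test h -> exists2 c, 0 <= c & exists2 r, 0 <= r & forall J,
  [/\ test (iter n.+1 (deflate (smoother J)) h),
      vanish_outside r (iter n.+1 (deflate (smoother J)) h) &
      forall x, `|iter n.+1 (deflate (smoother J)) h x| <= c * 2 ^- J].
Proof.
move=> th; have [r r_gt0 hr] := test_vanish th; have [C C0 hC] := test_dbound 1 th.
have N2 : 0 <= N ^+ 2 by exact: sqr_ge0.
exists ((1 + N ^+ 2) ^+ n * (d%:R * (2 * r0) * N ^+ 2 * C)).
  have r0' := ltW r00; have C0' := ltW C0.
  exact: (mulr_ge0 (exprn_ge0 _ (addr_ge0 ler01 N2)) (mulr_ge0 (mulr_ge0 (mulr_ge0
    (ler0n _ _) (mulr_ge0 (ler0n _ _) r0')) N2) C0')).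
exists (n.+1%:R * (2 * r0) + r).
  by rewrite addr_ge0 ?mulr_ge0//; exact: ltW.
move=> J; have tJ := test_smoother J; split; first exact: test_iter_deflate.
  have := @vanish_iter_deflate n.+1 _ _ _ _ (mulr_ge0 (ler0n R 2) (r2_ge0 J))
     (@vanish_smoother J) hr.
  apply: vanish_le; rewrite lerD2r ler_wpM2l// ler_wpM2l//.
  by have := r2_anti (leq0n J); rewrite {2}/r2 expr0 invr1 mul1r.
move=> x.
have D1 : dbound 0 (deflate (smoother J) h) (d%:R * (2 * r2 J) * N ^+ 2 * C).
  apply: dbound_deflate_lip => //; first exact: ltW.
  - by rewrite mulr_ge0// r2_ge0.
  - exact: vanish_smoother.
  - exact: I_smoother.
  - exact: norm1_smoother.
have D2 : 0 <= d%:R * (2 * r2 J) * N ^+ 2 * C.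
  exact: (mulr_ge0 (mulr_ge0 (mulr_ge0 (ler0n _ _) (mulr_ge0 (ler0n _ _) (r2_ge0 J))) N2) (ltW C0)).
have := @dbound_iter_deflate n 0 _ _ _ _ tJ (test_deflate tJ th) D2 (norm1_smoother J) D1 [::] erefl x.
rewrite -iterSr /= => /le_trans; apply; rewrite /r2 le_eqVlt; apply/orP; left; apply/eqP.
by ring.
Qed.

Lemma pow2NE n : 2 ^- n = 2 `^ (- n%:R) :> R.
Proof. by rewrite powRN powR_mulrn. Qed.

(** The power of 2 in the bound on [A j k] is the ratio of the Besov weights: multiplied by
    2^(j(alpha + kappa)) it becomes 2^(k alpha), and 2^-|j-k| is left for summation. With truncated
    subtraction, (j - k) + (k - j) is |j - k|. *)
Lemma littlewood_paley (alpha kappa : R) : alpha <= 0 -> 0 <= kappa <= 1 ->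
  exists C rho : R, [/\ 0 < C, 0 < rho & forall K (H : R),
    L1 K -> vanish_outside 1 K -> norm1 K <= H ->
    (forall y, norm1 (fun x => K (x - y) - K x) <= H * enorm y `^ kappa) ->
    exists A : nat -> nat -> E -> R,
    (forall j k, [/\ test (A j k), vanish_outside rho (A j k) &
       norm1 (A j k) <= H * C * (2 `^ (- kappa * j%:R + alpha * (k%:R - j%:R)) *
                                 2 ^- ((j - k) + (k - j)))]) /\
    (forall f j, test f -> exists2 c, 0 <= c & exists2 r, 0 <= r & forall J,
      exists2 e : E -> R,
        [/\ test e, vanish_outside r e & forall x, `|e x| <= c * 2 ^- J] &
        conv (piece j) (conv K f) =
          e + \sum_(k < J.+1) conv (A j k) (conv (piece k) f))].
Proof.
move=> alpha0 /andP[kappa0 kappa1].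
have a1 : 0 <= 1 - alpha by lra.
(* With n = n0 + 1, the n - 1 = n0 remaining deflations exceed 1 - alpha. *)
have := archi_boundP a1; set n0 := Num.bound _ => an0.
pose n := n0.+1; have [Cg Cg0 HG] := LP_kernel_norm1 n.
pose P := (4 + 4 * n%:R) * r0.
have P0 : 0 < P by rewrite mulr_gt0// ltr_wpDr// mulr_ge0.
exists (Cg * (P `^ kappa + 1)), (1 + P); split.
- by rewrite mulr_gt0// ltr_wpDl// powR_ge0.
- by rewrite addr_gt0.
move=> K H Ki K1 KH Kw; have H0 : 0 <= H by exact: (le_trans (norm1_ge0 K) KH).
have Kr : exists2 r, 0 < r & vanish_outside r K by exists 1.
exists (fun j k => conv K (LP_kernel n j k)); split; last first.
  move=> f j tf; have tKf := test_conv M Ki Kr tf.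
  have [c c0 [r r_ge0 Hr]] := LP_remainder n0 (test_conv2 (test_piece j) tKf).
  exists c => //; exists r => // J; have [te er ec] := Hr J.
  exists (iter n (deflate (smoother J)) (conv (piece j) (conv K f))) => //.
  by rewrite -(LP_telescope n J j Ki Kr tf) addrC subrK.
move=> j k; have tG := test_LP_kernel n j k; split; first exact: (test_conv M Ki Kr tG).
  apply: (vanish_conv M) => //; apply: vanish_le (@vanish_LP_kernel n j k).
  rewrite ler_wpM2l ?addr_ge0 ?mulr_ge0//.
  by have := r2_anti (leq0n (minn j k)); rewrite {2}/r2 expr0 invr1 mul1r.
(* For k <= j the comparison reduces to kappa <= 1 and alpha <= 0; for k > j it reduces to n0 >= 1 -
   alpha. *)
have dec : 2 `^ (- kappa * (minn j k)%:R) * decay n j k <=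
    2 `^ (- kappa * j%:R + alpha * (k%:R - j%:R)) * 2 ^- ((j - k) + (k - j)).
  rewrite /decay; have [kj|] := boolP (k <= j)%N; last rewrite -ltnNge => jk.
    rewrite !pow2NE -!powRD ?pnatr_eq0 ?implybT//.
    rewrite ler_powR ?ler1n// (minn_idPr kj) (eqP kj : (k - j = 0)%N) addn0 natrM natrB//.
    have : 0 <= (j%:R - k%:R) * (- alpha) :> R by rewrite mulr_ge0 ?subr_ge0 ?ler_nat// oppr_ge0.
    have : 0 <= (j%:R - k%:R) * (1 - kappa) :> R by rewrite mulr_ge0 ?subr_ge0 ?ler_nat.
    move: (j%:R : R) (k%:R : R) => a b; nra.
  rewrite !pow2NE -!powRD ?pnatr_eq0 ?implybT//.
  rewrite ler_powR ?ler1n// (minn_idPl (ltnW jk)) (eqP (ltnW jk) : (j - k = 0)%N) add0n.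
  rewrite natrM natrB ?(ltnW jk)//=.
  have : 0 <= (k%:R - j%:R) * (n0%:R - (1 - alpha)) :> R.
    by rewrite mulr_ge0 ?subr_ge0 ?ler_nat ?(ltnW jk)// ltW.
  move: (j%:R : R) (k%:R : R) (n0%:R : R) => a b c; nra.
have base : norm1 (conv K (LP_kernel n j k)) <=
    H * (P `^ kappa + 1) * 2 `^ (- kappa * (minn j k)%:R) * norm1 (LP_kernel n j k).
  (* At j = 0 the kernel need not have zero mean, but min(j, k) = 0 and no gain is asked for: plain
     Young suffices, and the summand 1 in P^kappa + 1 covers it. *)
  have [j0|j0] := posnP j.
    rewrite (le_trans (norm1_conv_le Ki Kr tG))// j0 min0n mulr0 powRr0 mulr1.
    rewrite ler_wpM2r ?norm1_ge0// (le_trans KH)// ler_peMr//.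
    by rewrite lerDr powR_ge0.
  apply: (@norm1_conv _ _ _ _ _ _ _ M 1 _ ((4 + 4 * n%:R) * r2 (minn j k))) => //.
  - by rewrite mulr_ge0 ?r2_ge0// addr_ge0// mulr_ge0.
  - exact: vanish_LP_kernel.
  - by rewrite mul1r; case: (j) j0 => // l _; exact: I_LP_kernel.
  move=> y yr.
  have -> : norm1 (fun x => K (x - y) - 1 * K x) = norm1 (fun x => K (x - y) - K x).
    by apply: eq_Rintegral => x _ /=; rewrite mul1r.
  rewrite (le_trans (Kw y))// -mulrA ler_wpM2l//.
  have yP : enorm y <= P * 2 `^ (- (minn j k)%:R).
    by rewrite (le_trans yr)// -pow2NE /r2 /P mulrCA mulrC -mulrA [r0 * _]mulrC mulrA mulrC mulrA.
  rewrite (le_trans (ge0_ler_powR kappa0 _ _ yP)) ?nnegrE ?enorm_ge0//.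
    by rewrite mulr_ge0 ?powR_ge0// ltW.
  rewrite powRM ?powR_ge0 ?(ltW P0)// -powRrM.
  rewrite [- (minn j k)%:R * kappa]mulrC mulrN -mulNr ler_wpM2r ?powR_ge0//.
  by rewrite lerDl.
rewrite (le_trans base)//.
rewrite (@le_trans _ _ (H * (P `^ kappa + 1) * 2 `^ (- kappa * (minn j k)%:R) * (Cg * decay n j k)))//.
  rewrite ler_wpM2l// !mulr_ge0 ?powR_ge0// addr_ge0 ?powR_ge0//.
rewrite [leLHS](_ : _ = H * (Cg * (P `^ kappa + 1)) * (2 `^ (- kappa * (minn j k)%:R) * decay n j k)); last by ring.
by rewrite ler_wpM2l// !mulr_ge0 ?addr_ge0 ?powR_ge0// ltW.
Qed.

End Blocks.

End LittlewoodPaley.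

(** * Sequence norms *)

Section SequenceNorm.
Context {R : realType}.
Implicit Types (q : \bar R) (a b c : nat -> R).
Local Open Scope ereal_scope.

Lemma poweR_le (r : R) (x y : \bar R) : (0 <= r)%R -> 0 <= x -> x <= y -> x `^ r <= y `^ r.
Proof.
move=> r0 x0 xy; apply: gt0_ler_poweR => //; rewrite in_itv/= leey andbT//.
exact: le_trans xy.
Qed.

Definition lqnorm q a : \bar R :=
  match q with
  | r%:E => (\sum_(0 <= j <oo) (a j `^ r)%:E) `^ r^-1
  | +oo => ereal_sup (range (fun j => (a j)%:E))
  | -oo => 0
  end.

Lemma lqnorm_ge0 q a : (forall j, 0 <= a j)%R -> 0 <= lqnorm q a.
Proof.
move=> a0; case: q => [r| |] //=; first exact: poweR_ge0.
by apply: (@le_trans _ _ (a 0%N)%:E); [rewrite lee_fin|apply: ereal_sup_ubound; exists 0%N].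
Qed.

Lemma lqnorm0 q : 1 < q -> lqnorm q (fun=> 0%R) = 0.
Proof.
case: q => [r| |] //=; rewrite ?lte_fin => r1.
  rewrite powR0 ?gt_eqF ?(lt_trans _ r1)//.
  rewrite eseries0 ?poweR0r ?invr_neq0 ?gt_eqF ?(lt_trans _ r1)//.
rewrite (_ : range _ = [set 0]) ?ereal_sup1//.
by apply/seteqP; split=> [_ [j _ <-]//|_ ->]; exists 0%N.
Qed.

Lemma lqnorm_triangle q a b c : 1 < q -> (forall j, 0 <= a j <= b j + c j)%R ->
  (forall j, 0 <= b j)%R -> (forall j, 0 <= c j)%R ->
  lqnorm q a <= lqnorm q b + lqnorm q c.
Proof.
case: q => [r| |] //=; rewrite ?lte_fin => r1 abc b0 c0; last first.
  apply: ge_ereal_sup => _ [j _ <-]; have /andP[_] := abc j.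
  rewrite -lee_fin EFinD => /le_trans; apply.
  by apply: leeD; apply: ereal_sup_ubound; exists j.
have r0 : (0 < r)%R by rewrite (lt_trans _ r1).
have lqE (u : nat -> R) : (forall j, 0 <= u j)%R ->
    (\sum_(0 <= j <oo) (u j `^ r)%:E) `^ r^-1 = 'N[counting]_r%:E[EFin \o u].
  move=> u0; rewrite Lnorm_counting//; congr (_ `^ _).
  by apply: eq_eseriesr => j _ /=; rewrite ger0_norm.
rewrite (lqE _ b0) (lqE _ c0).
have := @minkowski_EFin _ _ R counting b c r (fun _ _ _ => I) (fun _ _ _ => I) (ltW r1).
apply: le_trans; rewrite -lqE; last by move=> j; rewrite addr_ge0.
apply: poweR_le; first by rewrite invr_ge0 ltW.
  by apply: nneseries_ge0 => *; rewrite lee_fin powR_ge0.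
apply: lee_nneseries => [j _ _|j _]; first by rewrite lee_fin powR_ge0.
have /andP[a0 abj] := abc j.
by rewrite lee_fin ge0_ler_powR ?nnegrE ?addr_ge0// ltW.
Qed.

End SequenceNorm.

(** * Young's inequality for sequences with geometric decay *)

Section DiscreteYoung.
Context {R : realType}.
Implicit Types (a b : nat -> R).

(** Since y^2 = 1/2, the decay 2^-|j-k| is a product of two equal halves y^|j-k|; [Lam] bounds the
    two geometric series of one half. *)
Let y : R := Num.sqrt 2^-1.
Let Lam : R := 2 / (1 - y).

Let y2 : y ^+ 2 = 2^-1. Proof. by rewrite sqr_sqrtr// invr_ge0. Qed.

Let y0 : 0 < y. Proof. by rewrite sqrtr_gt0 invr_gt0. Qed.

Let y1 : y < 1.
Proof.
rewrite -(@ltr_pXn2r _ 2) ?nnegrE ?(ltW y0)// y2 expr1n invf_lt1// ltr1n//.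
Qed.

Let y_le1 : y <= 1. Proof. exact: ltW. Qed.

Let Lam0 : 0 < Lam. Proof. by rewrite divr_gt0// subr_gt0. Qed.

Let dist j k := ((j - k) + (k - j))%N.

Lemma geometric_sum j J : \sum_(k < J) y ^+ dist j k <= Lam.
Proof.
(* Multiplication by 1 - y telescopes the sum: the first branch is the rising part up to j, the
   second the falling part beyond it. *)
have H : (1 - y) * \sum_(k < J) y ^+ dist j k <=
    if (J <= j)%N then y ^+ (j - J).+1 else 1 + y - y ^+ (J - j).
  elim: J => [|J IH]; first by rewrite big_ord0 mulr0 /= exprn_ge0// ltW.
  rewrite big_ord_recr/= mulrDr.
  have [Jj|Jj|Jj] := ltngtP J j.
  - move: IH; rewrite (ltnW Jj) => IH; rewrite /dist (eqP (ltnW Jj) : (J - j = 0)%N) addn0.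
    have -> : (j - J = (j - J.+1).+1)%N by rewrite subnSK.
    rewrite (le_trans (lerD IH (lexx _)))//.
    by rewrite subnSK// ; rewrite mulrBl mul1r -exprS addrC subrK.
  - move: IH; rewrite leqNgt Jj/= => IH.
    rewrite /dist (eqP (ltnW Jj) : (j - J = 0)%N) add0n (le_trans (lerD IH (lexx _)))//.
    by rewrite subSn ?(ltnW Jj)// mulrBl mul1r -exprS addrA subrK.
  - move: IH; rewrite Jj leqnn subnn expr1 => IH; rewrite /dist subnn expr0 mulr1.
    by rewrite subSn// subnn expr1 addrK (le_trans (lerD IH (lexx _)))// addrC subrK.
rewrite /Lam ler_pdivlMr ?subr_gt0// mulrC (le_trans H)//.
case: ifP => _.
  by rewrite (le_trans (exprn_ile1 _ _ _))// ?(ltW y0)// ler1n.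
have : 0 <= y ^+ (J - j) by rewrite exprn_ge0// ltW.
by have := y1; lra.
Qed.

Lemma pow2N_sqr n : 2 ^- n = y ^+ n * y ^+ n :> R.
Proof. by rewrite -exprMn -expr2 y2 exprVn. Qed.

(** The hypothesis allows a finite sum and an error [e], which is the form delivered by a
    reproducing formula with a vanishing remainder. Half of the decay reduces the sum in k to a
    supremum, the other half makes the sum in j converge; no conjugate exponent is needed. *)
Lemma discrete_young (q : \bar R) : (1 < q)%E ->
  exists2 C : R, 0 < C & forall a b (D : R), 0 < D ->
    (forall j, 0 <= a j) -> (forall k, 0 <= b k) ->
    (forall j e, 0 < e -> exists J : nat,
      a j <= e + D * \sum_(k < J) 2 ^- ((j - k) + (k - j)) * b k) ->
    (lqnorm q a <= (C * D)%:E * lqnorm q b)%E.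
Proof.
move=> q1; exists (Lam * (Lam `^ (fine q)^-1 + 1)).
  by rewrite mulr_gt0// ltr_wpDl// powR_ge0.
move=> a b D D0 a0 b0 Hab.
have Lam1 : 1 <= Lam.
  by rewrite /Lam ler_pdivlMr ?subr_gt0// mul1r; have := y0; lra.
(* Half of the decay in |j - k| turns the sum over k into a supremum. *)
have key j (v : R) : 0 <= v -> (forall k, y ^+ dist j k * b k <= v) -> a j <= D * Lam * v.
  move=> v0 Hv; apply/ler_addgt0Pr => e e0.
  have [J aj] := Hab j e e0; rewrite (le_trans aj)// [leRHS]addrC lerD2l.
  rewrite -mulrA ler_wpM2l ?(ltW D0)//.
  rewrite (@le_trans _ _ (\sum_(k < J) y ^+ dist j k * v))//.
    apply: ler_sum => k _; rewrite pow2N_sqr -mulrA ler_wpM2l ?exprn_ge0 ?(ltW y0)//.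
    exact: Hv.
  by rewrite -mulr_suml ler_wpM2r// geometric_sum.
case: q q1 => [r| |]//=; rewrite ?lte_fin => r1; last first.
  set B := (X in (_ <= _ * X)%E).
  have B0 : (0 <= B)%E by apply: (@lqnorm_ge0 _ +oo%E).
  apply: ge_ereal_sup => _ [j _ <-].
  case EB : B B0 => [v| |]// v0; last first.
    rewrite gt0_muley ?leey// lte_fin.
    exact: (mulr_gt0 (mulr_gt0 Lam0 (ltr_wpDl (powR_ge0 _ _) ltr01)) D0).
  have bv k : b k <= v by rewrite -lee_fin -EB; apply: ereal_sup_ubound; exists k.
  rewrite -EFinM lee_fin (@le_trans _ _ (D * Lam * v))//.
    apply: key => // k; rewrite (le_trans _ (bv k))// ler_piMl ?b0//.
    by rewrite exprn_ile1// ltW.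
  rewrite ler_wpM2r// mulrC ler_wpM2r ?(ltW D0)// ler_peMr ?(ltW Lam0)//.
  by rewrite lerDr powR_ge0.
have r0 : 0 < r by rewrite (lt_trans _ r1).
(* The r-th root of [V j] dominates every y^|j-k| b_k, so it can be the [v] of [key]; if it is
   infinite there is nothing to prove. *)
pose V j : \bar R := (\sum_(0 <= k <oo) ((y ^+ dist j k * b k) `^ r)%:E)%E.
have V0 j : (0 <= V j)%E by apply: nneseries_ge0 => *; rewrite lee_fin powR_ge0.
have DL0 : 0 < D * Lam by rewrite mulr_gt0.
have aV j : ((a j `^ r)%:E <= ((D * Lam) `^ r)%:E * V j)%E.
  have termV k : (((y ^+ dist j k * b k) `^ r)%:E <= V j)%E.
    apply: (@le_trans _ _ (\sum_(0 <= i < k.+1) ((y ^+ dist j i * b i) `^ r)%:E)%E); last first.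
      by apply: nneseries_lim_ge => *; rewrite lee_fin powR_ge0.
    rewrite big_nat_recr//= leeDr// sume_ge0// => i _.
    by rewrite lee_fin powR_ge0.
  case EV : (V j) (V0 j) termV => [v| |]// v0 termV; last first.
    by rewrite gt0_muley ?leey// lte_fin powR_gt0.
  rewrite -EFinM lee_fin.
  have -> : (D * Lam) `^ r * v = (D * Lam * v `^ r^-1) `^ r.
    by rewrite [in RHS]powRM ?powR_ge0 ?(ltW DL0)// -powRrM mulVf ?gt_eqF// powRr1.
  have v1 : 0 <= D * Lam * v `^ r^-1 := mulr_ge0 (ltW DL0) (powR_ge0 _ _).
  rewrite ge0_ler_powR ?nnegrE ?(ltW r0)//.
  apply: key => [|k]; first exact: powR_ge0.
  have yb0 : 0 <= y ^+ dist j k * b k by rewrite mulr_ge0// exprn_ge0// ltW.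
  rewrite -[leLHS](@powRr1 _ _ yb0) -(mulfV (lt0r_neq0 r0)) powRrM.
  by rewrite ge0_ler_powR ?nnegrE ?powR_ge0 ?invr_ge0 ?(ltW r0)// -lee_fin.
pose SB : \bar R := (\sum_(0 <= k <oo) (b k `^ r)%:E)%E.
have SB0 : (0 <= SB)%E by apply: nneseries_ge0 => *; rewrite lee_fin powR_ge0.
have sumV : (\sum_(0 <= j <oo) V j <= Lam%:E * SB)%E.
  rewrite /V nneseries_interchange; last by move=> *; rewrite lee_fin powR_ge0.
  rewrite /SB -nneseriesZl; last by move=> *; rewrite lee_fin powR_ge0.
  apply: lee_nneseries => [k _ _|k _].
    by apply: nneseries_ge0 => *; rewrite lee_fin powR_ge0.
  apply: lime_le; first by apply: is_cvg_nneseries => *; rewrite lee_fin powR_ge0.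
  apply: nearW => J; rewrite sumEFin -EFinM lee_fin big_mkord.
  apply: (@le_trans _ _ (\sum_(j < J) y ^+ dist j k * b k `^ r)).
    (* As r > 1 and y < 1, the r-th power of y^|j-k| is at most y^|j-k|, which is summable in j with
       bound [Lam]. *)
    apply: ler_sum => j _; have yk0 : 0 < y ^+ dist j k by rewrite exprn_gt0.
    rewrite powRM ?(ltW yk0)// ler_wpM2r ?powR_ge0// ge1r_powR ?(ltW r1)// yk0/=.
    by rewrite exprn_ile1// ltW.
  rewrite -mulr_suml ler_wpM2r ?powR_ge0// (le_trans _ (geometric_sum k J))//.
  by apply: ler_sum => j _; rewrite /dist addnC.
apply: (@le_trans _ _ ((((D * Lam) `^ r)%:E * (Lam%:E * SB)) `^ r^-1)%E).
  apply: poweR_le; first by rewrite invr_ge0 ltW.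
    by apply: nneseries_ge0 => *; rewrite lee_fin powR_ge0.
  apply: (@le_trans _ _ (((D * Lam) `^ r)%:E * \sum_(0 <= j <oo) V j)%E); last first.
    by rewrite lee_wpmul2l// lee_fin powR_ge0.
  rewrite -nneseriesZl//; apply: lee_nneseries => [j _ _|j _]; last exact: aV.
  by rewrite lee_fin powR_ge0.
rewrite !poweRM ?mule_ge0 ?lee_fin ?powR_ge0 ?(ltW Lam0)//.
rewrite !poweR_EFin -powRrM mulfV ?gt_eqF// powRr1 ?(ltW DL0)// muleA -EFinM.
rewrite lee_wpmul2r ?poweR_ge0// lee_fin.
rewrite [leRHS](_ : _ = D * Lam * (Lam `^ r^-1 + 1)); last by ring.
by rewrite ler_wpM2l ?(ltW DL0)// lerDl.
Qed.

End DiscreteYoung.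

(** * Weighted Besov norms *)

Section WeightedNorm.
Context {R : realType} {d : nat} {dT} {T : measurableType dT}.
Context {m : {sigma_finite_measure set T -> \bar R}}.
Context {io : T -> 'rV[R]_d} {oi : 'rV[R]_d -> T}.
Local Notation E := 'rV[R]_d.
Hypothesis M : lebesgue_model m io oi.
Implicit Types (f g h K A : E -> R) (x y : E).

Local Notation mfun f := (measurable_fun [set: T] (f \o io)).
Local Notation L1 f := (m.-integrable [set: T] (EFin \o (f \o io))).
Local Notation I f := (Rintegral m setT (f \o io)).
Local Notation norm1 f := (Rintegral m setT (Num.norm \o (f \o io))).
Local Notation test := (@test_function R d).
Local Notation conv := (@convolution R d).

Variables (mu p : R).
Hypotheses (mu0 : 0 <= mu) (p1 : 1 < p).

Let p0 : 0 < p. Proof. exact: lt_trans p1. Qed.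

Local Notation W := (weighted_Lnorm mu p).

Definition weight x : R := expR (- mu * enorm x).

Definition weighted_int f : \bar R := (\int[m]_x (`|f (io x)| `^ p * weight (io x))%:E)%E.

Lemma wnorm_int f : W f = (weighted_int f `^ p^-1)%E.
Proof. by rewrite /weighted_Lnorm (model_int M). Qed.

Lemma weighted_int_ge0 f : (0 <= weighted_int f)%E.
Proof. by apply: integral_ge0 => x _; rewrite lee_fin mulr_ge0 ?powR_ge0 ?expR_ge0. Qed.

Lemma mfun_weight (a : R) : mfun (fun x => expR (a * enorm x)).
Proof.
apply: (measurableT_comp (@measurable_expR R)); apply: measurable_funM => //.
exact: (model_cont M (@enorm_continuous R d)).
Qed.

Lemma mfun_powR f (a : R) : mfun f -> mfun (fun x => `|f x| `^ a).
Proof.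
move=> mf; apply: (measurableT_comp (measurable_powR a)).
exact: (measurableT_comp (@normr_measurable _ _)).
Qed.

Lemma mfun_weighted f : mfun f -> mfun (fun x => `|f x| `^ p * weight x).
Proof. by move=> mf; apply: measurable_funM; [exact: mfun_powR|exact: mfun_weight]. Qed.

Lemma powR_expR (a b : R) : expR a `^ b = expR (a * b).
Proof. by rewrite /powR gt_eqF ?expR_gt0// expRK mulrC. Qed.

(** The factor exp(- mu |x| / p) is absorbed into the function, so that Minkowski's inequality for
    the unweighted norm applies. *)
Lemma wnorm_Lnorm f :
  W f = 'N[m]_p%:E[EFin \o (fun x : T => f (io x) * expR (- mu / p * enorm (io x)))%R]%E.
Proof.
rewrite wnorm_int unlock /weighted_int; congr (_ `^ _)%E; apply: eq_integral => x _ /=.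
rewrite normrM [`|expR _|]ger0_norm ?expR_ge0// powRM ?expR_ge0// powR_expR.
congr ((_ * expR _)%:E); rewrite mulrAC -!mulrA; congr (_ * _).
by rewrite mulrA mulVf ?mul1r// gt_eqF.
Qed.

Lemma wnorm_ge0 f : (0 <= W f)%E. Proof. by rewrite wnorm_int poweR_ge0. Qed.

Lemma wnormD f g : mfun f -> mfun g -> (W (f + g)%R <= W f + W g)%E.
Proof.
move=> mf mg; rewrite !wnorm_Lnorm.
have mw := mfun_weight (- mu / p).
have := @minkowski_EFin _ _ _ m _ _ p (measurable_funM mf mw) (measurable_funM mg mw) (ltW p1).
by apply: le_trans; rewrite le_eqVlt; apply/orP; left; apply/eqP; apply: eq_Lnorm => x /=;
  rewrite mulrDl.
Qed.

Lemma wnormN f : W (- f) = W f.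
Proof.
have H : weighted_int (- f) = weighted_int f.
  by apply: eq_integral => x _; rewrite !fctE normrN.
by rewrite (wnorm_int (- f)) H wnorm_int.
Qed.

Lemma wnormZ (a : R) f : mfun f -> W (a \*: f) = (`|a|%:E * W f)%E.
Proof.
move=> mf; rewrite !wnorm_int.
have -> : weighted_int (a \*: f) = ((`|a| `^ p)%:E * weighted_int f)%E.
  rewrite /weighted_int -ge0_integralZl//; last 2 first.
  - by apply/measurable_EFinP; exact: mfun_weighted.
  - by move=> x _; rewrite lee_fin mulr_ge0 ?powR_ge0 ?expR_ge0.
  by apply: eq_integral => x _; rewrite -EFinM mulrA -powRM// -normrM.
rewrite poweRM ?lee_fin ?powR_ge0//; last exact: weighted_int_ge0.
by rewrite poweR_EFin -powRrM mulfV ?gt_eqF// powRr1.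
Qed.

(** The weight is at most 1 because mu >= 0. This controls the remainder of the reproducing formula,
    uniformly in mu. *)
Lemma wnorm_bound (r C : R) f : 0 <= r -> mfun f -> vanish_outside r f ->
  (forall x, `|f x| <= C) -> (W f <= (C * ((2 * r) ^+ d) `^ p^-1)%:E)%E.
Proof.
move=> r_ge0 mf fr fC; have C0 : 0 <= C by rewrite (le_trans (normr_ge0 (f 0))).
pose F x := `|f x| `^ p * weight x.
have F0 x : 0 <= F x by rewrite mulr_ge0 ?powR_ge0 ?expR_ge0.
have Fr : vanish_outside r F.
  by move=> x rx; rewrite /F fr// normr0 powR0 ?mul0r// gt_eqF.
have FC x : `|F x| <= C `^ p.
  rewrite ger0_norm// /F (@le_trans _ _ (`|f x| `^ p))//.
    rewrite ler_piMr ?powR_ge0// /weight -[leRHS]expR0 ler_expR mulNr oppr_le0.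
    by rewrite mulr_ge0// enorm_ge0.
  by rewrite ge0_ler_powR ?nnegrE// ltW.
have [Fi FN] := vanish_L1 M r_ge0 (mfun_weighted mf) Fr FC.
rewrite wnorm_int (@le_trans _ _ ((C `^ p * (2 * r) ^+ d)%:E `^ p^-1)%E)//.
  apply: poweR_le; [by rewrite invr_ge0 ltW|exact: weighted_int_ge0|].
  rewrite -lee_fin -(norm1E Fi) in FN; apply: le_trans FN.
  rewrite le_eqVlt; apply/orP; left; apply/eqP; apply: eq_integral => x _.
  by congr (_%:E); rewrite [RHS]ger0_norm//; exact: (F0 (io x)).
rewrite poweR_EFin powRM ?powR_ge0 ?exprn_ge0 ?mulr_ge0//.
by rewrite -powRrM mulfV ?gt_eqF// powRr1.
Qed.

Lemma wnorm_fin f : test f -> W f \is a fin_num.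
Proof.
move=> tf; have [r r_gt0 fr] := test_vanish tf; have [C _ fC] := test_bounded tf.
rewrite ge0_fin_numE ?wnorm_ge0//.
by rewrite (le_lt_trans (wnorm_bound (ltW r_gt0) (test_mfun M tf) fr fC))// ltry.
Qed.

Lemma wnorm0 : W (0 : E -> R) = 0%E.
Proof.
apply/eqP; rewrite eq_le wnorm_ge0 andbT.
have H := @wnorm_bound 0 0 0 (lexx _) (test_mfun M (@test0 R d)) _ _.
by rewrite (le_trans (H _ _))// ?mul0r// => x; rewrite normr0.
Qed.

(* Jensen for the measure |A| dm, in the form given by Hoelder. *)
Lemma conv_powR A g x : test A -> test g ->
  ((`|conv A g x| `^ p)%:E <=
   (norm1 A `^ (p - 1))%:E * \int[m]_y (`|A (io y)| * `|g (x - io y)| `^ p)%:E)%E.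
Proof.
move=> tA tg; have mA := test_mfun M tA; have mg := test_mfun M tg.
have Ai := test_L1 M tA; have bg := test_bmfun M tg.
have mgx := mfun_subr M x mg.
(* |A| is split into its powers 1 - 1/p and 1/p, the second one carrying |g|; Hoelder is used with
   exponents 1/(1 - 1/p) and p. *)
pose f1 (y : T) := `|A (io y)| `^ (1 - p^-1).
pose f2 (y : T) := `|A (io y)| `^ p^-1 * `|g (x - io y)|.
have mf1 : measurable_fun setT f1 by exact: mfun_powR.
have mf2 : measurable_fun setT f2.
  by apply: measurable_funM; [exact: mfun_powR|exact: (measurableT_comp (@normr_measurable _ _))].
have q0 : 0 < 1 - p^-1 by rewrite subr_gt0 invf_lt1.
have f12 (y : T) : f1 y * f2 y = `|A (io y)| * `|g (x - io y)|.
  rewrite /f1 /f2 mulrA -powRD; first by rewrite subrK powRr1.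
  by rewrite subrK oner_eq0.
have H1 : (`|conv A g x|%:E <= 'N[m]_1[EFin \o (f1 \* f2)%R])%E.
  rewrite Lnorm1 (convE M)//.
  rewrite (EFin_normr_Rintegral measurableT (L1_bmfun Ai (bmfun_refl M x bg))).
  apply: (le_trans (le_abse_integral _ _ _)) => //.
    exact: measurable_int (L1_bmfun Ai (bmfun_refl M x bg)).
  rewrite le_eqVlt; apply/orP; left; apply/eqP; apply: eq_integral => y _ /=.
  by rewrite f12 !normrM !normr_id.
have := @hoelder _ _ _ m f1 f2 (1 - p^-1)^-1 p mf1 mf2.
rewrite invr_gt0 q0 p0 invrK subrK => /(_ isT isT erefl)/(le_trans H1) H2.
have N1 : ('N[m]_((1 - p^-1)^-1)%:E[EFin \o f1] = (norm1 A `^ (1 - p^-1))%:E)%E.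
  rewrite unlock invrK -poweR_EFin -(norm1E Ai); congr (_ `^ _)%E.
  apply: eq_integral => y _ /=; rewrite ger0_norm ?powR_ge0// -powRrM mulfV ?gt_eqF//.
  by rewrite powRr1.
have N2 : ('N[m]_p%:E[EFin \o f2] = (\int[m]_y (`|A (io y)| * `|g (x - io y)| `^ p)%:E) `^ p^-1)%E.
  rewrite unlock; congr (_ `^ _)%E; apply: eq_integral => y _ /=.
  rewrite ger0_norm ?mulr_ge0 ?powR_ge0// powRM ?powR_ge0// -powRrM mulVf ?gt_eqF//.
  by rewrite powRr1.
have G0 : (0 <= \int[m]_y (`|A (io y)| * `|g (x - io y)| `^ p)%:E)%E.
  by apply: integral_ge0 => y _; rewrite lee_fin mulr_ge0 ?powR_ge0.
rewrite N1 N2 in H2; rewrite -poweR_EFin.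
apply: (le_trans (poweR_le (ltW p0) _ H2)) => //.
rewrite poweRM ?lee_fin ?powR_ge0 ?poweR_ge0// poweR_EFin -powRrM -poweRrM mulVf ?gt_eqF//.
by rewrite poweRe1// mulrBl mul1r mulVf ?gt_eqF.
Qed.

(** For |y| <= rho, exp(- mu |x|) <= exp(mu rho) exp(- mu |x - y|), so the weight follows the
    translation of [g]. The constant depends on mu only through mu rho, hence is uniform on bounded
    sets of mu. *)
Lemma weighted_young (rho : R) A g : test A -> vanish_outside rho A -> test g ->
  (W (conv A g) <= (expR (mu * rho / p) * norm1 A)%:E * W g)%E.
Proof.
move=> tA Ar tg; have mA := test_mfun M tA; have mg := test_mfun M tg.
have Ai := test_L1 M tA; have tc := test_conv2 M tA tg; have n0 := norm1_ge0 (m := m) (io := io) A.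
pose F (z : T * T) : \bar R := (`|A (io z.2)| * `|g (io z.1 - io z.2)| `^ p * weight (io z.1))%:E.
have mF : measurable_fun setT F.
  apply/measurable_EFinP; apply: measurable_funM; last exact: (mfun_fst (mfun_weight (- mu))).
  apply: measurable_funM.
    exact: (measurableT_comp (@normr_measurable _ _) (mfun_snd mA)).
  apply: (measurableT_comp (measurable_powR p)).
  exact: (measurableT_comp (@normr_measurable _ _) (mfun_sub M mg)).
have F0 z : (0 <= F z)%E by rewrite lee_fin !mulr_ge0 ?powR_ge0 ?expR_ge0.
have mgp (x : E) : mfun (fun y => `|A y| * `|g (x - y)| `^ p).
  apply: measurable_funM; first exact: (measurableT_comp (@normr_measurable _ _) mA).
  exact: (mfun_powR p (mfun_subr M x mg)).
have key : (weighted_int (conv A g) <=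
    (norm1 A `^ p * expR (mu * rho))%:E * weighted_int g)%E.
  apply: (@le_trans _ _ ((norm1 A `^ (p - 1))%:E * \int[m]_x \int[m]_y F (x, y))%E).
    rewrite -ge0_integralZl//; last 3 first.
    - exact: (measurable_fun_fubini_tonelli_F F).
    - by move=> x _; exact: integral_ge0.
    - by rewrite lee_fin powR_ge0.
    apply: ge0_le_integral => //.
    - by move=> x _; rewrite lee_fin mulr_ge0 ?powR_ge0 ?expR_ge0.
    - by apply/measurable_EFinP; apply: mfun_weighted; exact: (test_mfun M tc).
    - by apply: measurable_funeM; exact: (measurable_fun_fubini_tonelli_F F).
    move=> x _; rewrite EFinM.
    under eq_integral do rewrite /F /= EFinM.
    rewrite ge0_integralZr//; last 2 first.
    - by apply/measurable_EFinP; exact: mgp.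
    - by rewrite lee_fin expR_ge0.
    by rewrite muleA lee_wpmul2r ?lee_fin ?expR_ge0// conv_powR.
  rewrite (fubini_tonelli F)//.
  rewrite -(mulr_powRB1 n0 p0) [norm1 A * _]mulrC -mulrA EFinM -muleA.
  rewrite lee_wpmul2l ?lee_fin ?powR_ge0// EFinM -muleA -(norm1E Ai).
  rewrite -ge0_integralZr//; last 2 first.
  - exact: (emfun_norm mA).
  - by rewrite mule_ge0 ?lee_fin ?expR_ge0// weighted_int_ge0.
  apply: ge0_le_integral => //.
  - by move=> y _; exact: integral_ge0.
  - exact: (measurable_fun_fubini_tonelli_G F).
  - by apply: emeasurable_funM => //; exact: (emfun_norm mA).
  move=> y _; have [yr|yr] := leP (enorm (io y)) rho; last first.
    rewrite integral0_eq ?mule_ge0 ?lee_fin ?expR_ge0 ?weighted_int_ge0// => x _.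
    by rewrite /F /= Ar// normr0 !mul0r.
  have <- : (\int[m]_x (`|g (io x - io y)| `^ p * weight (io x - io y))%:E = weighted_int g)%E.
    rewrite (model_trans M (F := fun x => (`|g x| `^ p * weight x)%:E))//.
      by apply/measurable_EFinP; exact: mfun_weighted.
    by move=> x; rewrite lee_fin mulr_ge0 ?powR_ge0 ?expR_ge0.
  have mgy := mfun_subl M (io y) (mfun_weighted mg).
  rewrite muleA -EFinM -ge0_integralZl//; last 2 first.
  - by apply/measurable_EFinP; exact: mgy.
  - by move=> x _; rewrite lee_fin mulr_ge0 ?powR_ge0 ?expR_ge0.
  apply: ge0_le_integral => //.
  - exact: (measurable_fun_pair1 _ mF).
  - by apply: measurable_funeM; apply/measurable_EFinP; exact: mgy.
  move=> x _; rewrite /F /= lee_fin -!mulrA ler_wpM2l// mulrCA ler_wpM2l ?powR_ge0//.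
  rewrite /weight -expRD ler_expR.
  have := enorm_triangle (io x) (- io y); rewrite enormN => xy.
  have : mu * enorm (io x - io y) <= mu * (enorm (io x) + rho).
    by rewrite ler_wpM2l// (le_trans xy)// lerD2l.
  by rewrite mulrDr; lra.
rewrite !wnorm_int (le_trans (poweR_le _ (weighted_int_ge0 _) key))//.
  by rewrite invr_ge0 ltW.
rewrite poweRM ?lee_fin ?mulr_ge0 ?powR_ge0 ?expR_ge0 ?weighted_int_ge0//.
rewrite poweR_EFin powRM ?powR_ge0 ?expR_ge0// -powRrM mulfV ?gt_eqF// powRr1//.
by rewrite powR_expR [norm1 A * _]mulrC.
Qed.

Lemma wnorm_sum n (g : nat -> E -> R) : (forall k, test (g k)) ->
  (W (\sum_(k < n) g k)%R <= \sum_(k < n) W (g k))%E.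
Proof.
move=> tg; have ts l : test (\sum_(k < l) g k).
  elim: l => [|l IH]; first by rewrite big_ord0; exact: test0.
  by rewrite big_ord_recr; exact: testD.
elim: n => [|n IH]; first by rewrite !big_ord0 wnorm0.
rewrite !big_ord_recr/= (le_trans (wnormD (test_mfun M (ts n)) (test_mfun M (tg n))))//.
exact: leeD.
Qed.

End WeightedNorm.

Lemma eq_lqnorm {R : realType} (q : \bar R) (a b : nat -> R) : a =1 b -> lqnorm q a = lqnorm q b.
Proof. by move=> /funext ->. Qed.

Lemma fine_triangle {R : numDomainType} (x y z : \bar R) :
  x \is a fin_num -> y \is a fin_num -> z \is a fin_num ->
  (x <= y + z)%E -> fine x <= fine y + fine z.
Proof. by case: x => [x| |]//; case: y => [y| |]//; case: z => [z| |]//= _ _ _. Qed.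

(** * The Besov norm on test functions and the convolution estimate *)

Section BesovNorm.
Context {R : realType} {d : nat} {dT} {T : measurableType dT}.
Context {m : {sigma_finite_measure set T -> \bar R}}.
Context {io : T -> 'rV[R]_d} {oi : 'rV[R]_d -> T}.
Local Notation E := 'rV[R]_d.
Hypothesis M : lebesgue_model m io oi.
Implicit Types (f g h K A : E -> R) (x y : E).

Local Notation mfun f := (measurable_fun [set: T] (f \o io)).
Local Notation L1 f := (m.-integrable [set: T] (EFin \o (f \o io))).
Local Notation I f := (Rintegral m setT (f \o io)).
Local Notation norm1 f := (Rintegral m setT (Num.norm \o (f \o io))).
Local Notation test := (@test_function R d).
Local Notation conv := (@convolution R d).

Variables (L : nat) (phi0 : E -> R).
Hypotheses (L1_ : (1 <= L)%N) (phi0A : admissible L phi0).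

Let tphi0 : test phi0. Proof. by case: phi0A. Qed.

Let c := I phi0.

Let c_neq0 : c != 0.
Proof. by case: phi0A => _ /eqP; rewrite (Rintegral_RdE M). Qed.

Let S := c^-1 \*: phi0.

Let tS : test S. Proof. exact: testZ. Qed.

Lemma I_normalized : I S = 1.
Proof.
by rewrite [LHS](IZ (c^-1) (test_L1 M tphi0)) mulVf.
Qed.

(* The moments of the mother block and of phi0 differ by the factor 1 - 2. *)
Lemma I_coord_phi0 (i : 'I_d) : I (fun y => y ord0 i * phi0 y) = 0.
Proof.
have [cphi iphi] := L1_coord M i tphi0.
pose f := fun y : E => y ord0 i * (2 ^- d * phi0 (2^-1 *: y)).
have tf : test (2 ^- d \*: dilate 2^-1 phi0) by apply/testZ/test_dilate.
have [cf fi] := L1_coord M i tf.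
have If : I f = 2 * I (fun y => y ord0 i * phi0 y).
  have E1 : dilate (2 ^+ 1) f = fun y => (2 * 2 ^- d) * (y ord0 i * phi0 y).
    apply/funext => y; rewrite /dilate /f mxE expr1 scalerA mulVf ?pnatr_eq0// scale1r.
    by rewrite mulrACA [_ * 2 ^- d]mulrC !mulrA.
  have := I_scale M 1 cf fi; rewrite -[dilate _ _]/(dilate (2 ^+ 1) f) E1 (IZ _ iphi) muln1 => <-.
  by rewrite mulrA mulrCA mulfV ?mulr1 ?pow2_neq0.
have [_ _ /(_ (fun j => (j == i) : nat))] := phi0A.
have -> : (\sum_(j < d) (j == i))%N = 1%N.
  by rewrite (bigD1 i)//= eqxx big1 ?addn0// => j /negbTE ->.
move=> /(_ L1_); rewrite (Rintegral_RdE M) => H.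
have mon x : monomial (fun j => (j == i) : nat) x = x ord0 i.
  by rewrite /monomial (bigD1 i)//= eqxx expr1 big1 ?mulr1// => j /negbTE ->.
have : I (fun y => y ord0 i * phi0 y - f y) = 0.
  rewrite -[RHS]H; apply: eq_Rintegral => y _ /=.
  by rewrite mon /lp_mother mulrBr.
by rewrite (IB iphi fi) If; lra.
Qed.

Lemma I_coord_normalized (i : 'I_d) : I (fun y => y ord0 i * S y) = 0.
Proof.
have [_ iphi] := L1_coord M i tphi0.
rewrite -[RHS](mulr0 c^-1) -(I_coord_phi0 i) -(IZ _ iphi).
by apply: eq_Rintegral => y _; rewrite /= mulrCA.
Qed.

Lemma lp_blockE j : lp_block phi0 j = c \*: piece S j.
Proof.
apply/funext => x; rewrite /piece /scaled_pred /lp_block; case: j => [|j] /=.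
  rewrite subr0 -[RHS]/(c * (2 ^+ (d * 0) * (c^-1 * phi0 (2 ^+ 0 *: x)))).
  by rewrite muln0 !expr0 scale1r mul1r mulrA mulfV ?mul1r.
rewrite -[RHS]/(c * (2 ^+ (d * j.+1) * (c^-1 * phi0 (2 ^+ j.+1 *: x)) -
  2 ^+ (d * j) * (c^-1 * phi0 (2 ^+ j *: x)))) /lp_mother.
have -> : 2^-1 *: (2 ^+ j.+1 *: x) = 2 ^+ j *: x.
  by rewrite scalerA exprS mulrA mulVf ?mul1r// pnatr_eq0.
rewrite mulnS exprD.
by field; rewrite c_neq0 pow2_neq0.
Qed.

Lemma test_lp_block j : test (lp_block phi0 j).
Proof. by rewrite lp_blockE; apply: testZ; exact: test_piece. Qed.

Section Weight.
Variables (mu p : R).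
Hypotheses (mu0 : 0 <= mu) (p1 : 1 < p).
Local Notation W := (weighted_Lnorm mu p).

(** Nothing is lost by [fine] on test functions, whose weighted norms are finite; the sequence
    estimates can then be made in [R]. *)
Definition block_norm j f : R := fine (W (conv (lp_block phi0 j) f)).

Lemma block_normE j f : test f -> W (conv (lp_block phi0 j) f) = (block_norm j f)%:E.
Proof.
move=> tf; rewrite /block_norm fineK//; apply: (wnorm_fin M mu0 p1).
exact: (test_conv2 M (test_lp_block j) tf).
Qed.

Lemma block_norm_ge0 j f : 0 <= block_norm j f.
Proof. by apply: fine_ge0; exact: (wnorm_ge0 M). Qed.

Lemma besov_normE s (q : \bar R) f : (1 < q)%E -> test f ->
  besov_norm phi0 s mu p q f = lqnorm q (fun j => 2 `^ (j%:R * s) * block_norm j f).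
Proof.
move=> q1 tf; rewrite /besov_norm /lqnorm; case: q q1 => [r| |]// r1.
  congr (_ `^ _)%E; apply: eq_eseriesr => j _; rewrite block_normE// poweR_EFin -EFinM.
  by rewrite powRM ?powR_ge0 ?block_norm_ge0// -powRrM.
congr ereal_sup; apply: eq_imagel => j _.
by rewrite block_normE.
Qed.

Lemma besov_seminorm s (q : \bar R) : (1 < q)%E ->
  seminorm_on test (besov_norm phi0 s mu p q).
Proof.
move=> q1; have tb j := test_lp_block j.
have convBB j f g : test f -> test g ->
    conv (lp_block phi0 j) (f - g) = conv (lp_block phi0 j) f - conv (lp_block phi0 j) g.
  by move=> tf tg; exact: (convB M (tb j) tf tg).
split.
- move=> f tf; rewrite besov_normE//; apply: lqnorm_ge0 => j.
  by rewrite mulr_ge0 ?powR_ge0 ?block_norm_ge0.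
- rewrite besov_normE//; last exact: test0.
  rewrite -(lqnorm0 q1); congr lqnorm; apply/funext => j; rewrite /block_norm.
  rewrite -(subrr (0 : E -> R)) (convBB j 0 0 (@test0 _ _) (@test0 _ _)) subrr.
  by rewrite (wnorm0 M mu0 p1) mulr0.
- move=> f g tf tg; 
  rewrite (besov_normE s q1 (testB tf tg)) (besov_normE s q1 (testB tg tf)).
  have sym j : block_norm j (f - g) = block_norm j (g - f).
    by rewrite /block_norm (convBB j f g tf tg) (convBB j g f tg tf) -opprB (wnormN M).
  by apply: eq_lqnorm => j; exact: (congr1 ( *%R _) (sym j)).
- move=> f g tf tg; have tfg := testB tf tg.
  rewrite (besov_normE s q1 tf) (besov_normE s q1 tg) (besov_normE s q1 tfg).
  apply: lqnorm_triangle => // j; rewrite ?mulr_ge0 ?powR_ge0 ?block_norm_ge0//=.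
  rewrite -mulrDr ler_wpM2l ?powR_ge0//.
  have E : conv (lp_block phi0 j) f = conv (lp_block phi0 j) (f - g) + conv (lp_block phi0 j) g.
    by rewrite (convBB j f g tf tg) subrK.
  move: (f - g) tfg E => h th E.
  have th' := test_mfun M (test_conv2 M (tb j) th).
  have tg' := test_mfun M (test_conv2 M (tb j) tg).
  have := wnormD M mu p1 th' tg'; rewrite -E.
  by apply: fine_triangle; apply: (wnorm_fin M mu0 p1); exact: (test_conv2 M (tb j)).
- by move=> f g; exact: testB.
Qed.

End Weight.

Variables (mustar p : R).
Hypothesis p1 : 1 < p.

(** The wave equation enters only through [H]: any integrable kernel supported in the unit ball,
    with L^1 norm and L^1 modulus of order kappa bounded by [H], raises the regularity by kappa. [C]
    is chosen before mu and [K]. *)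
Lemma besov_conv_le (alpha kappa : R) (q : \bar R) :
  alpha <= 0 -> 0 <= kappa <= 1 -> (1 < q)%E ->
  exists2 C : R, 0 < C & forall (mu : R) K H, 0 <= mu <= mustar -> 0 < H ->
    L1 K -> vanish_outside 1 K -> norm1 K <= H ->
    (forall y, norm1 (fun x => K (x - y) - K x) <= H * enorm y `^ kappa) ->
    forall f, test f ->
    (besov_norm phi0 (alpha + kappa) mu p q (conv K f) <=
     (C * H)%:E * besov_norm phi0 alpha mu p q f)%E.
Proof.
move=> alpha0 kappa01 q1; have [r0 r00 S0] := test_vanish tS.
have [C [rho [C0 rho0 LP]]] :=
  littlewood_paley M tS r00 S0 I_normalized I_coord_normalized alpha0 kappa01.
have [Cq Cq0 HY] := discrete_young q1.
(* The weight factor of [weighted_young] at the largest admissible mu; here the dependence on mu is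
   removed. *)
pose X := expR (mustar * rho / p).
have X0 : 0 < X by exact: expR_gt0.
exists (Cq * (X * C)); first by rewrite !mulr_gt0.
move=> mu K H /andP[mu0 muL] H0 Ki K1 KH Kw f tf.
have [A [HA Hdec]] := LP K H Ki K1 KH Kw.
have Kr : exists2 r, 0 < r & vanish_outside r K by exists 1.
have tKf := test_conv M Ki Kr tf.
have tp j := test_piece tS j.
pose w j g := fine (weighted_Lnorm mu p (conv (piece S j) g)).
have w0 j g : 0 <= w j g by apply: fine_ge0; exact: (wnorm_ge0 M).
have wE j g : test g -> (w j g)%:E = weighted_Lnorm mu p (conv (piece S j) g).
  by move=> tg; rewrite /w fineK// (wnorm_fin M mu0 p1)//; exact: (test_conv2 M).
have nE j g : test g -> block_norm mu p j g = `|c| * w j g.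
  move=> tg; rewrite /block_norm lp_blockE.
  rewrite (convZl M c (test_L1 M (tp j)) (test_bmfun M tg)).
  rewrite (wnormZ M mu p1 c (test_mfun M (test_conv2 M (tp j) tg))) -wE//.
rewrite !(besov_normE mu0 p1)// -mulrA.
apply: HY.
- by rewrite !mulr_gt0.
- by move=> j; rewrite mulr_ge0 ?powR_ge0 ?block_norm_ge0.
- by move=> j; rewrite mulr_ge0 ?powR_ge0 ?block_norm_ge0.
move=> j eps eps0; have [c' c'0 [r r_ge0 HJ]] := Hdec f j tf.
pose V := ((2 * r) ^+ d) `^ p^-1.
have V0 : 0 <= V by exact: powR_ge0.
pose P := 2 `^ (j%:R * (alpha + kappa)) : R.
have P0 : 0 <= P by exact: powR_ge0.
pose Y := P * `|c| * (c' * V).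
have Y0 : 0 <= Y by rewrite !mulr_ge0.
(* The remainder at level j, with its Besov weight, is at most Y 2^-J; an integer J above Y / eps is
   large enough since J < 2^J. *)
have [J HYJ] : exists J, Y * 2 ^- J <= eps.
  exists (Num.bound (Y / eps)); rewrite ler_pdivrMr ?exprn_gt0// mulrC -ler_pdivrMr//.
  rewrite (le_trans (ltW (archi_boundP _)))//; first by rewrite divr_ge0// ltW.
  by rewrite -natrX ler_nat ltnW// ltn_expl.
have [e [te er ec] He] := HJ J.
exists J.+1; rewrite nE//.
have tA k : test (conv (A j k) (conv (piece S k) f)).
  by have [tAk _ _] := HA j k; exact: (test_conv2 M tAk (test_conv2 M (tp k) tf)).
have main : w j (conv K f) <= c' * 2 ^- J * V +
    \sum_(k < J.+1) X * norm1 (A j k) * w k f.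
  rewrite -lee_fin wE// He.
  have ts : test (\sum_(k < J.+1) conv (A j k) (conv (piece S k) f)).
    elim: (J.+1) => [|l IH]; first by rewrite big_ord0; exact: test0.
    by rewrite big_ord_recr; exact: testD.
  rewrite (le_trans (wnormD M mu p1 (test_mfun M te) (test_mfun M ts)))//.
  rewrite EFinD leeD//; first exact: (wnorm_bound M mu0 p1 r_ge0 (test_mfun M te) er ec).
  rewrite (le_trans (wnorm_sum M mu0 p1 J.+1 tA))// -sumEFin lee_sum// => k _.
  have [tAk Ak _] := HA j k.
  rewrite (le_trans (weighted_young M mu0 p1 tAk Ak (test_conv2 M (tp k) tf)))//.
  rewrite -wE// -EFinM lee_fin ler_wpM2r// ler_wpM2r ?norm1_ge0// ler_expR.
  by rewrite ler_wpM2r ?invr_ge0 ?(ltW (lt_trans _ p1))// ler_wpM2r// ltW.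
rewrite -/P (@le_trans _ _ (P * (`|c| * (c' * 2 ^- J * V +
    \sum_(k < J.+1) X * norm1 (A j k) * w k f))))//.
  by rewrite ler_wpM2l// ler_wpM2l.
rewrite mulrDr mulrDr lerD//.
  by rewrite (le_trans _ HYJ)// le_eqVlt; apply/orP; left; apply/eqP; rewrite /Y; ring.
rewrite mulrA !mulr_sumr ler_sum// => k _; rewrite nE//.
have [_ _ Ak] := HA j k.
rewrite (@le_trans _ _ (P * `|c| * (X * (H * C *
   (2 `^ (- kappa * j%:R + alpha * (k%:R - j%:R)) * 2 ^- (j - k + (k - j)))) * w k f)))//.
  by rewrite ler_wpM2l ?mulr_ge0// ler_wpM2r// ler_wpM2l// ltW.
(* The weight at level j times the decay factor of [A j k] is the weight of the right-hand side at
   level k. *)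
have PP : P * 2 `^ (- kappa * j%:R + alpha * (k%:R - j%:R)) = 2 `^ (k%:R * alpha).
  by rewrite /P -powRD ?pnatr_eq0 ?implybT//; congr (_ `^ _); ring.
rewrite -PP le_eqVlt; apply/orP; left; apply/eqP; ring.
Qed.

End BesovNorm.

(** * Lebesgue measure on R and R * R *)

Section LebesgueLine.
Context {R : realType}.
Local Notation T := (measurableTypeR R).
Local Notation leb := (@lebesgue_measure R).
Implicit Types (F : R -> \bar R).

Lemma lebesgue_itvcc (a b : R) : a <= b -> leb (`[a, b]%classic : set T) = (b - a)%:E.
Proof.
move=> ab; rewrite [LHS](lebesgue_measure_itv `[a, b])/= lte_fin -EFinD.
by case: ltgtP ab => // -> _; rewrite subrr.
Qed.

Lemma measurable_affine (a b : R) : measurable_fun [set: T] ((fun x => a + b * x) : T -> T).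
Proof. by apply: measurable_funD => //; exact: measurable_funM. Qed.

(** By uniqueness of Lebesgue measure: b times its image under x -> a + b x gives each half-open
    interval its length. *)
Lemma integral_affine (a b : R) F : 0 < b -> measurable_fun [set: T] (F : T -> \bar R) ->
  (forall x, 0 <= F x)%E ->
  (b%:E * \int[leb]_x F (a + b * x)%R = \int[leb]_x F x)%E.
Proof.
move=> b0 mF F0; pose g : T -> T := fun x => a + b * x.
have mg : measurable_fun setT g := measurable_affine a b.
rewrite -(ge0_integral_pushforward mg leb measurableT mF)//.
rewrite -[b%:E]/((NngNum (ltW b0))%:num%:E) -ge0_integral_mscale//.
apply: eq_measure_integral => A mA _; apply/esym.
apply: (lebesgue_measure_unique (mu := mscale (NngNum (ltW b0)) (pushforward leb g))) => //.
move=> _ [[c e]] _ <-.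
pose J : set T := `](c - a) / b, (e - a) / b]%classic.
transitivity (b%:E * leb J)%E; last first.
  apply/esym; congr (_ * leb _)%E; apply/seteqP; split=> x; rewrite /J /g /= !in_itv/=;
    by rewrite ltr_pdivrMr// ler_pdivlMr// ltrBlDl lerBrDl [x * b]mulrC.
rewrite /J !lebesgue_measure_itv/= !lte_fin ltr_pM2r ?invr_gt0// ltrD2r.
case: ifP => _; last by rewrite mule0.
by rewrite -!EFinD -EFinM -mulrBl mulrCA mulfV ?gt_eqF// mulr1; congr (_%:E); ring.
Qed.

Lemma integral_opp F : measurable_fun [set: T] (F : T -> \bar R) ->
  (forall x, 0 <= F x)%E -> (\int[leb]_x F (- x)%R = \int[leb]_x F x)%E.
Proof.
move=> mF F0; have mN : measurable_fun setT (-%R : T -> T) by exact: oppr_measurable.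
rewrite -[LHS](ge0_integral_pushforward mN leb measurableT mF)//.
by apply: eq_measure_integral => A mA _; exact: lebesgue_measureN.
Qed.

Lemma integral_refl (a : R) F : measurable_fun [set: T] (F : T -> \bar R) ->
  (forall x, 0 <= F x)%E -> (\int[leb]_x F (a - x)%R = \int[leb]_x F x)%E.
Proof.
move=> mF F0; rewrite -[RHS](integral_affine a ltr01 mF F0) mul1e.
rewrite -[RHS]integral_opp//; last first.
  exact: (measurableT_comp mF (measurable_affine a 1)).
by apply: eq_integral => x _; rewrite mul1r.
Qed.

End LebesgueLine.

Section LebesguePlane.
Context {R : realType}.
Local Notation T := (measurableTypeR R).
Local Notation leb := (@lebesgue_measure R).

(** The superlevel sets are open, hence countable unions of rectangles with rational endpoints; this
    gives measurability for the product sigma-algebra. *)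
Lemma measurable_open_ray (f : R -> R -> R) :
  (forall (r x y : R), r < f x y -> exists2 e, 0 < e &
     forall u v, `|x - u| < e -> `|y - v| < e -> r < f u v) ->
  measurable_fun [set: T * T] (fun z => f z.1 z.2).
Proof.
move=> fP; apply: (measurability _ (RGenOInfty.measurableE R)) => //= _ [_ [r ->] <-].
rewrite setTI; pose rect (a b c d : R) := `]a, b[%classic `*` `]c, d[%classic : set (T * T).
rewrite (_ : _ @^-1` _ = \bigcup_(a : rat) \bigcup_(b : rat) \bigcup_(c : rat) \bigcup_(d : rat)
    if `[< rect (ratr a) (ratr b) (ratr c) (ratr d) `<=` [set z | r < f z.1 z.2] >] then
      rect (ratr a) (ratr b) (ratr c) (ratr d) else set0).
  do 4 apply: bigcupT_measurable_rat => ?.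
  by case: ifP => // _; apply: measurableX; exact: measurable_itv.
apply/seteqP; split=> [[x y]|[x y]]; rewrite /= in_itv/= andbT.
  move=> /fP[e e0 He].
  have [|a] := @rat_in_itvoo R (x - e) x; first by rewrite ltrBlDr ltrDl.
  rewrite in_itv/= => /andP[a1 a2].
  have [|b] := @rat_in_itvoo R x (x + e); first by rewrite ltrDl.
  rewrite in_itv/= => /andP[b1 b2].
  have [|c] := @rat_in_itvoo R (y - e) y; first by rewrite ltrBlDr ltrDl.
  rewrite in_itv/= => /andP[c1 c2].
  have [|d] := @rat_in_itvoo R y (y + e); first by rewrite ltrDl.
  rewrite in_itv/= => /andP[d1 d2].
  exists a => //; exists b => //; exists c => //; exists d => //.
  rewrite (_ : `[< _ >] = true).
    by split; rewrite /= in_itv/=; apply/andP; split.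
  apply/asboolP => -[u v] []; rewrite /= !in_itv/= => /andP[u1 u2] /andP[v1 v2].
  by apply: He; rewrite ltr_distl; apply/andP; split; lra.
move=> [a _ [b _ [c _ [d _]]]]; by case: ifP => // /asboolP H /H.
Qed.

Lemma measurable_sub (f g : T * T -> R) :
  measurable_fun [set: T * T] f -> measurable_fun [set: T * T] g ->
  measurable_fun [set: T * T] (fun z => f z - g z).
Proof. exact: measurable_funB. Qed.

(** Tonelli turns a change of variable in each coordinate into one on the plane. It serves for
    reflections (a = b = 1), dyadic dilations and the scaling of the planar kernel. *)
Lemma integral_plane (F : R * R -> \bar R) (phi psi : R -> R) (a b : R) : 0 <= a -> 0 <= b ->
  measurable_fun [set: T] (phi : T -> T) -> measurable_fun [set: T] (psi : T -> T) ->
  (forall G : R -> \bar R, measurable_fun [set: T] (G : T -> \bar R) -> (forall x, 0 <= G x)%E ->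
     (a%:E * \int[leb]_x G (phi x) = \int[leb]_x G x)%E) ->
  (forall G : R -> \bar R, measurable_fun [set: T] (G : T -> \bar R) -> (forall x, 0 <= G x)%E ->
     (b%:E * \int[leb]_x G (psi x) = \int[leb]_x G x)%E) ->
  measurable_fun [set: T * T] (F : T * T -> \bar R) -> (forall z, 0 <= F z)%E ->
  ((a * b)%:E * \int[leb \x leb]_z F (phi z.1, psi z.2) = \int[leb \x leb]_z F z)%E.
Proof.
move=> a0 b0 mphi mpsi Hphi Hpsi mF F0.
have mP : measurable_fun setT ((fun z => (phi z.1, psi z.2)) : T * T -> T * T).
  by apply: measurable_fun_pair; apply: measurableT_comp.
have mFP := measurableT_comp mF mP.
rewrite (fubini_tonelli1 _ mF F0) (fubini_tonelli1 _ mFP) /fubini_F /=; last by move=> z; exact: F0.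
have mG : measurable_fun [set: T] (fun x : T => \int[leb]_y F (x, y))%E.
  exact: (measurable_fun_fubini_tonelli_F _ mF F0).
rewrite -(Hphi (fun x => \int[leb]_y F (x, y))%E)//; last by move=> x; exact: integral_ge0.
rewrite EFinM -muleA; congr (_ * _)%E.
rewrite -ge0_integralZl//; last 2 first.
- exact: (measurable_fun_fubini_tonelli_F _ mFP (fun z => F0 _)).
- by move=> x _; exact: integral_ge0.
apply: eq_integral => x _; apply: (Hpsi (fun y => F (phi x, y))) => //.
exact: (measurable_fun_pair2 (phi x) mF).
Qed.

End LebesguePlane.

(* The library has the sigma-finite instance of a product only for probabilities. *)
Section PlaneMeasure.
Context (R : realType).
Local Notation T := (measurableTypeR R).
Local Notation leb := (@lebesgue_measure R).

Definition plane_measure : set (T * T) -> \bar R := (leb \x leb)%E.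

HB.instance Definition _ := Measure.on plane_measure.

Lemma plane_measure_sigma_finite : sigma_finite setT plane_measure.
Proof.
have H (n : nat) : - n%:R <= n%:R :> R by rewrite (@le_trans _ _ 0)// oppr_le0.
exists (fun n : nat => `[- n%:R, n%:R]%classic `*` `[- n%:R, n%:R]%classic).
  apply/seteqP; split=> // -[x y] _.
  exists (Num.bound (Num.max `|x| `|y|)) => //.
  have b : Num.max `|x| `|y| <= (Num.bound (Num.max `|x| `|y|))%:R.
    by rewrite ltW// archi_boundP// le_max normr_ge0.
  split; rewrite /= in_itv/= -ler_norml; apply: le_trans b; by rewrite le_max lexx ?orbT.
move=> n; split; first by apply: measurableX; exact: measurable_itv.
rewrite /plane_measure product_measure1E; [|exact: measurable_itv..].
rewrite [ltLHS](_ : _ = ((n%:R - - n%:R) * (n%:R - - n%:R))%:E) ?ltry//.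
by rewrite EFinM; congr (_ * _)%E; exact: lebesgue_itvcc.
Qed.

HB.instance Definition _ := Measure_isSigmaFinite.Build _ _ _ plane_measure
  plane_measure_sigma_finite.

End PlaneMeasure.

(** * The line and the plane as Lebesgue models *)

Section Models.
Context {R : realType}.
Local Notation T := (measurableTypeR R).
Local Notation leb := (@lebesgue_measure R).

Lemma row_continuous n (f : 'rV[R]_n -> R) : continuous f -> forall (v : 'rV[R]_n) (e : R), 0 < e ->
  exists2 r, 0 < r & forall w : 'rV[R]_n, (forall j, `|v ord0 j - w ord0 j| < r) -> `|f v - f w| < e.
Proof.
move=> cf v e e0; have /nbhs_ballP[r r0 H] := cf v _ (nbhsx_ballx (f v) e e0).
exists r => // w vw; apply: H; split=> // i j; rewrite (ord1 i); exact: vw.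
Qed.

Local Notation plane_measure := (@plane_measure R).

Definition io1 (x : T) : 'rV[R]_1 := \row_(i < 1) x.
Definition oi1 (v : 'rV[R]_1) : T := v ord0 ord0.
Definition io2 (z : T * T) : 'rV[R]_2 := \row_(i < 2) if i == 0%N :> nat then z.1 else z.2.
Definition oi2 (v : 'rV[R]_2) : T * T := (v ord0 ord0, v ord0 ord_max).

Lemma row1_eq (u v : 'rV[R]_1) : u ord0 ord0 = v ord0 ord0 -> u = v.
Proof. by move=> uv; apply/rowP => i; rewrite (ord1 i). Qed.

Lemma row2_eq (u v : 'rV[R]_2) : u ord0 ord0 = v ord0 ord0 ->
  u ord0 ord_max = v ord0 ord_max -> u = v.
Proof.
move=> u0 u1; apply/rowP => i; have [->//|i0] := eqVneq i ord0.
by rewrite (_ : i = ord_max)//; apply/val_inj; case: i i0 => -[|[]].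
Qed.

Lemma enorm_io1 x : enorm (io1 x) = `|x|.
Proof. by rewrite /enorm big_ord1 mxE sqrtr_sqr. Qed.

Lemma enorm_io2 z : enorm (io2 z) = Num.sqrt (z.1 ^+ 2 + z.2 ^+ 2).
Proof. by rewrite /enorm big_ord_recl big_ord1 !mxE. Qed.

Lemma line_model : lebesgue_model leb io1 oi1.
Proof.
split.
- by [].
- by move=> v; apply: row1_eq; rewrite mxE.
- rewrite (_ : (fun _ => _) = fun z : T * T => z.1 - z.2).
    exact: measurable_sub.
  by apply/funext => z; rewrite /oi1 !mxE.
- move=> F a mF F0; rewrite -[RHS](integral_refl (a ord0 ord0))//=.
  by apply: eq_integral => x _; congr F; apply: row1_eq; rewrite !mxE.
- move=> F n mF F0; rewrite mul1n.
  rewrite -[RHS](integral_affine 0 (exprn_gt0 n (ltr0Sn _ 1)) mF)//=.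
  by congr (_ * _)%E; apply: eq_integral => x _; congr F; apply: row1_eq; rewrite !mxE add0r.
- move=> f cf; apply: continuous_measurable_fun => x; apply/cvgrPdist_lt => e e0.
  have [r r0 H] := row_continuous cf (io1 x) e0.
  by apply/nbhs_ballP; exists r => //= y xy; apply: H => i; rewrite !mxE; exact: xy.
- move=> r r0; have -> : [set x : T | enorm (io1 x) <= r] = (`[- r, r]%classic : set T).
    by apply/seteqP; split=> x; rewrite /= enorm_io1 in_itv/= ler_norml.
  rewrite [leLHS](_ : _ = (r - - r)%:E); first by rewrite lee_fin expr1 opprK mulr_natl.
  by apply: lebesgue_itvcc; rewrite (le_trans _ r0)// oppr_le0.
Qed.

Lemma plane_cont (f : 'rV[R]_2 -> R) : continuous f -> measurable_fun [set: T * T] (f \o io2).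
Proof.
move=> cf; apply: (@measurable_open_ray _ (fun x y => f (io2 (x, y)))) => r x y rf.
have fr0 : 0 < f (io2 (x, y)) - r by rewrite subr_gt0.
have [e e0 H] := row_continuous cf (io2 (x, y)) fr0.
exists e => // u v xu yv; have : `|f (io2 (x, y)) - f (io2 (u, v))| < f (io2 (x, y)) - r.
  by apply: H => j; rewrite !mxE; case: ifP.
by rewrite ltr_distl => /andP[]; lra.
Qed.

Lemma plane_model : lebesgue_model plane_measure io2 oi2.
Proof.
split.
- by [].
- by move=> v; apply: row2_eq; rewrite mxE.
- rewrite (_ : (fun _ => _) =
      fun z : (T * T) * (T * T) => (z.1.1 - z.2.1, z.1.2 - z.2.2)); last first.
    by apply/funext => z; rewrite /oi2 !mxE.
  by apply: measurable_fun_pair; apply: measurable_funB; apply: measurableT_comp.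
- move=> F a mF F0.
  pose G (z : R * R) := F (io2 z).
  have := @integral_plane R G (fun x => a ord0 ord0 - x) (fun x => a ord0 ord_max - x) 1 1.
  rewrite mulr1 mul1e => H; apply: (etrans _ (H _ _ _ _ _ _ mF _)) => //.
  + by apply: eq_integral => z _; congr F; apply: row2_eq; rewrite !mxE.
  + exact: measurable_funB.
  + exact: measurable_funB.
  + by move=> h mh h0; rewrite mul1e integral_refl.
  + by move=> h mh h0; rewrite mul1e integral_refl.
  + by move=> z; exact: F0.
- move=> F n mF F0; pose G (z : R * R) := F (io2 z).
  have p0 : 0 < 2 ^+ n :> R by rewrite exprn_gt0.
  have := @integral_plane R G (fun x => 2 ^+ n * x) (fun x => 2 ^+ n * x) (2 ^+ n) (2 ^+ n).
  have scale (h : R -> \bar R) : measurable_fun [set: T] (h : T -> \bar R) -> (forall x, 0 <= h x)%E ->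
      ((2 ^+ n)%:E * \int[leb]_x h (2 ^+ n * x)%R = \int[leb]_x h x)%E.
    move=> mh h0; rewrite -[RHS](integral_affine 0 p0 mh)//.
    by congr (_ * _)%E; apply: eq_integral => x _; rewrite add0r.
  move=> H; apply: (etrans _ (H (ltW p0) (ltW p0) _ _ scale scale mF _)) => //.
  + rewrite mul2n -addnn exprD; congr (_ * _)%E; apply: eq_integral => z _.
    by congr F; apply: row2_eq; rewrite !mxE.
  + exact: measurable_funM.
  + exact: measurable_funM.
  + by move=> z; exact: F0.
- exact: plane_cont.
- move=> r r0.
  have mB : measurable ([set x | enorm (io2 x) <= r] : set (T * T)).
    rewrite (_ : [set _ | _] = (enorm \o io2) @^-1` `]-oo, r]); last first.
      by apply/seteqP; split=> z; rewrite /= in_itv.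
    rewrite -[X in measurable X]setTI.
    exact: (plane_cont (@enorm_continuous R 2) measurableT (measurable_itv _)).
  apply: (@le_trans _ _ (plane_measure (`[- r, r]%classic `*` `[- r, r]%classic))).
    apply: le_measure; rewrite ?inE//.
      by apply: measurableX; exact: measurable_itv.
    move=> z /= zr; split; rewrite /= in_itv/= -ler_norml (le_trans _ zr)//.
      by have := coord_le_enorm (io2 z) ord0; rewrite mxE.
    by have := coord_le_enorm (io2 z) ord_max; rewrite mxE.
  rewrite /plane_measure product_measure1E; [|exact: measurable_itv..].
  rewrite [leLHS](_ : _ = ((r - - r) * (r - - r))%:E).
    by rewrite lee_fin opprK le_eqVlt; apply/orP; left; apply/eqP; ring.
  have rr : - r <= r by rewrite (le_trans _ r0)// oppr_le0.
  by rewrite EFinM; congr (_ * _)%E; exact: lebesgue_itvcc.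
Qed.

End Models.

(** * The wave kernel *)

Section InverseSqrt.
Context {R : realType}.
Local Notation T := (measurableTypeR R).
Local Notation leb := (@lebesgue_measure R).
Implicit Types (a b c x y : R).

(** Zero for y <= 0, since [Num.sqrt] vanishes there and the inverse of 0 is 0. *)
Definition isqrt y : R := (Num.sqrt y)^-1.

Lemma isqrt_ge0 y : 0 <= isqrt y. Proof. by rewrite invr_ge0 sqrtr_ge0. Qed.

Lemma isqrtE y : isqrt y = if 0 < y then y `^ (- 2^-1) else 0.
Proof.
rewrite /isqrt; case: ltP => y0; first by rewrite powRN powR12_sqrt// ltW.
by rewrite ler0_sqrtr// invr0.
Qed.

Lemma isqrt_le x y : 0 < x -> x <= y -> isqrt y <= isqrt x.
Proof.
move=> x0 xy; have y0 := lt_le_trans x0 xy.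
by rewrite /isqrt lef_pV2 ?posrE ?sqrtr_gt0// ler_wsqrtr.
Qed.

Lemma isqrtM x y : 0 <= x -> isqrt (x * y) = isqrt x * isqrt y.
Proof. by move=> x0; rewrite /isqrt sqrtrM// invfM. Qed.

Lemma measurable_isqrt : measurable_fun [set: T] (isqrt : T -> T).
Proof.
rewrite (_ : isqrt = fun y => if 0 < y then y `^ (- 2^-1) else 0); last first.
  by apply/funext => y; exact: isqrtE.
by apply: measurable_fun_ifT => //; exact: measurable_fun_ltr.
Qed.

Definition sing c y : R := if 0 < y <= c then isqrt y else 0.

Lemma sing_ge0 c y : 0 <= sing c y.
Proof. by rewrite /sing; case: ifP => // _; exact: isqrt_ge0. Qed.

Lemma measurable_sing c : measurable_fun [set: T] (sing c : T -> T).
Proof.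
apply: measurable_fun_ifT => //; last exact: measurable_isqrt.
by apply: measurable_and; [exact: measurable_fun_ltr|exact: measurable_fun_ler].
Qed.

Lemma integral_isqrt a c : 0 < a -> a < c ->
  (\int[leb]_(y in `[a, c]) (isqrt y)%:E = (2 * Num.sqrt c - 2 * Num.sqrt a)%:E)%E.
Proof.
move=> a0 ac; have c2 x : {for x, continuous (fun y : R => 2 * Num.sqrt y)}.
  by apply: cvgM; [exact: cvg_cst|exact: sqrt_continuous].
rewrite (@continuous_FTC2 _ isqrt (fun y => 2 * Num.sqrt y))// ?EFinB//.
- apply: continuous_in_subspaceT => x; rewrite inE/= in_itv/= => /andP[ax _].
  apply: continuousV; last exact: sqrt_continuous.
  by rewrite gt_eqF// sqrtr_gt0 (lt_le_trans a0).
- split.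
  + move=> x; rewrite in_itv/= => /andP[ax _].
    have x0 := lt_trans a0 ax; have := is_derive1_sqrt x0 => ?.
    exact: ex_derive.
  + exact: cvg_at_right_filter (c2 a).
  + exact: cvg_at_left_filter (c2 c).
- move=> x; rewrite in_itv/= => /andP[ax _].
  have x0 := lt_trans a0 ax; have := is_derive1_sqrt x0 => ?.
  rewrite derive1E derive_val /isqrt.
  by rewrite /GRing.scale/= invfM mulrA mulfV ?mul1r// pnatr_eq0.
Qed.

(** Monotone convergence along intervals that avoid the singularity at 0, with the primitive 2
    sqrt(y) on each of them. *)
Lemma integral_sing c : 0 <= c -> (\int[leb]_y (sing c y)%:E <= (2 * Num.sqrt c)%:E)%E.
Proof.
rewrite le_eqVlt => /predU1P[<-|c0].
  rewrite integral0_eq ?lee_fin ?mulr_ge0// => y _.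
  by rewrite /sing; case: ifP => // /andP[/lt_le_trans h /h]; rewrite ltxx.
(* The shift by 2 keeps the left endpoint strictly below c already for i = 0. *)
pose F (i : nat) : set T := `[c / i.+2%:R, c]%classic.
have cn (i : nat) : 0 < c / i.+2%:R by rewrite divr_gt0.
have mF i : measurable (F i) by exact: measurable_itv.
have mi : measurable_fun [set: T] (fun y => (isqrt y)%:E : \bar R).
  by apply/measurable_EFinP; exact: measurable_isqrt.
have nF : nondecreasing_seq F.
  apply/nondecreasing_seqP => n; apply/subsetPset => y; rewrite /F /= !in_itv/=.
  move=> /andP[ny ->]; rewrite andbT (le_trans _ ny)// ler_wpM2l ?(ltW c0)//.
  by rewrite lef_pV2 ?posrE// ler_nat.
have UF : \bigcup_i F i = [set y | 0 < y <= c].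
  apply/seteqP; split=> y /=.
    by move=> [i _]; rewrite /F/= in_itv/= => /andP[/(lt_le_trans (cn i)) -> ->].
  move=> /andP[y0 yc]; exists (Num.bound (c / y)) => //; rewrite /F/= in_itv/= yc andbT.
  rewrite ler_pdivrMr// mulrC -ler_pdivrMr//.
  rewrite (le_trans (ltW (archi_boundP _)))//; first by rewrite divr_ge0// ltW.
  by rewrite ler_nat; do 2 apply: leqW.
have cv := @ge0_nondecreasing_set_cvg_integral _ _ _ F (fun y : T => (isqrt y)%:E) leb nF mF
  (fun i => measurable_funTS mi) (fun i x _ => isqrt_ge0 x).
have -> : (\int[leb]_y (sing c y)%:E = \int[leb]_(y in \bigcup_i F i) (isqrt y)%:E)%E.
  rewrite [RHS]integral_mkcond; apply: eq_integral => y _.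
  rewrite patchE /sing; case: ifPn => yc; first by rewrite mem_set// UF.
  by rewrite memNset// UF; apply/negP.
rewrite -(cvg_lim _ cv)//; apply: lime_le; first by apply/cvg_ex; eexists; exact: cv.
apply: nearW => i; rewrite integral_isqrt// ?lee_fin.
  by rewrite lerBlDr lerDl mulr_ge0 ?sqrtr_ge0.
by rewrite ltr_pdivrMr// ltr_pMr// ltr1n.
Qed.

(* a^2 - y^2 >= a (a - |y|) reduces to the integral of an inverse square root. *)
Lemma integral_ring a b : 0 <= b -> b <= a -> 0 < a ->
  (\int[leb]_y (if (b <= `|y|) && (`|y| < a) then isqrt (a ^+ 2 - y ^+ 2) else 0)%:E <=
   (4 * Num.sqrt (a ^+ 2 - b ^+ 2) / a)%:E)%E.
Proof.
move=> b0 ba a0; pose c := a - b; have c0 : 0 <= c by rewrite subr_ge0.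
have H1 : (\int[leb]_y (sing c (a - y))%:E <= (2 * Num.sqrt c)%:E)%E.
  rewrite (integral_refl a (F := fun y => (sing c y)%:E))//; first exact: integral_sing.
    by apply/measurable_EFinP; exact: measurable_sing.
  by move=> y; rewrite lee_fin sing_ge0.
have H2 : (\int[leb]_y (sing c (a + 1 * y))%:E <= (2 * Num.sqrt c)%:E)%E.
  have := @integral_affine _ a 1 (fun y => (sing c y)%:E) ltr01; rewrite mul1e => ->.
  - exact: integral_sing.
  - by apply/measurable_EFinP; exact: measurable_sing.
  - by move=> y; rewrite lee_fin sing_ge0.
have m1 : measurable_fun [set: T] ((fun y => sing c (a - y)) : T -> T).
  by apply: (measurableT_comp (measurable_sing c)); exact: measurable_funB.
have m2 : measurable_fun [set: T] ((fun y => sing c (a + 1 * y)) : T -> T).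
  exact: (measurableT_comp (measurable_sing c) (measurable_affine a 1)).
apply: (@le_trans _ _ (\int[leb]_y (isqrt a * (sing c (a - y) + sing c (a + 1 * y)))%:E)%E).
  apply: ge0_le_integral => //.
  - by move=> y _; case: ifP => _ //; rewrite lee_fin isqrt_ge0.
  - apply/measurable_EFinP; apply: measurable_fun_ifT => //.
      apply: measurable_and; first exact: measurable_fun_ler.
      exact: measurable_fun_ltr.
    apply: (measurableT_comp measurable_isqrt); apply: measurable_funB; first exact: measurable_cst.
    exact: exprn_measurable.
  - by apply/measurable_EFinP; apply: measurable_funM => //; exact: measurable_funD.
  move=> y _; rewrite lee_fin mul1r; case: ifP => [/andP[by_ ya]|_]; last first.
    by rewrite mulr_ge0 ?isqrt_ge0// addr_ge0 ?sing_ge0.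
  (* Used with z = y or z = - y according to the sign; the sum of the two singular functions then
     bounds both cases. *)
  have half z : z = `|y| -> isqrt (a ^+ 2 - y ^+ 2) <= isqrt a * sing c (a - z).
    move=> zy; rewrite /sing ifT; last first.
      by rewrite subr_gt0 zy ya/= /c lerD2l lerN2.
    rewrite -(@isqrtM a (a - z) (ltW a0)); apply: isqrt_le; first by rewrite mulr_gt0// subr_gt0 zy.
    rewrite -[y ^+ 2]real_normK ?num_real// -zy subr_sqr mulrC ler_wpM2l//.
      by rewrite subr_ge0 zy ltW.
    by rewrite lerDl zy.
  have [y0|y0] := leP 0 y.
    rewrite (le_trans (half y _)) ?ger0_norm//.
    by rewrite ler_wpM2l ?isqrt_ge0// lerDl sing_ge0.
  rewrite (le_trans (half (- y) _)) ?ltr0_norm// opprK.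
  by rewrite ler_wpM2l ?isqrt_ge0// lerDr sing_ge0.
under eq_integral do rewrite EFinM EFinD.
rewrite ge0_integralZl//; last 3 first.
- by apply: emeasurable_funD; apply/measurable_EFinP.
- by move=> y _; rewrite adde_ge0// lee_fin sing_ge0.
- by rewrite lee_fin isqrt_ge0.
rewrite ge0_integralD//; last 4 first.
- by move=> y _; rewrite lee_fin sing_ge0.
- by apply/measurable_EFinP.
- by move=> y _; rewrite lee_fin sing_ge0.
- by apply/measurable_EFinP.
apply: (@le_trans _ _ ((isqrt a)%:E * ((2 * Num.sqrt c)%:E + (2 * Num.sqrt c)%:E))%E).
  by apply: lee_wpmul2l; [rewrite lee_fin isqrt_ge0|exact: leeD].
rewrite -EFinD -EFinM lee_fin.
(* Squared, this is c a <= (a - b)(a + b), with c = a - b. *)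
have E : Num.sqrt c <= Num.sqrt (a ^+ 2 - b ^+ 2) * isqrt a.
  rewrite /isqrt -(ler_pM2r (x := Num.sqrt a)) ?sqrtr_gt0// -mulrA mulVf ?mulr1; last first.
    by rewrite gt_eqF// sqrtr_gt0.
  rewrite -sqrtrM// ler_wsqrtr// /c subr_sqr ler_wpM2l//.
  by rewrite lerDl.
have aa : isqrt a * isqrt a = a^-1 by rewrite -invfM -expr2 sqr_sqrtr// ltW.
rewrite -aa; have := isqrt_ge0 a; move: E; nra.
Qed.

End InverseSqrt.

(** * L^1 increments in time and space of a family of kernels *)

Section KernelFamily.
Context {R : realType} {d : nat} {dT} {T : measurableType dT}.
Context {m : {sigma_finite_measure set T -> \bar R}}.
Context {io : T -> 'rV[R]_d} {oi : 'rV[R]_d -> T}.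
Local Notation E := 'rV[R]_d.
Hypothesis M : lebesgue_model m io oi.

Local Notation mfun f := (measurable_fun [set: T] (f \o io)).
Local Notation L1 f := (m.-integrable [set: T] (EFin \o (f \o io))).
Local Notation I f := (Rintegral m setT (f \o io)).
Local Notation norm1 f := (Rintegral m setT (Num.norm \o (f \o io))).

Variables (G : R -> E -> R) (rho A : R).
Hypotheses (rho0 : 0 < rho) (A0 : 0 < A).
Hypothesis G_mfun : forall t, mfun (G t).
Hypothesis G_ge0 : forall t x, 0 <= G t x.
Hypothesis G_out : forall t x, t <= enorm x -> G t x = 0.
Hypothesis G_anti : forall s t x, s <= t -> enorm x < s -> G t x <= G s x.

(** The part of [G t] not covered by the ball of radius s, where the monotonicity [G_anti] says
    nothing. *)
Definition outer s t (x : E) := if s <= enorm x then G t x else 0.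

Hypothesis G_annulus : forall s t, 0 <= s -> s <= t -> t <= 2 ->
  (\int[m]_x (outer s t (io x))%:E <= (A * (t - s) `^ rho)%:E)%E.
Hypothesis G_mass : forall s t, 0 <= s -> s <= t ->
  (\int[m]_x (G s (io x))%:E <= \int[m]_x (G t (io x))%:E)%E.
(** Turns a translation into a time increment: on the smaller ball, G_t(x) - G_t(x - y) <= G_t(x) -
    G_t'(x), and the right-hand side is controlled in L^1 by [norm1_diff]. *)
Hypothesis G_shift : forall t r, 0 <= t -> 0 <= r -> exists2 t', t <= t' <= t + r &
  forall x y, enorm y = r -> enorm x < t - r -> G t' x <= G t (x - y).

Lemma norm1_translate f y : L1 f -> norm1 (fun x => f (x - y)) = norm1 f.
Proof. by move=> fi; exact: (I_trans M y (L1_norm fi)). Qed.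

Lemma outer_ge0 s t x : 0 <= outer s t x.
Proof. by rewrite /outer; case: ifP. Qed.

Lemma outer_mfun s t : mfun (outer s t).
Proof.
apply: measurable_fun_ifT => //; last exact: G_mfun.
apply: measurable_fun_ler => //; exact: (model_cont M (@enorm_continuous R d)).
Qed.

Lemma outer_L1 s t : 0 <= s -> s <= t -> t <= 2 -> L1 (outer s t).
Proof.
move=> s0 st t2; apply/L1P; split; first exact: outer_mfun.
rewrite (le_lt_trans _ (ltry (A * (t - s) `^ rho)))//.
rewrite (le_trans _ (G_annulus s0 st t2))// le_eqVlt; apply/orP; left; apply/eqP.
by apply: eq_integral => x _; rewrite ger0_norm// outer_ge0.
Qed.

Lemma I_outer s t : 0 <= s -> s <= t -> t <= 2 -> I (outer s t) <= A * (t - s) `^ rho.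
Proof.
move=> s0 st t2; have Hi := outer_L1 s0 st t2.
rewrite -lee_fin (le_trans _ (G_annulus s0 st t2))//.
have -> : I (outer s t) = norm1 (outer s t).
  by apply: eq_Rintegral => x _ /=; rewrite ger0_norm// outer_ge0.
rewrite -(norm1E Hi) le_eqVlt; apply/orP; left; apply/eqP.
by apply: eq_integral => x _; rewrite ger0_norm// outer_ge0.
Qed.

Lemma outer0 t : outer 0 t = G t.
Proof. by apply/funext => x; rewrite /outer enorm_ge0. Qed.

Lemma G_L1 t : 0 <= t -> t <= 2 -> L1 (G t).
Proof. by move=> t0 t2; rewrite -outer0; exact: outer_L1. Qed.

Lemma norm1_G t : 0 <= t -> t <= 2 -> norm1 (G t) <= A * t `^ rho.
Proof.
move=> t0 t2; rewrite -[t in X in _ <= X]subr0 (le_trans _ (I_outer (lexx 0) t0 t2))//.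
rewrite outer0 le_eqVlt; apply/orP; left; apply/eqP.
by apply: eq_Rintegral => x _ /=; rewrite ger0_norm.
Qed.

Lemma I_mass s t : 0 <= s -> s <= t -> t <= 2 -> I (G s) <= I (G t).
Proof.
move=> s0 st t2; apply: fine_le; last exact: G_mass.
- exact: (integrable_fin_num measurableT (G_L1 s0 (le_trans st t2))).
- exact: (integrable_fin_num measurableT (G_L1 (le_trans s0 st) t2)).
Qed.

(* |G_t - G_s| = (G_s - G_t) + 2 G_t 1_(|x| >= s) pointwise. *)
Lemma norm1_diff s t : 0 <= s -> s <= t -> t <= 2 ->
  norm1 (fun x => G t x - G s x) <= 2 * (A * (t - s) `^ rho).
Proof.
move=> s0 st t2; have t0 := le_trans s0 st; have s2 := le_trans st t2.
have Gt := G_L1 t0 t2; have Gs := G_L1 s0 s2; have Oi := outer_L1 s0 st t2.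
have -> : norm1 (fun x => G t x - G s x) = I (fun x => (G s x - G t x) + 2 * outer s t x).
  apply: eq_Rintegral => x _ /=; rewrite /outer; case: leP => sx.
    by rewrite (G_out sx) subr0 ger0_norm//; lra.
  by rewrite mulr0 addr0 distrC ger0_norm// subr_ge0 G_anti.
rewrite (ID (L1B Gs Gt) (L1Z 2 Oi)) (IB Gs Gt) (IZ 2 Oi).
have := I_mass s0 st t2; have := I_outer s0 st t2; lra.
Qed.

(* The increment u has integral 0, so its L^1 norm is at most 2 int w as soon as - u <= w. *)
Lemma norm1_shift t y : 0 <= t -> t <= 1 ->
  norm1 (fun x => G t (x - y) - G t x) <= 6 * A * enorm y `^ rho.
Proof.
move=> t0 t1; have t2 : t <= 2 by lra.
set r := enorm y; have r0 : 0 <= r := enorm_ge0 y.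
have Gt := G_L1 t0 t2; have Gty := L1_trans M y Gt.
have rho_ge0 := ltW rho0; have A_ge0 := ltW A0.
(* For r > 1 >= t the trivial bound by twice the norm of [G t] is already of order r^rho. *)
have [r1|r1] := ltP 1 r.
  have n1 : norm1 (fun x => G t (x - y) - G t x) <= norm1 (G t) + norm1 (G t).
    rewrite -{1}(norm1_translate y Gt).
    have := norm1B_le Gty Gt.
    by apply: le_trans.
  have tr : t `^ rho <= r `^ rho.
    by rewrite ge0_ler_powR ?nnegrE// (le_trans t1)// ltW.
  have := norm1_G t0 t2; move: n1 tr; have := powR_ge0 r rho.
  move: (norm1 _) (norm1 (G t)) (t `^ rho) (r `^ rho) => a b e f; nra.
have [t' /andP[tt' t'r] Ht'] := G_shift t0 r0.
have t'2 : t' <= 2 by lra.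
(* [G_shift] applies in the ball of radius t - r; its complement is an annulus of width at most r.
   If t < r the ball is empty and the whole kernel counts as annulus. *)
pose s := Num.max (t - r) 0.
have s0 : 0 <= s by rewrite le_max lexx orbT.
have st : s <= t by rewrite ge_max t0 andbT lerBlDr lerDl.
have tsr : t - s <= r by rewrite lerBlDr -lerBlDl le_max lexx.
have Gt' := G_L1 (le_trans t0 tt') t'2; have Oi := outer_L1 s0 st t2.
pose w x := outer s t x + `|G t' x - G t x|.
have wi : L1 w by apply: L1D => //; exact: (L1_norm (L1B Gt' Gt)).
have w0 x : 0 <= w x by rewrite addr_ge0 ?outer_ge0.
pose u x := G t (x - y) - G t x.
have ui : L1 u by exact: L1B.
have uw x : - u x <= w x.
  rewrite /u /w opprB /outer; case: (leP s (enorm x)) => sx.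
    by rewrite (le_trans (y := G t x))// ?lerDl// gerBl.
  have xr : enorm x < t - r.
    by move: sx; rewrite lt_max => /orP[//|]; rewrite ltNge enorm_ge0.
  rewrite add0r distrC (le_trans _ (ler_norm _))// lerB//.
  exact: Ht'.
(* |u| <= u + 2 w in both sign cases. The annulus contributes A r^rho to the integral of w and the
   time increment 2 A r^rho, whence the constant 6 A. *)
have := le_I (L1_norm ui) (L1D ui (L1Z 2 wi)); rewrite (ID ui (L1Z 2 wi)) (IZ 2 wi).
have -> : I u = 0 by rewrite (IB Gty Gt) (I_trans M y Gt) subrr.
rewrite (ID Oi (L1_norm (L1B Gt' Gt))) add0r => /(_ _)/le_trans-> //.
  move=> x; have := uw x; have := w0 x; case: (ger0P (u x)); lra.
have p1 : (t - s) `^ rho <= r `^ rho by rewrite ge0_ler_powR ?nnegrE ?subr_ge0.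
have p2 : (t' - t) `^ rho <= r `^ rho by rewrite ge0_ler_powR ?nnegrE ?subr_ge0// lerBlDl.
have q1 := I_outer s0 st t2; have q2 := norm1_diff t0 tt' t'2.
have -> : I (fun x => `|G t' x - G t x|) = norm1 (fun x => G t' x - G t x) by [].
move: q1 q2 p1 p2; set a1 := _ `^ rho; set a2 := (t' - t) `^ rho; set a3 := r `^ rho.
move: (norm1 _) (I _) => b1 b2; nra.
Qed.

Lemma powR_interp (kappa a b : R) : 0 <= kappa <= rho -> 0 < a -> 0 <= b ->
  Num.min (a `^ rho) (b `^ rho) <= a `^ (rho - kappa) * b `^ kappa.
Proof.
move=> /andP[k0 kr] a0 b0; rewrite ge_min.
have split_ (z : R) : 0 < z -> z `^ rho = z `^ (rho - kappa) * z `^ kappa.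
  by move=> z0; rewrite -powRD ?subrK// (gt_eqF z0) implybT.
have [ab|ba] := leP a b.
  apply/orP; left; rewrite split_// ler_wpM2l ?powR_ge0// ge0_ler_powR ?nnegrE//.
  exact: ltW.
(* Splitting a power into two requires a positive base, so b = 0 is treated apart, where b^rho = 0
   as rho > 0. *)
apply/orP; right; move: b0; rewrite le_eqVlt => /predU1P[<-|b0].
  by rewrite powR0 ?gt_eqF// mulr_ge0 ?powR_ge0.
by rewrite split_// ler_wpM2r ?powR_ge0// ge0_ler_powR ?nnegrE ?subr_ge0// ltW.
Qed.

(** The modulus of [K] at y is bounded by 2 |K|_1 <= 4 A (t - s)^rho and by two spatial increments,
    12 A |y|^rho; 12 A covers both, and [powR_interp] interpolates. *)
Lemma kernel_increment (kappa s t : R) : 0 <= kappa <= rho ->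
  0 <= s -> s < t -> t <= 1 ->
  let K x := G t x - G s x in let H := 12 * A * (t - s) `^ (rho - kappa) in
  [/\ L1 K, vanish_outside 1 K, norm1 K <= H &
      forall y, norm1 (fun x => K (x - y) - K x) <= H * enorm y `^ kappa].
Proof.
move=> kr s0 st t1 K H; have t0 := le_trans s0 (ltW st); have t2 : t <= 2 by lra.
have s2 : s <= 2 by lra.
have [s1 dt0] : s <= 1 /\ 0 < t - s by split; lra.
have Gt := G_L1 t0 t2; have Gs := G_L1 s0 s2; have Ki : L1 K := L1B Gt Gs.
have nK : norm1 K <= 2 * (A * (t - s) `^ rho) := norm1_diff s0 (ltW st) t2.
have A_ge0 := ltW A0; have kr' := kr; case/andP: kr' => k0 k1.
split => //.
- by move=> x x1; rewrite /K !G_out ?subrr//; lra.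
(* Here t - s <= 1, so lowering the exponent increases the power. *)
- have h : (t - s) `^ rho <= (t - s) `^ (rho - kappa).
    by rewrite ger_powR//; [rewrite dt0; lra|lra].
  rewrite (le_trans nK)// /H; have := powR_ge0 (t - s) (rho - kappa).
  move: h; move: (_ `^ rho) (_ `^ (rho - kappa)) => a b; nra.
move=> y; have := powR_interp kr dt0 (enorm_ge0 y).
have Ky := L1_trans M y Ki.
have n1 : norm1 (fun x => K (x - y) - K x) <= 2 * norm1 K.
  rewrite (le_trans (norm1B_le Ky Ki))// mulr2n mulrDl !mul1r.
  by rewrite lerD2r (norm1_translate y Ki).
have n2 : norm1 (fun x => K (x - y) - K x) <= 12 * A * enorm y `^ rho.
  have -> : norm1 (fun x => K (x - y) - K x) =
      norm1 ((fun x => G t (x - y) - G t x) - (fun x => G s (x - y) - G s x)).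
    by apply: eq_Rintegral => x _ /=; rewrite !fctE /K; congr `|_|; ring.
  have Dt := L1B (L1_trans M y Gt) Gt; have Ds := L1B (L1_trans M y Gs) Gs.
  rewrite (le_trans (norm1B_le Dt Ds))//.
  have := norm1_shift y t0 t1; have := norm1_shift y s0 s1.
  by move: (norm1 _) (norm1 _) => a b; lra.
rewrite /H -mulrA ge_min => /orP[h|h].
  rewrite (le_trans n1)//; move: nK h; set P := _ * enorm y `^ kappa.
  have P0 : 0 <= P by rewrite mulr_ge0 ?powR_ge0.
  move: (norm1 K) (_ `^ rho) => a b; nra.
rewrite (le_trans n2)// -mulrA -[leRHS]mulrA.
by rewrite ler_wpM2l// ler_wpM2l// ltW.
Qed.

End KernelFamily.

(** * Pointwise properties of the wave kernel *)

Section WaveKernel.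
Context {R : realType} {d : nat}.
Local Notation E := 'rV[R]_d.
Implicit Types (s t r : R) (x y : E).
Local Notation G := (@wave_kernel R d).

Let c : R := (2 * pi)^-1.

Let c0 : 0 < c. Proof. by rewrite invr_gt0 mulr_gt0// pi_gt0. Qed.

Lemma wave_kernelE t x : G t x =
  if enorm x < t then if d == 1%N then 2^-1 else c * isqrt (t ^+ 2 - enorm x ^+ 2) else 0.
Proof. by []. Qed.

Lemma wave_kernel_ge0 t x : 0 <= G t x.
Proof.
rewrite wave_kernelE; case: ifP => // _; case: ifP => _ //.
by rewrite mulr_ge0 ?isqrt_ge0// ltW.
Qed.

Lemma wave_kernel_out t x : t <= enorm x -> G t x = 0.
Proof. by rewrite wave_kernelE leNgt => /negbTE ->. Qed.

Lemma wave_kernel_anti s t x : s <= t -> enorm x < s -> G t x <= G s x.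
Proof.
move=> st xs; rewrite !wave_kernelE xs (lt_le_trans xs st); case: ifP => // _.
rewrite ler_wpM2l ?(ltW c0)//; have := enorm_ge0 x => x0.
apply: isqrt_le; first by rewrite subr_sqr mulr_gt0 ?subr_gt0// ltr_wpDr// (le_lt_trans x0).
by rewrite lerD2r ler_sqr ?nnegrE; lra.
Qed.

(* |x - y|^2 >= |x|^2 - 2 t |y| in the ball of radius t. *)
Lemma wave_kernel_shift t r : 0 <= t -> 0 <= r -> exists2 t', t <= t' <= t + r &
  forall x y, enorm y = r -> enorm x < t - r -> G t' x <= G t (x - y).
Proof.
move=> t0 r0; have tr0 : 0 <= t * r by rewrite mulr_ge0.
have q0 : 0 <= t ^+ 2 + 2 * (t * r) by rewrite addr_ge0 ?sqr_ge0// mulr_ge0.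
(* Chosen so that t^2 - |x - y|^2 <= t'^2 - |x|^2 in the ball; t' <= t + r since (t + r)^2 has the
   extra term r^2. *)
exists (Num.sqrt (t ^+ 2 + 2 * (t * r))).
  rewrite -{1}(ger0_norm t0) -sqrtr_sqr ler_wsqrtr ?lerDl ?mulr_ge0//=.
  rewrite -[leRHS]ger0_norm ?addr_ge0// -sqrtr_sqr ler_wsqrtr//.
  by have := sqr_ge0 r; nra.
move=> x y yr xtr; have x0 := enorm_ge0 x; have e0 := enorm_ge0 (x - y).
have et : enorm (x - y) < t by have := enormB x y; lra.
have xe : enorm x <= enorm (x - y) + r by have := enorm_triangle (x - y) y; rewrite subrK yr.
rewrite !wave_kernelE et; case: ifP => [_|_]; last first.
  by case: ifP => // _; rewrite mulr_ge0 ?isqrt_ge0// ltW.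
case: ifP => // _; rewrite ler_wpM2l ?(ltW c0)//; apply: isqrt_le.
  by rewrite subr_sqr mulr_gt0 ?subr_gt0//; lra.
rewrite (sqr_sqrtr q0); move: x0 e0 et xe xtr; move: (enorm x) (enorm (x - y)) => u e.
move=> u0 e0 et ue utr; have [ur|ru] := leP u r; nra.
Qed.

End WaveKernel.

(** * The mapping bound in an abstract Lebesgue model *)

Section Increment.
Context {R : realType} {d : nat} {dT} {T : measurableType dT}.
Context {m : {sigma_finite_measure set T -> \bar R}}.
Context {io : T -> 'rV[R]_d} {oi : 'rV[R]_d -> T}.
Local Notation E := 'rV[R]_d.
Hypothesis M : lebesgue_model m io oi.
Local Notation G := (@wave_kernel R d).
Local Notation rho := (wave_rho R d).

Lemma wave_kernel_mfun t : measurable_fun [set: T] (G t \o io).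
Proof.
have me : measurable_fun [set: T] (enorm \o io) := model_cont M (@enorm_continuous R d).
apply: measurable_fun_ifT => //; first exact: measurable_fun_ltr.
case: (d == 1%N) => //=; apply: measurable_funM => //.
apply: (measurableT_comp measurable_isqrt); apply: measurable_funB => //.
exact: measurable_funX.
Qed.

Lemma wave_rho01 : 0 < rho <= 1.
Proof. by rewrite /wave_rho; case: ifP => _; rewrite ?ltr01 ?lexx//; apply/andP; split; lra. Qed.

Variables (A : R).
Hypothesis A0 : 0 < A.
Hypothesis annulus : forall s t, 0 <= s -> s <= t -> t <= 2 ->
  (\int[m]_x (outer G s t (io x))%:E <= (A * (t - s) `^ rho)%:E)%E.
Hypothesis mass : forall s t, 0 <= s -> s <= t ->
  (\int[m]_x (G s (io x))%:E <= \int[m]_x (G t (io x))%:E)%E.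

Lemma wave_increment_le (L : nat) (phi0 : E -> R) (mustar alpha kappa p : R) (q : \bar R) :
  (1 <= L)%N -> admissible L phi0 -> alpha <= 0 -> 1 < p -> (1 < q)%E ->
  0 <= kappa <= rho ->
  exists C : R, forall mu : R, 0 <= mu <= mustar ->
    forall s t : R, 0 <= s -> s < t -> t <= 1 ->
    forall f : set (nat -> E -> R), besov phi0 alpha mu p q f ->
      besov phi0 (alpha + kappa) mu p q
        (wave_increment phi0 (alpha + kappa) mu p q s t f) /\
      (besov_space_norm phi0 (alpha + kappa) mu p q
         (wave_increment phi0 (alpha + kappa) mu p q s t f)
       <= (C * `|t - s| `^ (rho - kappa))%:E * besov_space_norm phi0 alpha mu p q f)%E.
Proof.
move=> L1 phi0A alpha0 p1 q1 kr; have /andP[rho0 rho1] := wave_rho01.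
have k01 : 0 <= kappa <= 1 by move: kr => /andP[-> /le_trans->].
have [Cb Cb0 Hb] := besov_conv_le M L1 phi0A mustar p1 alpha0 k01 q1.
exists (Cb * 12 * A) => mu muM s t s0 st t1 f Bf.
have /andP[mu0 _] := muM.
have dt : 0 < t - s by rewrite subr_gt0.
have [Ki K1 KH Kw] := kernel_increment M rho0 A0 wave_kernel_mfun wave_kernel_ge0
  wave_kernel_out wave_kernel_anti annulus mass wave_kernel_shift kr s0 st t1.
set H := 12 * A * _ in KH Kw; pose K x := G t x - G s x.
have H0 : 0 < H by rewrite !mulr_gt0// powR_gt0.
have Kr : exists2 r, 0 < r & vanish_outside r K by exists 1.
(* The kernels at times s and t are integrable, so the increment of the operators is convolution
   with the single kernel [K]. *)
have TE (g : E -> R) : test_function g -> wave_op t g - wave_op s g = convolution K g.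
  move=> tg; apply/esym; apply: (convBl M _ _ (test_bmfun M tg)).
    by apply: (G_L1 M (rho := rho) (A := A)) => //; [exact: wave_kernel_mfun|
      exact: wave_kernel_ge0|lra|lra].
  by apply: (G_L1 M (rho := rho) (A := A)) => //; [exact: wave_kernel_mfun|
      exact: wave_kernel_ge0|lra].
have CH : (Cb * H = Cb * 12 * A * `|t - s| `^ (rho - kappa))%R.
  by rewrite gtr0_norm// /H !mulrA.
rewrite -CH.
have sn a := besov_seminorm M phi0A mu0 p1 a q1.
have T1 (g : E -> R) : test_function g -> test_function (wave_op t g - wave_op s g).
  by move=> tg; rewrite TE//; exact: (test_conv M Ki Kr tg).
have T2 (g h : E -> R) : test_function g -> test_function h ->
    wave_op t (g - h) - wave_op s (g - h) =
    (wave_op t g - wave_op s g) - (wave_op t h - wave_op s h).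
  move=> tg th; rewrite (TE _ tg) (TE _ th) (TE _ (testB tg th)).
  exact: (convBr M Ki (test_bmfun M tg) (test_bmfun M th)).
have T3 (g : E -> R) : test_function g ->
    (besov_norm phi0 (alpha + kappa) mu p q (wave_op t g - wave_op s g)%R <=
     (Cb * H)%:E * besov_norm phi0 alpha mu p q g)%E.
  by move=> tg; rewrite (TE _ tg); exact: (Hb mu K H muM H0 Ki K1 KH Kw g tg).
exact: (extend_by_continuity_bounded (sn alpha) (sn (alpha + kappa)) (mulr_gt0 Cb0 H0) T1 T2 T3 Bf).
Qed.

End Increment.

(** * Annulus and mass estimates for d = 1 *)

Section LineKernel.
Context {R : realType}.
Local Notation T := (measurableTypeR R).
Local Notation leb := (@lebesgue_measure R).
Local Notation G := (@wave_kernel R 1).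
Implicit Types (s t : R).

Lemma line_mass s t : 0 <= s -> s <= t ->
  (\int[leb]_x (G s (io1 x))%:E <= \int[leb]_x (G t (io1 x))%:E)%E.
Proof.
move=> s0 st; apply: ge0_le_integral => //.
- by move=> x _; rewrite lee_fin wave_kernel_ge0.
- by apply/measurable_EFinP; exact: (wave_kernel_mfun line_model s).
- by apply/measurable_EFinP; exact: (wave_kernel_mfun line_model t).
move=> x _; rewrite lee_fin /wave_kernel /=; case: ifP => [xs|_].
  by rewrite (lt_le_trans xs st).
by case: ifP.
Qed.

(** The annulus lies in two intervals of length t - s, and the kernel is at most 1/2 there, so the
    constant is 1. *)
Lemma line_annulus s t : 0 <= s -> s <= t -> t <= 2 ->
  (\int[leb]_x (outer G s t (io1 x))%:E <= (1 * (t - s) `^ wave_rho R 1)%:E)%E.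
Proof.
move=> s0 st t2; pose P : set T := `[- t, - s]%classic; pose Q : set T := `[s, t]%classic.
have mP : measurable P by exact: measurable_itv.
have mQ : measurable Q by exact: measurable_itv.
have mP1 : measurable_fun [set: T] (fun x : T => (\1_P x)%:E : \bar R).
  by apply/measurable_EFinP; exact: measurable_indic.
have mQ1 : measurable_fun [set: T] (fun x : T => (\1_Q x)%:E : \bar R).
  by apply/measurable_EFinP; exact: measurable_indic.
apply: (@le_trans _ _ (\int[leb]_x ((2^-1)%:E * ((\1_P x)%:E + (\1_Q x)%:E)))%E).
  apply: ge0_le_integral => //.
  - by move=> x _; rewrite lee_fin outer_ge0//; exact: wave_kernel_ge0.
  - by apply/measurable_EFinP; exact: (outer_mfun line_model (wave_kernel_mfun line_model)).
  - by apply: measurable_funeM; exact: emeasurable_funD.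
  move=> x _; rewrite -EFinD -EFinM lee_fin /outer /wave_kernel /= !enorm_io1.
  case: ifP => [sx|_]; last by rewrite mulr_ge0 ?addr_ge0.
  case: ifP => [xt|_]; last by rewrite mulr_ge0 ?addr_ge0.
  rewrite ler_peMr// !indicE; have [x0|x0] := leP 0 x.
    rewrite [x \in Q]mem_set ?lerDr//.
    by move: sx xt; rewrite ger0_norm// /Q /= in_itv/= => -> /ltW->.
  rewrite [x \in P]mem_set ?lerDl//.
  move: sx xt; rewrite ltr0_norm// /P /= in_itv/= => sx xt.
  by apply/andP; split; lra.
rewrite ge0_integralZl//; last 2 first.
- exact: emeasurable_funD.
- by move=> x _; rewrite adde_ge0// lee_fin.
rewrite ge0_integralD//.
rewrite !integral_indic//= !setIT.
have -> : leb P = (t - s)%:E.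
  by rewrite (lebesgue_itvcc (a := - t)) ?lerN2//; congr (_%:E); lra.
rewrite (lebesgue_itvcc st) -EFinD -EFinM lee_fin /wave_rho /= powRr1 ?subr_ge0//.
by lra.
Qed.

End LineKernel.

(** * Annulus and mass estimates for d = 2 *)

Section PlaneKernel.
Context {R : realType}.
Local Notation T := (measurableTypeR R).
Local Notation leb := (@lebesgue_measure R).
Local Notation leb2 := (@plane_measure R).
Local Notation G := (@wave_kernel R 2).
Implicit Types (s t : R).

Let c : R := (2 * pi)^-1.

Let c0 : 0 < c. Proof. by rewrite invr_gt0 mulr_gt0// pi_gt0. Qed.

(** The planar kernel is homogeneous: G_s(z) = l G_t(l z) with l = t / s. As dilation by l
    contributes l^2, the mass at time t is l >= 1 times the mass at time s. The time s = 0, where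
    the kernel vanishes, is treated apart. *)
Lemma plane_mass s t : 0 <= s -> s <= t ->
  (\int[leb2]_x (G s (io2 x))%:E <= \int[leb2]_x (G t (io2 x))%:E)%E.
Proof.
rewrite le_eqVlt => /predU1P[<- _|s0 st].
  rewrite integral0_eq; last by move=> x _; rewrite wave_kernel_out ?enorm_ge0.
  by apply: integral_ge0 => x _; rewrite lee_fin wave_kernel_ge0.
have t0 := lt_le_trans s0 st; pose l := t / s.
have l0 : 0 < l by rewrite divr_gt0.
have l1 : 1 <= l by rewrite ler_pdivlMr// mul1r.
have lst : l * s = t by rewrite /l -mulrA mulVf ?mulr1// gt_eqF.
pose F (z : T * T) : \bar R := (G t (io2 z))%:E.
have mF : measurable_fun [set: T * T] F.
  by apply/measurable_EFinP; exact: (wave_kernel_mfun plane_model t).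
have F0 z : (0 <= F z)%E by rewrite lee_fin wave_kernel_ge0.
have ml : measurable_fun [set: T] ((fun x => l * x) : T -> T) by exact: measurable_funM.
have scale (h : R -> \bar R) : measurable_fun [set: T] (h : T -> \bar R) ->
    (forall x, 0 <= h x)%E -> (l%:E * \int[leb]_x h (l * x)%R = \int[leb]_x h x)%E.
  move=> mh h0; rewrite -[RHS](integral_affine 0 l0 mh)//.
  by congr (_ * _)%E; apply: eq_integral => x _; rewrite add0r.
have HF := integral_plane (ltW l0) (ltW l0) ml ml scale scale mF F0.
apply: (@le_trans _ _ ((l * l)%:E * \int[(leb \x leb)%E]_z F (l * z.1, l * z.2)%R)%E); last first.
  by rewrite HF.
have mFl : measurable_fun [set: T * T] (fun z => F (l * z.1, l * z.2)%R).
  apply: (measurableT_comp mF); apply: measurable_fun_pair; exact: measurable_funM.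
have E z : ((G s (io2 z))%:E = l%:E * F (l * z.1, l * z.2)%R)%E.
  rewrite /F -EFinM; congr (_%:E); rewrite !wave_kernelE /=.
  have -> : io2 (l * z.1, l * z.2)%R = l *: io2 z by apply: row2_eq; rewrite !mxE.
  rewrite enormZ gtr0_norm// -lst ltr_pM2l//; case: ifP => _; last by rewrite mulr0.
  rewrite (_ : (l * s) ^+ 2 - _ = l ^+ 2 * (s ^+ 2 - enorm (io2 z) ^+ 2)); last by ring.
  rewrite (isqrtM _ (sqr_ge0 l)) [isqrt (l ^+ 2)]/isqrt sqrtr_sqr gtr0_norm//.
  by rewrite mulrCA [l * _]mulrA mulfV ?mul1r// gt_eqF.
have -> : (\int[leb2]_x (G s (io2 x))%:E = l%:E * \int[leb2]_z F (l * z.1, l * z.2)%R)%E.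
  by rewrite -ge0_integralZl ?lee_fin ?(ltW l0)//; apply: eq_integral => z _; exact: E.
rewrite lee_wpmul2r ?lee_fin ?ler_peMr ?(ltW l0)//.
exact: integral_ge0.
Qed.

(** On the slice at abscissa x the annulus becomes b <= |y| < a with a^2 = t^2 - x^2 and a^2 - b^2
    <= t^2 - s^2, so [integral_ring] gives 4 c D / a. The factor 1 / a is again an inverse square
    root, now in x on |x| < t, and a second use of [integral_ring] with b = 0 gives 4; hence 16 = 4
    * 4. *)
Lemma plane_annulus_sqrt s t : 0 <= s -> s <= t ->
  (\int[leb2]_x (outer G s t (io2 x))%:E <= (16 * c * Num.sqrt (t ^+ 2 - s ^+ 2))%:E)%E.
Proof.
move=> s0 st; have t0 := le_trans s0 st.
have mO : measurable_fun [set: T * T] (fun z => (outer G s t (io2 z))%:E : \bar R).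
  by apply/measurable_EFinP; exact: (outer_mfun plane_model (wave_kernel_mfun plane_model)).
have O0 (z : T * T) : (0 <= (outer G s t (io2 z))%:E)%E.
  by rewrite lee_fin outer_ge0//; exact: wave_kernel_ge0.
have [t00|tpos] := leP t 0.
  rewrite integral0_eq ?lee_fin ?mulr_ge0 ?sqrtr_ge0 ?(ltW c0)// => z _.
  rewrite /outer wave_kernel_out ?(le_trans t00) ?enorm_ge0//; by case: ifP.
rewrite [leLHS](fubini_tonelli1 _ mO O0) /fubini_F /=.
pose D := Num.sqrt (t ^+ 2 - s ^+ 2); have D0 : 0 <= D by exact: sqrtr_ge0.
pose ringf (a b y : R) : R := if (b <= `|y|) && (`|y| < a) then isqrt (a ^+ 2 - y ^+ 2) else 0.
have ringf0 a b y : 0 <= ringf a b y by rewrite /ringf; case: ifP => // _; exact: isqrt_ge0.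
have mring a b : measurable_fun [set: T] (fun y : T => (ringf a b y)%:E : \bar R).
  apply/measurable_EFinP; apply: measurable_fun_ifT => //.
    apply: measurable_and; first exact: measurable_fun_ler.
    exact: measurable_fun_ltr.
  apply: (measurableT_comp measurable_isqrt); apply: measurable_funB; first exact: measurable_cst.
  exact: exprn_measurable.
have inner (x : T) : (\int[leb]_y (outer G s t (io2 (x, y)))%:E <=
    (4 * c * D)%:E * (ringf t 0 x)%:E)%E.
  rewrite /ringf normr_ge0 /=; have [xt|tx] := ltP `|x| t; last first.
    rewrite mule0 integral0_eq// => y _; rewrite /outer wave_kernel_out; first by case: ifP.
    rewrite (le_trans tx)//; have := coord_le_enorm (io2 (x, y)) ord0.
    by rewrite mxE.
  have a2 : 0 < t ^+ 2 - x ^+ 2.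
    by rewrite subr_gt0 -[x ^+ 2]real_normK ?num_real// ltr_pXn2r ?nnegrE.
  (* The maximum with 0 covers the slices with |x| >= s, which miss the inner disc. *)
  pose a := Num.sqrt (t ^+ 2 - x ^+ 2); pose b2 := Num.max (s ^+ 2 - x ^+ 2) 0.
  have b20 : 0 <= b2 by rewrite le_max lexx orbT.
  pose b := Num.sqrt b2.
  have a0 : 0 < a by rewrite sqrtr_gt0.
  have s2t2 : s ^+ 2 <= t ^+ 2 by rewrite ler_sqr ?nnegrE.
  have aE : a ^+ 2 = t ^+ 2 - x ^+ 2 by rewrite sqr_sqrtr// ltW.
  have bE : b ^+ 2 = b2 by rewrite sqr_sqrtr.
  have ba : b <= a by rewrite ler_wsqrtr// ge_max lerD2r s2t2 ltW.
  have abD : a ^+ 2 - b ^+ 2 <= t ^+ 2 - s ^+ 2.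
    have : s ^+ 2 - x ^+ 2 <= b2 by rewrite le_max lexx.
    by rewrite aE bE; lra.
  apply: (@le_trans _ _ (\int[leb]_y (c%:E * (ringf a b y)%:E))%E).
    apply: ge0_le_integral => //.
    - exact: (measurable_fun_pair2 x mO).
    - by apply: measurable_funeM; exact: mring.
    move=> y _; rewrite -EFinM lee_fin /outer /wave_kernel /=.
    have e2 : enorm (io2 (x, y)) ^+ 2 = x ^+ 2 + y ^+ 2.
      by rewrite enorm_io2 sqr_sqrtr// addr_ge0 ?sqr_ge0.
    have cr0 : 0 <= c * ringf a b y by rewrite mulr_ge0 ?ringf0// ltW.
    case: ifP => // se; case: ifP => // et; rewrite e2.
    have : s ^+ 2 <= x ^+ 2 + y ^+ 2 by rewrite -e2 ler_sqr ?nnegrE ?enorm_ge0.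
    have : x ^+ 2 + y ^+ 2 < t ^+ 2 by rewrite -e2 ltr_sqr ?nnegrE ?enorm_ge0.
    move=> yt sy; rewrite /ringf ifT; first by rewrite aE opprD addrA.
    apply/andP; split; rewrite -[`|y|]ger0_norm// -sqrtr_sqr real_normK ?num_real//.
      by apply: ler_wsqrtr; rewrite ge_max sqr_ge0 andbT lerBlDl.
    by rewrite ltr_sqrt// ltrBrDl.
  rewrite ge0_integralZl//; last 2 first.
  - by move=> y _; rewrite lee_fin ringf0.
  - by rewrite lee_fin ltW.
  apply: (le_trans (lee_wpmul2l _ (integral_ring (sqrtr_ge0 b2) ba a0))).
    by rewrite lee_fin ltW.
  rewrite -!EFinM lee_fin -/a /isqrt -/a.
  have H : Num.sqrt (a ^+ 2 - b ^+ 2) <= D by exact: ler_wsqrtr.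
  rewrite [leLHS](_ : _ = 4 * c * a^-1 * Num.sqrt (a ^+ 2 - b ^+ 2)); last by ring.
  rewrite [leRHS](_ : _ = 4 * c * a^-1 * D); last by ring.
  have Q0 : 0 <= 4 * c / a by rewrite (divr_ge0 _ (ltW a0))// mulr_ge0// ltW.
  exact: ler_wpM2l.
apply: (@le_trans _ _ (\int[leb]_x ((4 * c * D)%:E * (ringf t 0 x)%:E))%E).
  apply: ge0_le_integral => //.
  - by move=> x _; exact: integral_ge0.
  - exact: (measurable_fun_fubini_tonelli_F _ mO O0).
  - by apply: measurable_funeM; exact: mring.
have cD : 0 <= 4 * c * D by rewrite !mulr_ge0// ltW.
rewrite ge0_integralZl//; last first.
  by move=> y _; rewrite lee_fin ringf0.
apply: (le_trans (lee_wpmul2l _ (integral_ring (lexx 0) t0 tpos))); first by rewrite lee_fin.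
rewrite -EFinM lee_fin expr0n subr0 sqrtr_sqr ger0_norm// -[4 * t / t]mulrA mulfV ?gt_eqF//.
rewrite mulr1 -/D le_eqVlt; apply/orP; left; apply/eqP; ring.
Qed.

Lemma plane_annulus s t : 0 <= s -> s <= t -> t <= 2 ->
  (\int[leb2]_x (outer G s t (io2 x))%:E <= (32 * c * (t - s) `^ wave_rho R 2)%:E)%E.
Proof.
move=> s0 st t2; apply: (le_trans (plane_annulus_sqrt s0 st)); rewrite lee_fin.
rewrite /wave_rho /= powR12_sqrt ?subr_ge0//.
(* t^2 - s^2 = (t - s)(t + s) <= 4 (t - s) since s <= t <= 2; the resulting factor 2 turns 16 c into
   32 c. *)
have : Num.sqrt (t ^+ 2 - s ^+ 2) <= 2 * Num.sqrt (t - s).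
  have -> : 2 = Num.sqrt 4 :> R by rewrite (_ : 4 = 2 ^+ 2) ?sqrtr_sqr ?ger0_norm//; ring.
  by rewrite -sqrtrM// ler_wsqrtr// subr_sqr mulrC ler_wpM2r ?subr_ge0//; lra.
move: c0 (Num.sqrt _) (Num.sqrt _) => c0' u v; nra.
Qed.

Lemma plane_annulus_gt0 : 0 < 32 * c. Proof. by rewrite mulr_gt0. Qed.

End PlaneKernel.

Theorem corollary3p7 (R : realType) (d : nat) (hd : d = 1%N \/ d = 2%N)
    (L : nat) (hL : (1 <= L)%N)
    (phi0 : 'rV[R]_d -> R) (hphi0 : admissible L phi0)
    (mustar : R) (hmustar : 0 < mustar)
    (alpha kappa p : R) (q : \bar R)
    (halpha : alpha <= 0) (hp : 1 < p) (hq : (1 < q)%E)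
    (hkappa : 0 <= kappa <= wave_rho R d) :
  exists C : R, forall mu : R, 0 <= mu <= mustar ->
    forall s t : R, 0 <= s -> s < t -> t <= 1 ->
    forall f : set (nat -> 'rV[R]_d -> R), besov phi0 alpha mu p q f ->
      besov phi0 (alpha + kappa) mu p q
        (wave_increment phi0 (alpha + kappa) mu p q s t f) /\
      (besov_space_norm phi0 (alpha + kappa) mu p q
         (wave_increment phi0 (alpha + kappa) mu p q s t f)
       <= (C * `|t - s| `^ (wave_rho R d - kappa))%:E
          * besov_space_norm phi0 alpha mu p q f)%E.
Proof.
case: hd => hd; subst d.
  by apply: (wave_increment_le line_model ltr01 line_annulus line_mass mustar hL).
by apply: (wave_increment_le plane_model plane_annulus_gt0 plane_annulus plane_mass mustar hL).
Qed.
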